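(* Let $1\le i\le n$, let $m\ge0$ be an integer and let $w\in W^i$. Then the Demazure module $V_w(m\omega_i)$, with cyclic generator $v_{w(m\omega_i)}$, is a favourable $\mathbb U$-module.
   Context: $\mathfrak{sl}_{n+1}(\mathbb C)=\mathfrak n^+\oplus\mathfrak h\oplus\mathfrak n^-$, $W=S_{n+1}$, $W^i=S_{n+1}/(S_i\times S_{n+1-i})$ with cosets identified with minimal length representatives. $\mathbb U$ is the group of unipotent upper triangular matrices, with Lie algebra $\mathfrak n^+$. For $w\in W^i$, $v_{w(m\omega_i)}$ spans the one-dimensional weight space of weight $w(m\omega_i)$ in the simple module $V(m\omega_i)$, and $V_w(m\omega_i)=U(\mathfrak h\oplus\mathfrak n^+).v_{w(m\omega_i)}=U(\mathfrak n^+).v_{w(m\omega_i)}$. Favourable modules. Let $M=U(\mathfrak n^+).v$ be a cyclic finite-dimensional $\mathbb U$-module. Fix a total order on the positive roots, giving an ordered basis $x_1,\dots,x_N$ of $\mathfrak n^+$ consisting of root vectors ($N=\dim\mathfrak n^+$), and the induced homogeneous lexicographic order $\preceq$ on exponents $\mathbf p\in\mathbb Z_{\ge0}^N$ (compare total degree first, then lexicographically). Write $x^{\mathbf p}=x_1^{p_1}\cdots x_N^{p_N}\in U(\mathfrak n^+)$ and set $M^{\preceq\mathbf p}=\langle x^{\mathbf q}.v\mid\mathbf q\preceq\mathbf p\rangle_{\mathbb C}$, $M^{\prec\mathbf p}=\langle x^{\mathbf q}.v\mid\mathbf q\prec\mathbf p\rangle_{\mathbb C}$. The exponent $\mathbf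 p$ is essential if $M^{\preceq\mathbf p}/M^{\prec\mathbf p}\ne0$; $es(M)\subset\mathbb Z_{\ge0}^N$ is the set of essential exponents. $M$ is called favourable if, for some such choice of order, there exists a normal convex lattice polytope $P(M)\subset\mathbb R^N$ whose set $S(M)$ of lattice points equals $es(M)$, and for all $r\ge1$ $$|rS(M)|=\dim U(\mathfrak n^+).v^{\otimes r}\subset M^{\otimes r},$$ where $rS(M)$ is the $r$-fold Minkowski sum of $S(M)$ (equivalently, by normality, the set of lattice points of $rP(M)$). A lattice polytope $P$ is normal if for all $r\ge1$ every lattice point of $rP$ is a sum of $r$ lattice points of $P$. *)

(* Defs.v *)
From mathcomp Require Import all_boot all_order all_algebra all_fingroup.
From mathcomp Require Import boolp classical_sets cardinality reals.
From mathcomp Require Import complex.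

Set Implicit Arguments.
Unset Strict Implicit.
Unset Printing Implicit Defensive.

Import Order.TTheory GRing.Theory Num.Theory.

Local Open Scope classical_set_scope.
Local Open Scope ring_scope.

Lemma lspan_subproof (K : fieldType) (V : vectType K) (A : set V) :
  exists U : {vspace V}, A `<=` [set` U] /\
    forall W : {vspace V}, A `<=` [set` W] -> (U <= W)%VS.
Proof.
pose P d := `[< exists s : seq V, [set` s] `<=` A /\ \dim <<s>> = d >].
have exP : exists d, P d.
  by exists (\dim (<<[::]>> : {vspace V})); apply/asboolP; exists [::].
have ubP d : P d -> (d <= \dim {:V})%N.
  by move=> /asboolP[s [_ <-]]; apply/dimvS/subvf.
have [d /asboolP[s [sA sd]] maxd] := ex_maxnP exP ubP.
exists <<s>>%VS; split=> [u Au /=|W AW]; last first.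
  by apply/span_subvP => u us; apply/AW/sA.
have sub_us : (<<s>> <= <<u :: s>>)%VS.
  by apply: sub_span => x xs; rewrite inE xs orbT.
have : (\dim <<u :: s>> <= \dim <<s>>)%N.
  rewrite sd; apply: maxd; apply/asboolP; exists (u :: s); split=> // x /=.
  by rewrite inE => /predU1P[->|/sA].
rewrite (geq_leqif (dimv_leqif_sup sub_us)) => /subvP; apply.
by rewrite memv_span ?mem_head.
Qed.

(* the linear span of an arbitrary set of vectors: the smallest subspace
   containing it *)
Definition lspan (K : fieldType) (V : vectType K) (A : set V) : {vspace V} :=
  projT1 (cid (lspan_subproof A)).

(* Rank convention: [sln C n] is sl_{n+1}. *)
Definition sln (C : fieldType) n : {pred 'M[C]_n.+1} := [pred X | \tr X == 0].

Definition cartan (C : fieldType) n : {pred 'M[C]_n.+1} :=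
  [pred X | (\tr X == 0) && is_diag_mx X].

Definition nplus (C : fieldType) n : {pred 'M[C]_n.+1} :=
  [pred X : 'M[C]_n.+1 |
     [forall a : 'I_n.+1, forall b : 'I_n.+1, (b <= a)%N ==> (X a b == 0)]].

(* h + n^+ *)
Definition borel (C : fieldType) n : {pred 'M[C]_n.+1} :=
  [pred X : 'M[C]_n.+1 | (\tr X == 0) &&
     [forall a : 'I_n.+1, forall b : 'I_n.+1, (b < a)%N ==> (X a b == 0)]].

Definition stable (C : fieldType) n (V : vectType C) (g : {pred 'M[C]_n.+1})
    (act : 'M[C]_n.+1 -> V -> V) (M : {vspace V}) : Prop :=
  forall X u, X \in g -> u \in M -> act X u \in M.

(* [act] makes the subspace [M] a module over the Lie algebra [g]; the values
   of [act] outside g x M are irrelevant. *)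
Definition lie_module (C : fieldType) n (V : vectType C)
    (g : {pred 'M[C]_n.+1}) (act : 'M[C]_n.+1 -> V -> V) (M : {vspace V}) :
    Prop :=
  [/\ stable g act M,
      {in g, forall X, {in M &, forall u v, forall c : C,
        act X (c *: u + v) = c *: act X u + act X v}},
      {in g &, forall X Y, {in M, forall u, forall c : C,
        act (c *: X + Y) u = c *: act X u + act Y u}} &
      {in g &, forall X Y, {in M, forall u,
        act (X *m Y - Y *m X) u = act X (act Y u) - act Y (act X u)}}].

Definition simple_module (C : fieldType) n (V : vectType C)
    (g : {pred 'M[C]_n.+1}) (act : 'M[C]_n.+1 -> V -> V) : Prop :=
  [/\ lie_module g act fullv, (fullv : {vspace V}) != 0%VS &
      forall U : {vspace V}, stable g act U -> U = 0%VS \/ U = fullv].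

(* U(g).v: the span of the vectors X_1 ... X_k v with all X_j in g *)
Definition Ug (C : fieldType) n (V : vectType C) (g : {pred 'M[C]_n.+1})
    (act : 'M[C]_n.+1 -> V -> V) (v : V) : {vspace V} :=
  lspan [set u | exists2 s : seq 'M[C]_n.+1,
                   all (mem g) s & u = foldr act v s].

(* [lam] stands for the restriction to h of \sum_j lam_j e_j, where e_j is
   the j-th diagonal entry. *)
Definition weight n := {ffun 'I_n.+1 -> int}.

Definition weight_eval (C : fieldType) n (lam : weight n) (H : 'M[C]_n.+1) :
    C :=
  \sum_j (lam j)%:~R * H j j.

(* omega_i = e_0 + ... + e_{i-1} *)
Definition fundamental_weight n (i : nat) : weight n :=
  [ffun j : 'I_n.+1 => ((j < i)%N : nat)%:Z].

(* determined by w(e_j) = e_{w j} *)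
Definition weyl_act n (w : 'S_n.+1) (lam : weight n) : weight n :=
  [ffun j => lam (w^-1%g j)].

Definition weight_vector (C : fieldType) n (V : vectType C)
    (act : 'M[C]_n.+1 -> V -> V) (lam : weight n) (u : V) : Prop :=
  u != 0 /\ {in @cartan C n, forall H, act H u = weight_eval lam H *: u}.

(* (V, act) is the simple sl_{n+1}-module V(lam) *)
Definition simple_hw_module (C : fieldType) n (V : vectType C)
    (act : 'M[C]_n.+1 -> V -> V) (lam : weight n) : Prop :=
  simple_module (@sln C n) act /\
  exists2 u : V, weight_vector act lam u &
    {in @nplus C n, forall X, act X u = 0}.

(* the transposition of j and j+1 *)
Definition simple_reflection n (j : 'I_n) : 'S_n.+1 :=
  tperm (widen_ord (leqnSn n) j) (lift ord0 j).

Lemma weyl_length_subproof n (w : 'S_n.+1) :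
  exists l, [exists t : l.-tuple 'I_n,
    w == (\prod_(j <- t) simple_reflection j)%g].
Proof.
suff [s ->] : exists s : seq 'I_n, w = (\prod_(j <- s) simple_reflection j)%g.
  by exists (size s); apply/existsP; exists (in_tuple s).
have cat_ex (x y : 'S_n.+1) :
    (exists s : seq 'I_n, x = (\prod_(j <- s) simple_reflection j)%g) ->
    (exists s : seq 'I_n, y = (\prod_(j <- s) simple_reflection j)%g) ->
    exists s : seq 'I_n, (x * y)%g = (\prod_(j <- s) simple_reflection j)%g.
  by move=> [s ->] [t ->]; exists (s ++ t); rewrite big_cat.
have tp_ex d (a b : 'I_n.+1) : b = (a + d.+1)%N :> nat ->
    exists s : seq 'I_n,
      tperm a b = (\prod_(j <- s) simple_reflection j)%g.
  elim: d a b => [|d IHd] a b bE.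
    have an : (a < n)%N by rewrite -ltnS (leq_trans _ (ltn_ord b)) // bE addn1.
    exists [:: Ordinal an]; rewrite big_seq1 /simple_reflection.
    by congr tperm; apply: val_inj; rewrite //= bE /bump leq0n add1n addn1.
  have cn : (a + d.+1 < n)%N.
    by rewrite -ltnS (leq_trans _ (ltn_ord b)) // bE !addnS.
  pose c : 'I_n.+1 := widen_ord (leqnSn n) (Ordinal cn).
  have cb : exists s : seq 'I_n,
      tperm c b = (\prod_(j <- s) simple_reflection j)%g.
    exists [:: Ordinal cn]; rewrite big_seq1 /simple_reflection.
    by congr tperm; apply: val_inj; rewrite //= bE /bump leq0n add1n addnS.
  have -> : tperm a b = (tperm c b * (tperm a c * tperm c b))%g.
    have ac : a != c by rewrite -val_eqE /= neq_ltn addnS ltnS leq_addr.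
    have ab : a != b by rewrite -val_eqE /= bE neq_ltn addnS ltnS leq_addr.
    rewrite -[X in (X * _)%g]tpermV -conjgE tpermJ tpermL tpermD //.
      by rewrite eq_sym.
    by rewrite eq_sym.
  by apply: (cat_ex) => //; apply: (cat_ex) => //; apply: IHd.
have [ts -> /allP dts] := prod_tpermP w.
elim: ts dts => [|[a b] ts IHts] dts.
  by rewrite big_nil; exists [::]; rewrite big_nil.
rewrite big_cons; apply: cat_ex; last first.
  by apply: IHts => x xts; apply: dts; rewrite inE xts orbT.
have := dts _ (mem_head _ _); rewrite /dpair /= neq_ltn => /orP[ab|ba].
  by apply: (tp_ex (b - a).-1); rewrite prednK ?subn_gt0 // subnKC // ltnW.
rewrite tpermC.
by apply: (tp_ex (a - b).-1); rewrite prednK ?subn_gt0 // subnKC // ltnW.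
Qed.

Definition weyl_length n (w : 'S_n.+1) : nat :=
  ex_minn (weyl_length_subproof w).

(* S_i x S_{n+1-i} *)
Definition parabolic n (i : nat) : {pred 'S_n.+1} :=
  [pred u : 'S_n.+1 | [forall j : 'I_n.+1, (u j < i)%N == (j < i)%N]].

(* w is the minimal length representative of its coset in
   S_{n+1} / (S_i x S_{n+1-i}). As (u * w)%g j = w (u j), the coset
   {w o u} is {u * w}. *)
Definition minimal_rep n (i : nat) (w : 'S_n.+1) : Prop :=
  {in @parabolic n i, forall u, (weyl_length w <= weyl_length (u * w)%g)%N}.

Definition demazure (C : fieldType) n (V : vectType C)
    (act : 'M[C]_n.+1 -> V -> V) (v : V) : {vspace V} :=
  Ug (@borel C n) act v.

(* A finite dimensional (algebraic) module over the group of unipotent upper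
   triangular matrices is the same thing as an n^+-module on which every
   element of n^+ acts nilpotently. *)
Definition unipotent_module (C : fieldType) n (V : vectType C)
    (act : 'M[C]_n.+1 -> V -> V) (M : {vspace V}) : Prop :=
  lie_module (@nplus C n) act M /\
  {in @nplus C n, forall X, exists k,
    {in M, forall u, iter k (act X) u = 0}}.

(* Tensor powers, in coordinates with respect to the basis vbasis V: the
   value of a tensor at t is its coefficient at the basis tensor
   b_(t 0) (x) ... (x) b_(t (r-1)). *)
Definition tensor (C : fieldType) (V : vectType C) (r : nat) : vectType C :=
  {ffun {ffun 'I_r -> 'I_(\dim {:V})} -> C^o}.

Definition pure_tensor (C : fieldType) (V : vectType C) (r : nat)
    (u : 'I_r -> V) : tensor V r :=
  [ffun t : {ffun 'I_r -> 'I_(\dim {:V})} =>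
     \prod_k coord (vbasis {:V}) (t k) (u k)].

Definition tensor_act (C : fieldType) n (V : vectType C)
    (act : 'M[C]_n.+1 -> V -> V) (r : nat) (X : 'M[C]_n.+1)
    (T : tensor V r) : tensor V r :=
  [ffun t : {ffun 'I_r -> 'I_(\dim {:V})} =>
     \sum_(k < r) \sum_(j < \dim {:V})
       coord (vbasis {:V}) (t k) (act X (vbasis {:V})`_j)
       * (T : {ffun _}) [ffun l => if l == k then j else t l]].

(* Sanity check: [tensor_act] satisfies the Leibniz rule. *)
Lemma tensor_act_pure (C : fieldType) n (V : vectType C)
    (act : 'M[C]_n.+1 -> V -> V) (r : nat) (X : 'M[C]_n.+1) (u : 'I_r -> V) :
    (forall c x y, act X (c *: x + y) = c *: act X x + act X y) ->
  tensor_act act X (pure_tensor u) =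
  \sum_(k < r) pure_tensor (fun l => if l == k then act X (u l) else u l).
Proof.
move=> lin; apply/ffunP => t; rewrite sum_ffunE ffunE.
apply: eq_bigr => k _; rewrite ffunE (bigD1 k) //= eqxx.
have actE (x : V) : act X x =
    \sum_j coord (vbasis {:V}) j x *: act X (vbasis {:V})`_j.
  have act0 : act X 0 = 0.
    have := lin 1 0 0; rewrite !scale1r addr0 => /eqP.
    by rewrite -[X in X == _]addr0 (inj_eq (addrI _)) => /eqP <-.
  rewrite {1}(coord_vbasis (memvf x)).
  elim/big_rec2: _ => [|j y z _ <-]; first exact: act0.
  exact: lin.
rewrite {1}actE linear_sum mulr_suml; apply: eq_bigr => j _.
rewrite linearZ /= ffunE (bigD1 k) //= ffunE eqxx mulrCA mulrA.
congr (_ * _ * _); apply: eq_bigr => l lk.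
by rewrite ffunE (negPf lk).
Qed.

(* (a, b) stands for the positive root e_a - e_b, with root vector E_ab.
   Rescaling the root vectors does not change the essential exponents. *)
Definition posroot n := {ab : 'I_n.+1 * 'I_n.+1 | (ab.1 < ab.2)%N}.

Definition root_vector (C : fieldType) n (al : posroot n) : 'M[C]_n.+1 :=
  delta_mx (val al).1 (val al).2.

Notation npos n := #|{: posroot n}|.

Definition total_degree N (p : 'rV[nat]_N) : nat := (\sum_k p ord0 k)%N.

Definition hlex_lt N (p q : 'rV[nat]_N) : bool :=
  (total_degree p < total_degree q)%N ||
  (total_degree p == total_degree q) &&
  [exists k : 'I_N,
     [forall j : 'I_N, (j < k)%N ==> (p ord0 j == q ord0 j)] &&
     (p ord0 k < q ord0 k)%N].

Definition hlex_le N (p q : 'rV[nat]_N) : bool := (p == q) || hlex_lt p q.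

(* x_1^{p_1} ... x_N^{p_N} v, where x_k is the root vector of [beta k]; the
   bijection [beta] encodes the total order on the positive roots *)
Definition monomial_act (C : fieldType) n (V : vectType C)
    (act : 'M[C]_n.+1 -> V -> V) (beta : 'I_(npos n) -> posroot n)
    (p : 'rV[nat]_(npos n)) (v : V) : V :=
  foldr (fun k u => iter (p ord0 k) (act (root_vector C (beta k))) u) v
    (enum 'I_(npos n)).

Definition filt_le (C : fieldType) n (V : vectType C)
    (act : 'M[C]_n.+1 -> V -> V) (beta : 'I_(npos n) -> posroot n) (v : V)
    (p : 'rV[nat]_(npos n)) : {vspace V} :=
  lspan [set u | exists2 q, hlex_le q p & u = monomial_act act beta q v].

Definition filt_lt (C : fieldType) n (V : vectType C)
    (act : 'M[C]_n.+1 -> V -> V) (beta : 'I_(npos n) -> posroot n) (v : V)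
    (p : 'rV[nat]_(npos n)) : {vspace V} :=
  lspan [set u | exists2 q, hlex_lt q p & u = monomial_act act beta q v].

(* M^{<= p} / M^{< p} is nonzero, M^{< p} being a subspace of M^{<= p} *)
Definition essential (C : fieldType) n (V : vectType C)
    (act : 'M[C]_n.+1 -> V -> V) (beta : 'I_(npos n) -> posroot n) (v : V) :
    set 'rV[nat]_(npos n) :=
  [set p | filt_le act beta v p != filt_lt act beta v p].

Definition is_lattice_point (R : realType) N (x : 'rV[R]_N) : Prop :=
  forall j, x 0 j \is a Num.int.

Definition lattice_points (R : realType) N (P : set 'rV[R]_N) :
    set 'rV[R]_N :=
  [set x | P x /\ is_lattice_point x].

Definition convex_hull (R : realType) N (s : seq 'rV[R]_N) : set 'rV[R]_N :=
  [set x | exists c : 'I_(size s) -> R,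
     [/\ forall k, 0 <= c k, \sum_k c k = 1 & x = \sum_k c k *: s`_k]].

Definition lattice_polytope (R : realType) N (P : set 'rV[R]_N) : Prop :=
  exists2 s : seq 'rV[R]_N,
    {in s, forall x, is_lattice_point x} & P = convex_hull s.

Definition dilate (R : realType) N (r : nat) (P : set 'rV[R]_N) :
    set 'rV[R]_N :=
  [set r%:R *: x | x in P].

Definition minkowski (R : realType) N (r : nat) (A : set 'rV[R]_N) :
    set 'rV[R]_N :=
  [set x | exists2 f : 'I_r -> 'rV[R]_N,
     forall k, A (f k) & x = \sum_k f k].

Definition normal_polytope (R : realType) N (P : set 'rV[R]_N) : Prop :=
  forall r, (0 < r)%N ->
    lattice_points (dilate r P) `<=` minkowski r (lattice_points P).

Definition exponent_point (R : realType) N (p : 'rV[nat]_N) : 'rV[R]_N :=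
  map_mx (fun k : nat => k%:R) p.

(* [M], a subspace of the ambient space [V], is a favourable module over the
   unipotent group with cyclic generator [v]. The action on tensors is that on
   the tensor powers of V, of which the tensor powers of M are subspaces. *)
Definition favourable (R : realType) n (V : vectType R[i])
    (act : 'M[R[i]]_n.+1 -> V -> V) (M : {vspace V}) (v : V) : Prop :=
  [/\ unipotent_module act M,
      M = Ug (@nplus R[i] n) act v &
      exists2 beta : 'I_(npos n) -> posroot n, bijective beta &
      exists P : set 'rV[R]_(npos n),
      [/\ lattice_polytope P,
          normal_polytope P,
          lattice_points P = @exponent_point R (npos n) @` essential act beta v
        & forall r, (0 < r)%N ->
            (minkowski r (lattice_points P) #=
             `I_(\dim (Ug (@nplus R[i] n) (@tensor_act R[i] n V act r)
                          (pure_tensor (fun _ : 'I_r => v)))))%card]].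

(* Main.v *)
Require Import Defs.
From mathcomp Require Import all_boot all_order all_algebra all_fingroup.
From mathcomp Require Import boolp classical_sets cardinality reals complex.

(** Let [I] be the image under [w] of the first [i] indices. In the [i]-th
    exterior power of the natural module the extremal vector is the wedge of the
    basis vectors indexed by [I], and the root vector [E_ab] with [a < b] does
    not kill it exactly when [b] is in [I] and [a] is not. These root vectors
    commute, and all other positive root vectors kill the generator, also in
    [V(m omega_i)]; so the Demazure module is spanned by the commuting monomials
    in the roots that move an element of [I] out of [I] ([Ug_mon_span]).

    View such a root as the interval from [a] to [b], and order these intervals by
    inclusion. The claim is that, for a suitable order of the roots (by [a]
    increasing, then [b] decreasing, then all other roots), the essential
    exponents of [V_w(m omega_i)] are the exponents supported on these roots
    whose sum over each chain of intervals is at most [m], that is, the lattice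
    points of the [m]-fold dilation of a chain polytope. By Mirsky's argument
    ([chain_point_peel]) these are the sums of [m] indicators of antichains; so
    Minkowski sums add the levels [m], and the polytope is normal.

    Exponents violating a chain inequality are not essential ([straighten]). The
    rows and columns of a chain span a rectangle of positive roots, so a matrix
    of rank one with arbitrary entries on this rectangle belongs to the
    nilradical. Such a matrix acts on exterior powers with square zero, hence on
    [V(m omega_i)] with vanishing powers of order larger than [m]. The
    coefficients of this power, as a polynomial in the entries, are sums over
    transport matrices with prescribed margins, and among these the one
    supported on a chain is the largest ([staircase_max]).

    Exponents satisfying the chain inequalities are essential. For an antichain
    take the coordinate, in the exterior power, of the basis vector reached by
    its monomial: an antichain is the smallest transport matrix with its margins
    ([antichain_min]), so this functional vanishes on all smaller monomials. A
    product of such functionals does the same for a sum of antichains, in a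
    tensor power ([tpow_extremal]).

    The two arguments only use the four properties collected in
    [extremal_cyclic], which pass to tensor powers; the same computation at
    level [r * m] therefore gives the dimensions for [v^(tensor r)]. The abstract
    simple module is reached by embedding it into the [m]-th tensor power of the
    exterior algebra ([fock_embedding]): the submodule of the product generated
    by the pair of highest weight vectors is the graph of an injective map, since
    the standard hermitian form on the tensor power is contravariant. A comparison
    of weights ([extremal_weight_space]) shows that the extremal vector is mapped
    to a multiple of the tensor power of the wedge. *)

Set Implicit Arguments.
Unset Strict Implicit.
Unset Printing Implicit Defensive.

Import Order.TTheory GRing.Theory Num.Theory.

Local Open Scope ring_scope.

(** * Spans, Lie modules and cyclic generation *)

Section LinearSpan.

Variables (K : fieldType) (V : vectType K).
Implicit Types (A : set V) (U : {vspace V}).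

Lemma mem_lspan A u : A u -> u \in lspan A.
Proof. by rewrite /lspan; case: cid => U /= [AU _]; apply: AU. Qed.

Lemma lspan_sub A U : (forall u, A u -> u \in U) -> (lspan A <= U)%VS.
Proof. by rewrite /lspan; case: cid => W /= [_ minW] AU; apply: minW. Qed.

Lemma lspan_span A :
  exists2 s : seq V, (forall u, u \in s -> A u) & lspan A = <<s>>%VS.
Proof.
pose P d := `[< exists2 s : seq V, (forall u, u \in s -> A u) & \dim <<s>> = d >].
have exP : exists d, P d.
  by exists (\dim (<<[::]>> : {vspace V})); apply/asboolP; exists [::].
have ubP d : P d -> (d <= \dim {:V})%N.
  by move=> /asboolP[s _ <-]; apply/dimvS/subvf.
have [d /asboolP[s sA sd] maxd] := ex_maxnP exP ubP.
exists s => //; apply/eqP; rewrite eqEsubv; apply/andP; split; last first.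
  by apply/span_subvP => u us; apply/mem_lspan/sA.
apply: lspan_sub => u Au.
have sub_us : (<<s>> <= <<u :: s>>)%VS.
  by apply: sub_span => x xs; rewrite inE xs orbT.
have : (\dim <<u :: s>> <= \dim <<s>>)%N.
  rewrite sd; apply: maxd; apply/asboolP; exists (u :: s) => // x.
  by rewrite inE => /predU1P[->|/sA].
rewrite (geq_leqif (dimv_leqif_sup sub_us)) => /subvP; apply.
by rewrite memv_span ?mem_head.
Qed.

(** A finite part of the set already spans, so the property need not be known to
    define a subspace. *)
Lemma lspan_ind A (P : V -> Prop) :
    P 0 -> (forall c x y, P x -> P y -> P (c *: x + y)) ->
    (forall x, A x -> P x) ->
  forall x, x \in lspan A -> P x.
Proof.
move=> P0 Plin PA x; have [s sA ->] := lspan_span A.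
move=> /(@coord_span _ _ _ (in_tuple s)) ->.
elim/big_ind: _ => // [y z Py Pz|k _]; first by rewrite -[y]scale1r; apply: Plin.
rewrite -[_ *: _]addr0; apply: Plin => //; apply/PA/sA.
by rewrite /= mem_nth.
Qed.

End LinearSpan.

Section LinearMaps.

Variables (K : fieldType) (V W : vectType K) (f : V -> W).
Hypothesis lf : linear f.

Lemma lin0 : f 0 = 0.
Proof. by have := lf (-1) 0 0; rewrite scaler0 addr0 scaleN1r addNr. Qed.

Lemma linD x y : f (x + y) = f x + f y.
Proof. by have := lf 1 x y; rewrite !scale1r. Qed.

Lemma linZ c x : f (c *: x) = c *: f x.
Proof. by have := lf c x 0; rewrite lin0 !addr0. Qed.

Lemma linN x : f (- x) = - f x.
Proof. by rewrite -scaleN1r linZ scaleN1r. Qed.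

Lemma lin_sum I (r : seq I) (P : pred I) (F : I -> V) :
  f (\sum_(i <- r | P i) F i) = \sum_(i <- r | P i) f (F i).
Proof.
by elim/big_rec2: _ => [|i x y _ <-]; [apply: lin0 | rewrite linD].
Qed.

End LinearMaps.

Section LieModules.

Variables (C : fieldType) (n : nat) (V : vectType C).
Variables (g : {pred 'M[C]_n.+1}) (act : 'M[C]_n.+1 -> V -> V).
Hypothesis Lg : lie_module g act fullv.

Lemma lie_linear X : X \in g -> linear (act X).
Proof. by case: Lg => _ H _ _ gX c u v; apply: H; rewrite ?memvf. Qed.

Lemma lie_actD X Y u : X \in g -> Y \in g -> act (X + Y) u = act X u + act Y u.
Proof.
case: Lg => _ _ H _ gX gY; have := H X Y gX gY u (memvf u) 1.
by rewrite !scale1r.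
Qed.

Lemma lie_act0 u : 0 \in g -> act 0 u = 0.
Proof.
case: Lg => _ _ H _ g0; have := H 0 0 g0 g0 u (memvf u) (-1).
by rewrite scaler0 addr0 scaleN1r addNr.
Qed.

Lemma lie_actZ c X u : 0 \in g -> X \in g -> act (c *: X) u = c *: act X u.
Proof.
case: (Lg) => _ _ H _ g0 gX; have := H X 0 gX g0 u (memvf u) c.
by rewrite addr0 lie_act0 // addr0.
Qed.

Lemma lie_act_sum I (r : seq I) (P : pred I) (F : I -> 'M[C]_n.+1) u :
    0 \in g -> (forall X Y, X \in g -> Y \in g -> X + Y \in g) ->
    (forall i, P i -> F i \in g) ->
  act (\sum_(i <- r | P i) F i) u = \sum_(i <- r | P i) act (F i) u.
Proof.
move=> g0 gD gF.
suff [_ ->] : (\sum_(i <- r | P i) F i \in g) /\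
  act (\sum_(i <- r | P i) F i) u = \sum_(i <- r | P i) act (F i) u by [].
elim/big_rec2: _ => [|i x y Pi [gy <-]]; first by rewrite lie_act0.
by rewrite lie_actD ?gF //; split=> //; apply: gD => //; apply: gF.
Qed.

Lemma lie_actC X Y u : X \in g -> Y \in g ->
  act X (act Y u) = act Y (act X u) + act (X *m Y - Y *m X) u.
Proof.
by case: Lg => _ _ _ H gX gY; rewrite H ?memvf // addrC subrK.
Qed.

Lemma sub_lie_module (h : {pred 'M[C]_n.+1}) : {subset h <= g} ->
  lie_module h act fullv.
Proof.
move=> hg; case: Lg => _ H1 H2 H3; split.
- by move=> X u _ _; rewrite memvf.
- by move=> X /hg; apply: H1.
- by move=> X Y /hg gX /hg; apply: H2.
- by move=> X Y /hg gX /hg; apply: H3.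
Qed.

End LieModules.

Section CyclicModules.

Variables (C : fieldType) (n : nat) (V : vectType C).
Implicit Types (g : {pred 'M[C]_n.+1}) (act : 'M[C]_n.+1 -> V -> V).

Lemma Ug_gen g act v : v \in Ug g act v.
Proof. by apply: mem_lspan; exists [::]. Qed.

Lemma Ug_stable g act v : (forall X, X \in g -> linear (act X)) ->
  stable g act (Ug g act v).
Proof.
move=> lin X u gX; move: u; apply: lspan_ind.
- by rewrite lin0 ?mem0v //; apply: lin.
- by move=> c x y xU yU; rewrite (lin X gX) memvD // memvZ.
- move=> _ [s gs ->]; apply: mem_lspan; exists (X :: s) => //=.
  by rewrite gs andbT.
Qed.

Lemma Ug_min g act v (U : {vspace V}) : stable g act U -> v \in U ->
  (Ug g act v <= U)%VS.
Proof.
move=> stU vU; apply: lspan_sub => _ [s gs ->].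
by elim: s gs => //= X s IHs /andP[gX gs]; apply: stU => //; apply: IHs.
Qed.

(** The part of the Poincare-Birkhoff-Witt theorem used throughout: an element of
    [g2] can be moved to the right past the elements of [g1], at the cost of
    shorter words, until it reaches the generator. *)
Lemma Ug_split g g1 g2 act v :
    lie_module g act fullv ->
    (forall X Y, X \in g -> Y \in g -> X *m Y - Y *m X \in g) ->
    {subset g1 <= g} -> {subset g2 <= g} ->
    (forall Z, Z \in g -> exists Z1 Z2, [/\ Z1 \in g1, Z2 \in g2 & Z = Z1 + Z2]) ->
    (forall Z, Z \in g2 -> act Z v \in <[v]>%VS) ->
  Ug g act v = Ug g1 act v.
Proof.
move=> Lg gbr s1 s2 split12 act2; set U := Ug g1 act v.
have vU : v \in U by apply: Ug_gen.
have stU : stable g1 act U.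
  by apply: Ug_stable => X /s1; apply: (lie_linear Lg).
have gU Z u : Z \in g -> u \in U -> act Z u \in U.
  move=> gZ uU; move: u uU Z gZ; apply: lspan_ind.
  - by move=> Z gZ; rewrite (lin0 (lie_linear Lg gZ)) mem0v.
  - by move=> c x y xU yU Z gZ; rewrite (lie_linear Lg gZ) memvD ?memvZ ?xU ?yU.
  move=> _ [s gs ->]; elim: s gs => [_|Y s IHs /= /andP[gY gs]] Z gZ /=.
    have [Z1 [Z2 [Z1g Z2g ->]]] := split12 _ gZ.
    rewrite (lie_actD Lg _ (s1 _ Z1g) (s2 _ Z2g)) memvD ?(stU _ _ Z1g) //.
    have /vlineP[c ->] := act2 _ Z2g; exact: memvZ.
  have [Z1 [Z2 [Z1g Z2g ->]]] := split12 _ gZ.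
  have wU : foldr act v s \in U by apply: mem_lspan; exists s.
  rewrite (lie_actD Lg _ (s1 _ Z1g) (s2 _ Z2g)); apply: memvD.
    exact: stU Z1g (stU _ _ gY wU).
  rewrite (lie_actC Lg _ (s2 _ Z2g) (s1 _ gY)); apply: memvD.
    by apply: stU gY _; apply: IHs => //; apply: s2.
  by apply: IHs => //; apply: gbr; [apply: s2 | apply: s1].
apply/eqP; rewrite eqEsubv Ug_min //=.
apply: Ug_min; last exact: Ug_gen.
by move=> X u /s1 gX; apply: Ug_stable => //; apply: lie_linear.
Qed.

End CyclicModules.

(** * The homogeneous lexicographic order *)

Section Exponents.

Variable N : nat.
Implicit Types p q r : 'rV[nat]_N.

Lemma exponentD p q k : (p + q) ord0 k = (p ord0 k + q ord0 k)%N.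
Proof. by rewrite mxE. Qed.

Lemma exponent_sum (I : Type) (s : seq I) (P : pred I) (F : I -> 'rV[nat]_N) k :
  (\sum_(i <- s | P i) F i) ord0 k = (\sum_(i <- s | P i) F i ord0 k)%N.
Proof. by elim/big_rec2: _ => [|i x y _ <-]; rewrite mxE. Qed.

Lemma exponentP p q : (forall k, p ord0 k = q ord0 k) -> p = q.
Proof. by move=> pq; apply/rowP. Qed.

Lemma total_degreeD p q :
  total_degree (p + q) = (total_degree p + total_degree q)%N.
Proof. by rewrite /total_degree -big_split; apply: eq_bigr => k _; rewrite exponentD. Qed.

Lemma total_degree0 p : total_degree p = 0%N -> p = 0.
Proof.
move/eqP; rewrite sum_nat_eq0 => /forallP p0; apply: exponentP => k.
by rewrite mxE; apply/eqP/p0.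
Qed.

Lemma hlexP p q : reflect
  ((total_degree p < total_degree q)%N \/
   total_degree p = total_degree q /\
   exists2 k : 'I_N, forall j : 'I_N, (j < k)%N -> p ord0 j = q ord0 j &
     (p ord0 k < q ord0 k)%N)
  (hlex_lt p q).
Proof.
apply: (iffP orP) => -[->|]; try by left.
  case/andP=> /eqP -> /existsP[k /andP[/forallP H pq]]; right; split=> //.
  by exists k => // j jk; apply/eqP; have := H j; rewrite jk.
move=> [-> [k H pq]]; right; rewrite eqxx /=; apply/existsP; exists k.
by rewrite pq andbT; apply/forallP => j; apply/implyP => /H ->.
Qed.

Lemma hlex_irr p : hlex_lt p p = false.
Proof.
by apply/negP => /hlexP[|[_ [k _]]]; rewrite ltnn.
Qed.

Lemma hlex_trans p q r : hlex_lt p q -> hlex_lt q r -> hlex_lt p r.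
Proof.
move=> /hlexP[pq|[pq [k Hk ltk]]] /hlexP[qr|[qr [l Hl ltl]]]; apply/hlexP.
- by left; apply: ltn_trans qr.
- by left; rewrite -qr.
- by left; rewrite pq.
right; split; first by rewrite pq.
have [kl|lk|/val_inj kl] := ltngtP k l.
- exists k => [j jk|]; first by rewrite Hk // Hl // (ltn_trans jk).
  by rewrite -Hl.
- exists l => [j jl|]; first by rewrite Hk ?Hl // (ltn_trans jl).
  by rewrite Hk.
- exists k => [j jk|]; first by rewrite Hk ?Hl // -kl.
  by apply: ltn_trans ltk _; rewrite kl.
Qed.

Lemma first_diff p q : p != q -> exists2 k : 'I_N,
  forall j : 'I_N, (j < k)%N -> p ord0 j = q ord0 j & p ord0 k != q ord0 k.
Proof.
move=> pq; have [k0 k0P] : exists k0, p ord0 k0 != q ord0 k0.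
  apply/existsP; apply: contraR pq => /existsPn pq.
  by apply/eqP/exponentP => k; apply/eqP; have := pq k; rewrite negbK.
case: (@arg_minnP _ k0 (fun k => p ord0 k != q ord0 k) (@nat_of_ord N) k0P) => k kP kmin.
by exists k => // j jk; apply/eqP; apply: contraLR jk => /kmin; rewrite -leqNgt.
Qed.

Lemma hlex_total p q : p != q -> hlex_lt p q || hlex_lt q p.
Proof.
move=> pq; have [lt|gt|eq] := ltngtP (total_degree p) (total_degree q).
- by apply/orP; left; apply/hlexP; left.
- by apply/orP; right; apply/hlexP; left.
have [k Hk] := first_diff pq; rewrite neq_ltn => /orP[lt|gt]; apply/orP.
  by left; apply/hlexP; right; split=> //; exists k.
by right; apply/hlexP; right; split=> //; exists k => // j /Hk.
Qed.

Lemma hlex_add p q r : hlex_lt (p + r) (q + r) = hlex_lt p q.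
Proof.
rewrite /hlex_lt !total_degreeD ltn_add2r eqn_add2r; congr (_ || _ && _).
apply: eq_existsb => k /=; rewrite !exponentD ltn_add2r; congr (_ && _).
by apply: eq_forallb => j; rewrite !exponentD eqn_add2r.
Qed.

Lemma hlex_le_refl p : hlex_le p p. Proof. by rewrite /hlex_le eqxx. Qed.

Lemma hlex_le_trans p q r : hlex_le p q -> hlex_le q r -> hlex_le p r.
Proof.
move=> /predU1P[-> //|pq] /predU1P[<-|qr]; rewrite /hlex_le ?pq ?orbT //.
by rewrite (hlex_trans pq qr) orbT.
Qed.

Lemma hlex_lt_le_trans p q r : hlex_lt p q -> hlex_le q r -> hlex_lt p r.
Proof. by move=> pq /predU1P[<- //|]; apply: hlex_trans. Qed.

Lemma hlex_le_total p q : hlex_le p q || hlex_le q p.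
Proof.
have [->|pq] := eqVneq p q; first by rewrite hlex_le_refl.
by have /orP[pq'|pq'] := hlex_total pq; rewrite /hlex_le pq' !orbT.
Qed.

Lemma hlex_le_lt p q : hlex_le p q -> hlex_lt q p = false.
Proof.
move=> pq; apply/negP => qp.
by have := hlex_lt_le_trans qp pq; rewrite hlex_irr.
Qed.

Lemma hlex_leD p q p' q' :
  hlex_le p q -> hlex_le p' q' -> hlex_le (p + p') (q + q').
Proof.
move=> pq pq'; apply: (@hlex_le_trans _ (q + p')).
  by move: pq => /predU1P[->|]; rewrite ?hlex_le_refl // /hlex_le hlex_add orbC => ->.
move: pq' => /predU1P[->|]; rewrite ?hlex_le_refl // /hlex_le.
by rewrite ![q + _]addrC hlex_add orbC => ->.
Qed.

Lemma hlex_lt_leD p q p' q' :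
  hlex_lt p q -> hlex_le p' q' -> hlex_lt (p + p') (q + q').
Proof.
move=> pq pq'; apply: (@hlex_lt_le_trans _ (q + p')); first by rewrite hlex_add.
by apply: hlex_leD; first exact: hlex_le_refl.
Qed.

Lemma hlex_le_sum (I : Type) (s : seq I) (P : pred I) (F G : I -> 'rV[nat]_N) :
  (forall i, P i -> hlex_le (F i) (G i)) ->
  hlex_le (\sum_(i <- s | P i) F i) (\sum_(i <- s | P i) G i).
Proof.
move=> FG; elim/big_rec2: _ => [|i x y Pi xy]; first exact: hlex_le_refl.
by apply: hlex_leD => //; apply: FG.
Qed.

Lemma hlex_sum_eq (I : finType) (F G : I -> 'rV[nat]_N) :
    (forall i, hlex_le (F i) (G i)) -> \sum_i F i = \sum_i G i ->
  F =1 G.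
Proof.
move=> FG eqs i; apply/eqP; have /predU1P[/eqP //|lt] := FG i.
have lt' : hlex_lt (F i + \sum_(j | j != i) F j) (G i + \sum_(j | j != i) G j).
  by apply: hlex_lt_leD => //; apply: hlex_le_sum.
move: eqs lt'; rewrite (bigD1 i) //= => ->.
by rewrite [X in hlex_lt X _](bigD1 i) //= hlex_irr.
Qed.

(** The exponents of bounded degree being finitely many, the order is well
    founded. *)
Lemma hlex_ind (P : 'rV[nat]_N -> Prop) :
  (forall p, (forall q, hlex_lt q p -> P q) -> P p) -> forall p, P p.
Proof.
move=> IH p; set d := total_degree p.
pose row_of (f : {ffun 'I_N -> 'I_d.+1}) : 'rV[nat]_N := \row_k (f k : nat).
have row_onto q : (total_degree q <= d)%N -> exists f, row_of f = q.
  move=> qd; exists [ffun k => inord (q ord0 k)]; apply: exponentP => k.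
  rewrite mxE ffunE inordK // ltnS (leq_trans _ qd) //.
  by rewrite /total_degree (bigD1 k) //= leq_addr.
pose rank q := #|[set f | hlex_lt (row_of f) q]|.
have deg_le q q' : hlex_lt q q' -> (total_degree q <= total_degree q')%N.
  by move=> /hlexP[/ltnW //|[->]].
suff main k q : (rank q < k)%N -> (total_degree q <= d)%N -> P q.
  exact: (main (rank p).+1).
elim: k q => // k IHk q; rewrite ltnS => rk qd; apply: IH => q' q'q.
have q'd := leq_trans (deg_le _ _ q'q) qd.
apply: IHk q'd; apply: leq_trans rk; apply: proper_card.
apply/properP; split.
  by apply/fintype.subsetP => f; rewrite !inE => /hlex_trans; apply.
have [f fq'] := row_onto q' (leq_trans (deg_le _ _ q'q) qd).
by exists f; rewrite !inE fq' ?hlex_irr.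
Qed.

End Exponents.

(** * Chain polytopes of finite posets *)

Section ChainPolytopes.

Variables (N : nat) (good : pred 'I_N) (le : rel 'I_N).
Implicit Types (p q : 'rV[nat]_N) (c : {set 'I_N}).

Definition chain c := [forall k in c, forall l in c, le k l || le l k].

Lemma chainP c :
  reflect {in c &, forall k l, le k l || le l k} (chain c).
Proof.
apply: (iffP forall_inP) => [H k l kc lc|H k kc].
  by have /forall_inP := H k kc; apply.
by apply/forall_inP => l lc; apply: H.
Qed.

(** The lattice points of the [m]-fold dilation of the chain polytope of the poset
    of good indices. *)
Definition chain_point m p : bool :=
  [forall k, good k || (p ord0 k == 0%N)] &&
  [forall c : {set 'I_N}, chain c ==> (\sum_(k in c) p ord0 k <= m)%N].

Lemma chain_pointP m p : reflect
  ((forall k, ~~ good k -> p ord0 k = 0%N) /\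
   forall c, chain c -> (\sum_(k in c) p ord0 k <= m)%N)
  (chain_point m p).
Proof.
apply: (iffP andP) => -[H1 H2]; split.
- by move=> k /negPf gk; have := forallP H1 k; rewrite gk => /eqP.
- by move=> c; apply/implyP; have := forallP H2 c.
- by apply/forallP => k; case: (boolP (good k)) => //= /H1 ->.
- by apply/forallP => c; apply/implyP/H2.
Qed.

Lemma chain_point0 m : chain_point m 0.
Proof.
apply/chain_pointP; split=> [k _|c _]; first by rewrite mxE.
by rewrite big1 // => k _; rewrite mxE.
Qed.

Lemma chain_pointD a b p q :
  chain_point a p -> chain_point b q -> chain_point (a + b) (p + q).
Proof.
move=> /chain_pointP[gp cp] /chain_pointP[gq cq]; apply/chain_pointP; split.
  by move=> k gk; rewrite exponentD gp // gq.
move=> c cc; under eq_bigr do rewrite exponentD.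
by rewrite big_split leq_add ?cp ?cq.
Qed.

Lemma chain_point_sum_fun r m (f : 'I_r -> 'rV[nat]_N) :
  (forall k, chain_point m (f k)) -> chain_point (r * m) (\sum_k f k).
Proof.
elim: r f => [|r IHr] f fP; first by rewrite big_ord0 chain_point0.
by rewrite big_ord_recl mulSn chain_pointD // IHr.
Qed.

Hypothesis le_refl : reflexive le.
Hypothesis le_anti : antisymmetric le.
Hypothesis le_trans : transitive le.

Lemma chain1 k : chain [set k].
Proof. by apply/chainP => i j; rewrite !inE => /eqP -> /eqP ->; rewrite le_refl. Qed.

Lemma chain2 k l : le k l -> chain [set k; l].
Proof.
move=> kl; apply/chainP => i j; rewrite !inE.
by move=> /orP[] /eqP -> /orP[] /eqP ->; rewrite ?le_refl ?kl ?orbT.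
Qed.

Lemma chain_point_le m p k : chain_point m p -> (p ord0 k <= m)%N.
Proof.
by move=> /chain_pointP[_ /(_ _ (chain1 k))]; rewrite big_set1.
Qed.

Definition chain_points m : seq 'rV[nat]_N :=
  [seq p <- [seq \row_k (f k : nat) | f : {ffun 'I_N -> 'I_m.+1}] |
    chain_point m p].

Lemma mem_chain_points m p : (p \in chain_points m) = chain_point m p.
Proof.
rewrite mem_filter; case: (boolP (chain_point m p)) => //= cp.
apply/mapP; exists [ffun k => inord (p ord0 k)]; first by rewrite mem_enum.
by apply: exponentP => k; rewrite mxE ffunE inordK // ltnS (chain_point_le _ cp).
Qed.

Lemma chain_points_uniq m : uniq (chain_points m).
Proof.
rewrite filter_uniq // map_inj_uniq ?enum_uniq // => f g fg.
by apply/ffunP => k; apply: val_inj; have /rowP/(_ k) := fg; rewrite !mxE.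
Qed.

Lemma chain_min c k : chain c -> k \in c ->
  exists2 k0, k0 \in c & {in c, forall l, le k0 l}.
Proof.
move=> /chainP cc kc.
case: (arg_minnP (fun k => #|[set l | le l k]|) kc) => k0 k0c k0min.
exists k0 => // l lc; have /orP[//|lk0] := cc _ _ k0c lc.
have [->|lnk0] := eqVneq l k0; first exact: le_refl.
have := k0min l lc; rewrite leqNgt => /negP[]; apply: proper_card.
apply/properP; split.
  by apply/fintype.subsetP => x; rewrite !inE => xl; apply: le_trans lk0.
exists k0; rewrite !inE ?le_refl //.
by apply: contra lnk0 => k0l; rewrite (@le_anti l k0) ?lk0 ?k0l.
Qed.

(** Mirsky's argument: subtract the indicator of the minimal elements of the
    support, which form an antichain. A chain meeting them loses one, and a chain
    of the support missing them can be prolonged downwards, so that its sum was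
    not maximal. *)
Lemma chain_point_peel m p : chain_point m.+1 p ->
  exists p1 p', [/\ chain_point 1 p1, chain_point m p' & p = p1 + p'].
Proof.
move=> /chain_pointP[gp cp].
pose mini k := (0 < p ord0 k)%N &&
  [forall l, (0 < p ord0 l)%N ==> le l k ==> (l == k)].
have miniP k l : mini k -> (0 < p ord0 l)%N -> le l k -> l = k.
  by case/andP=> _ /forallP/(_ l) H pl lk; apply/eqP; move: H; rewrite pl lk.
pose p1 : 'rV[nat]_N := \row_k (mini k : nat).
pose p' : 'rV[nat]_N := \row_k (p ord0 k - mini k)%N.
have p1p k : (p1 ord0 k <= p ord0 k)%N.
  by rewrite mxE; case: (boolP (mini k)) => // /andP[].
have pE : p = p1 + p'.
  by apply: exponentP => k; rewrite exponentD; have := p1p k; rewrite !mxE => /subnKC.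
exists p1, p'; split=> //.
- apply/chain_pointP; split.
    by move=> k /gp pk; have := p1p k; rewrite pk leqn0 => /eqP.
  move=> c cc; case: (pickP (fun k => (k \in c) && mini k)) => [k /andP[kc mk]|nomin].
    rewrite (bigD1 k) //= big1 ?addn0; first by rewrite mxE; case: (mini k).
    move=> l /andP[lc lk]; rewrite mxE; case: (boolP (mini l)) => // ml.
    have pos x : mini x -> (0 < p ord0 x)%N by case/andP.
    have /orP[kl|lk'] := chainP _ cc k l kc lc.
      by rewrite (miniP l k) ?pos ?eqxx in lk.
    by rewrite (miniP k l) ?pos ?eqxx in lk.
  rewrite big1 // => k kc; rewrite mxE.
  by have := nomin k; rewrite kc /= => ->.
apply/chain_pointP; split; first by move=> k /gp pk; rewrite mxE pk.
move=> c cc.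
have sumE : (\sum_(k in c) p ord0 k = \sum_(k in c) p1 ord0 k + \sum_(k in c) p' ord0 k)%N.
  by rewrite -big_split; apply: eq_bigr => k _; rewrite {1}pE exponentD.
case: (pickP (fun k => (k \in c) && mini k)) => [k /andP[kc mk]|nomin].
  have := cp c cc; rewrite sumE (bigD1 k) //= [p1 _ _]mxE mk.
  by rewrite -addnA add1n ltnS => /(leq_trans (leq_addl _ _)).
have [allp|] := boolP [forall k in c, p ord0 k == 0%N].
  rewrite big1 // => k kc; rewrite mxE.
  by have /eqP -> := forall_inP allp k kc.
rewrite negb_forall_in => /exists_inP[k kc pk].
pose c' := [set k in c | (0 < p ord0 k)%N].
have cc' : chain c'.
  apply/chainP => i j; rewrite !inE => /andP[ic _] /andP[jc _].
  exact: (chainP _ cc).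
have [|k0 k0c' k0min] := chain_min cc' (_ : k \in c'); first by rewrite inE kc lt0n.
have [l [pl lk0 ll]] : exists l, [/\ (0 < p ord0 l)%N, le l k0 & l != k0].
  have := nomin k0; move: k0c'; rewrite inE => /andP[k0c pk0].
  rewrite k0c /mini pk0 /= => /negbT; rewrite negb_forall => /existsP[l].
  by rewrite !negb_imply => /and3P[? ? ?]; exists l.
have lc' : l \notin c'.
  by apply/negP => /k0min k0l; move: ll; rewrite (@le_anti l k0) ?eqxx ?lk0.
have cl : chain (l |: c').
  apply/chainP => i j; rewrite !inE => /predU1P[->|ic] /predU1P[->|jc].
  - by rewrite le_refl.
  - by rewrite (le_trans lk0) // k0min // inE.
  - by rewrite orbC (le_trans lk0) // k0min // inE.
  - by apply: (chainP _ cc'); rewrite inE.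
have := cp _ cl; rewrite big_setU1 //= => leS.
have lem : (\sum_(k in c') p ord0 k <= m)%N.
  by rewrite -ltnS (leq_trans _ leS) // -[X in (X < _)%N]add0n ltn_add2r.
apply: leq_trans lem; apply: (@leq_trans (\sum_(k in c) p ord0 k)%N).
  by apply: leq_sum => j _; rewrite mxE leq_subr.
rewrite (bigID (fun j => 0 < p ord0 j)%N) /= [X in (_ + X)%N]big1 ?addn0.
  by apply/eq_leq/eq_bigl => j; rewrite inE.
by move=> j /andP[_]; rewrite -eqn0Ngt => /eqP.
Qed.

Lemma chain_point_splitD a b p : chain_point (a + b) p ->
  exists q r, [/\ chain_point a q, chain_point b r & p = q + r].
Proof.
elim: a p => [|a IHa] p.
  by rewrite add0n => pb; exists 0, p; rewrite chain_point0 pb add0r.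
rewrite addSn => /chain_point_peel[p1 [p' [p1P /IHa[q [r [qP rP ->]]] ->]]].
by exists (p1 + q), r; rewrite addrA -add1n chain_pointD.
Qed.

Lemma chain_point_split r m p : chain_point (r * m) p ->
  exists2 f : 'I_r -> 'rV[nat]_N, forall k, chain_point m (f k) & p = \sum_k f k.
Proof.
elim: r p => [|r IHr] p.
  move=> p0; exists (fun=> 0) => [k|]; first exact: chain_point0.
  rewrite big_ord0; apply: exponentP => k; apply/eqP; rewrite mxE -leqn0.
  exact: (chain_point_le _ p0).
rewrite mulSn => /chain_point_splitD[q [p' [qP /IHr[f fP ->] ->]]].
exists (fun k => if unlift ord0 k is Some j then f j else q).
  by move=> k; case: unlift.
rewrite big_ord_recl unlift_none; congr (_ + _).
by apply: eq_bigr => j _; rewrite liftK.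
Qed.

End ChainPolytopes.

(** * Extremal transport matrices *)

Section Transport.

Variables (N n : nat) (row col : 'I_N -> 'I_n.+1) (good : pred 'I_N).

(** An index stands for the interval from its row to its column; smaller indices
    are larger intervals. *)
Definition nested : rel 'I_N :=
  fun k l => (row k <= row l)%N && (col l <= col k)%N.

Definition same_margins (p q : 'rV[nat]_N) : Prop :=
  (forall x, \sum_(k | row k == x) p ord0 k = \sum_(k | row k == x) q ord0 k)%N /\
  (forall x, \sum_(k | col k == x) p ord0 k = \sum_(k | col k == x) q ord0 k)%N.

Hypothesis row_col_inj : forall k l, row k = row l -> col k = col l -> k = l.
Hypothesis index_lex : forall k l, good k -> good l ->
  (k < l)%N = (row k < row l)%N || (row k == row l) && (col l < col k)%N.

Lemma nested_refl : reflexive nested.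
Proof. by move=> k; rewrite /nested !leqnn. Qed.

Lemma nested_anti : antisymmetric nested.
Proof.
move=> k l /andP[/andP[r1 c1] /andP[r2 c2]].
by apply: row_col_inj; apply/val_inj/eqP; rewrite eqn_leq ?r1 ?r2 ?c1 ?c2.
Qed.

Lemma nested_trans : transitive nested.
Proof.
move=> l k j /andP[r1 c1] /andP[r2 c2].
by rewrite /nested (leq_trans r1) // (leq_trans c2).
Qed.

Lemma margins_degree p q : same_margins p q -> total_degree p = total_degree q.
Proof.
move=> [mrow _]; rewrite /total_degree !(partition_big row xpredT) //=.
by apply: eq_bigr.
Qed.

(** Equal sums force a strict inequality to be compensated elsewhere. *)
Lemma sum_eq_gt (P : pred 'I_N) (f g : 'I_N -> nat) k :
    (\sum_(l | P l) f l = \sum_(l | P l) g l)%N -> P k -> (f k < g k)%N ->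
  exists2 l, P l & (g l < f l)%N.
Proof.
move=> eqs Pk fg; apply/exists_inP; apply: contraLR fg.
rewrite negb_exists_in -leqNgt => /forall_inP H.
have le (Q : pred 'I_N) : (\sum_(l | P l && Q l) f l <= \sum_(l | P l && Q l) g l)%N.
  by apply: leq_sum => l /andP[/H]; rewrite -leqNgt.
move/eqP: eqs; rewrite (bigD1 k) //= [X in _ == X](bigD1 k) //= => eqs.
rewrite -(leq_add2r (\sum_(i | P i && (i != k)) f i)) (eqP eqs) leq_add2l.
exact: le.
Qed.

Lemma first_diff_later (p q : 'rV[nat]_N) (k l : 'I_N) :
    (forall j : 'I_N, (j < k)%N -> p ord0 j = q ord0 j) ->
    p ord0 l != q ord0 l -> l != k -> (k < l)%N.
Proof.
move=> same pql lk; rewrite ltn_neqAle eq_sym lk /= leqNgt.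
by apply: contra pql => /same ->.
Qed.

(** The northwest corner rule, with the columns in decreasing order. At the first
    difference, an excess of [q] would have to be compensated further down the
    same column and at a smaller column of the same row, which gives two incomparable
    positions in the support of [p]. *)
Lemma staircase_max (p q : 'rV[nat]_N) :
    (forall k, ~~ good k -> p ord0 k = 0%N) ->
    (forall k, ~~ good k -> q ord0 k = 0%N) ->
    chain nested [set k | (0 < p ord0 k)%N] ->
    same_margins p q -> p != q ->
  hlex_lt q p.
Proof.
move=> gp gq /chainP cp mpq npq; have [mrow mcol] := mpq.
have goodP l : (0 < p ord0 l)%N -> good l.
  by apply: contraTT => /gp ->.
have goodQ l : (0 < q ord0 l)%N -> good l.
  by apply: contraTT => /gq ->.
have [k Hk] := first_diff npq; rewrite neq_ltn orbC => /orP[lt|gt].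
  apply/hlexP; right; rewrite (margins_degree mpq); split=> //.
  by exists k => // j /Hk.
have gk : good k by apply: goodQ; apply: leq_ltn_trans gt.
have [l1 /eqP l1E lt1] := sum_eq_gt (mcol (col k)) (eqxx _) gt.
have [l2 /eqP l2E lt2] := sum_eq_gt (mrow (row k)) (eqxx _) gt.
have p1 := leq_ltn_trans (leq0n _) lt1; have p2 := leq_ltn_trans (leq0n _) lt2.
have l1k : l1 != k by apply: contraTneq lt1 => ->; rewrite ltnNge ltnW.
have l2k : l2 != k by apply: contraTneq lt2 => ->; rewrite ltnNge ltnW.
have d1 : p ord0 l1 != q ord0 l1 by rewrite neq_ltn lt1 orbT.
have d2 : p ord0 l2 != q ord0 l2 by rewrite neq_ltn lt2 orbT.
have := first_diff_later Hk d1 l1k.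
rewrite (index_lex gk (goodP _ p1)) l1E ltnn andbF orbF => r1.
have := first_diff_later Hk d2 l2k.
rewrite (index_lex gk (goodP _ p2)) l2E ltnn eqxx /= => c2.
have := cp l1 l2; rewrite !inE => /(_ p1 p2); rewrite /nested l1E l2E.
by rewrite leqNgt r1 /= [X in _ && X]leqNgt c2 andbF.
Qed.

(** Dually, where [q] falls short of [p] at the first difference, [q] has an excess
    at a smaller column of the same row; the column of that excess then holds a later
    entry of [p], which is comparable with the first one. *)
Lemma antichain_min (p q : 'rV[nat]_N) :
    chain_point good nested 1 p -> (forall k, ~~ good k -> q ord0 k = 0%N) ->
    same_margins p q ->
  hlex_le p q.
Proof.
move=> cp gq mpq; have [mrow mcol] := mpq.
have /chain_pointP[gp anti] := cp.
have goodP l : (0 < p ord0 l)%N -> good l.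
  by apply: contraTT => /gp ->.
have goodQ l : (0 < q ord0 l)%N -> good l.
  by apply: contraTT => /gq ->.
have [->|npq] := eqVneq p q; first exact: hlex_le_refl.
rewrite /hlex_le (negPf npq) /=.
have [k Hk] := first_diff npq; rewrite neq_ltn => /orP[lt|gt].
  apply/hlexP; right; rewrite (margins_degree mpq); split=> //.
  by exists k.
have pk := leq_ltn_trans (leq0n _) gt; have gk := goodP _ pk.
have [l1 /eqP l1E lt1] := sum_eq_gt (esym (mrow (row k))) (eqxx _) gt.
have q1 := leq_ltn_trans (leq0n _) lt1; have g1 := goodQ _ q1.
have l1k : l1 != k by apply: contraTneq lt1 => ->; rewrite ltnNge ltnW.
have d1 : p ord0 l1 != q ord0 l1 by rewrite neq_ltn lt1.
have := first_diff_later Hk d1 l1k.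
rewrite (index_lex gk g1) l1E ltnn eqxx /= => c1.
have [l2 /eqP l2E lt2] := sum_eq_gt (mcol (col l1)) (eqxx _) lt1.
have p2 := leq_ltn_trans (leq0n _) lt2; have g2 := goodP _ p2.
have l2k : l2 != k by apply: contraTneq c1 => kl; rewrite -l2E kl ltnn.
have d2 : p ord0 l2 != q ord0 l2 by rewrite neq_ltn lt2 orbT.
have := first_diff_later Hk d2 l2k; rewrite (index_lex gk g2) => rk.
have kl2 : nested k l2.
  rewrite /nested l2E (ltnW c1) andbT.
  by case/orP: rk => [/ltnW //|/andP[/eqP -> _]].
have := anti _ (chain2 nested_refl kl2); rewrite big_setU1 ?big_set1; last first.
  by rewrite inE eq_sym.
by rewrite leqNgt; case/negP; rewrite (@leq_add 1 1).
Qed.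

End Transport.

(** * Coefficients of vector valued polynomial maps *)

Section PolynomialMaps.

Variables (C : numFieldType) (W : vectType C).

(** A polynomial with infinitely many roots vanishes; apply this to each coordinate. *)
Lemma extract_coef1 (J : Type) (r : seq J) (P : pred J) (e : J -> nat)
    (G : J -> W) :
    (forall t : C, \sum_(j <- r | P j) t ^+ e j *: G j = 0) ->
  forall d, \sum_(j <- r | P j && (e j == d)) G j = 0.
Proof.
move=> H d; set u := \sum_(j <- r | _) G j.
rewrite (coord_vbasis (memvf u)) big1 // => i _.
suff -> : coord (vbasis fullv) i u = 0 by rewrite scale0r.
pose p : {poly C} := \sum_(j <- r | P j) coord (vbasis fullv) i (G j) *: 'X^(e j).
have p0 : p = 0.
  apply: (@roots_geq_poly_eq0 _ _ [seq k%:R | k <- iota 0 (size p)]).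
  - apply/allP => _ /mapP[k _ ->]; rewrite rootE /p horner_sum.
    have /(congr1 (coord (vbasis fullv) i)) := H k%:R.
    rewrite linear0 linear_sum => Hk; apply/eqP; rewrite -[RHS]Hk.
    by apply: eq_bigr => j _; rewrite hornerZ hornerXn linearZ /= mulrC.
  - rewrite map_inj_uniq ?iota_uniq // => x y /eqP.
    by rewrite eqr_nat => /eqP.
  - by rewrite size_map size_iota.
have := coef0 C d; rewrite -p0 coef_sum => pd; rewrite -[RHS]pd linear_sum.
rewrite big_mkcondr /=; apply: eq_bigr => j _.
by rewrite coefZ coefXn eq_sym; case: eqP => _; rewrite ?mulr1 ?mulr0.
Qed.

(** The variables are eliminated one at a time. *)
Lemma extract_coef (M : nat) (J : Type) (r : seq J) (e : J -> 'I_M -> nat)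
    (G : J -> W) :
    (forall z : 'I_M -> C, \sum_(j <- r) (\prod_x z x ^+ e j x) *: G j = 0) ->
  forall d : 'I_M -> nat, \sum_(j <- r | [forall x, e j x == d x]) G j = 0.
Proof.
move=> H d.
suff main (S : {set 'I_M}) (z : 'I_M -> C) :
    \sum_(j <- r | [forall x in S, e j x == d x])
      (\prod_(x in ~: S) z x ^+ e j x) *: G j = 0.
  rewrite -[RHS](main [set: 'I_M]%SET (fun=> 1)); apply: eq_big => [j|j _].
    by apply: eq_forallb => x; rewrite inE.
  by rewrite big1 ?scale1r // => x; rewrite expr1n.
have [k] := ubnP #|S|; elim: k S z => // k IHk S z; rewrite ltnS => Sk.
have [->|[x0 x0S]] := set_0Vmem S.
  rewrite -[RHS](H z); apply: eq_big => [j|j _].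
    by apply/forall_inP => x; rewrite inE.
  by congr (_ *: _); apply: eq_bigl => x; rewrite !inE.
pose S' := S :\ x0.
have cS' : (#|S'| < #|S|)%N by rewrite [X in (_ < X)%N](cardsD1 x0) x0S.
pose c j := (\prod_(x in ~: S) z x ^+ e j x) *: G j.
have := @extract_coef1 J r (fun j => [forall x in S', e j x == d x])
  (fun j => e j x0) c _ (d x0).
set lhs := (X in _ -> X = 0) => Hlhs; rewrite -[RHS]Hlhs /lhs => [|t].
  apply: eq_bigl => j; apply/forall_inP/andP => [HS|[/forall_inP HS' /eqP e0] x xS].
    split; last exact: HS.
    by apply/forall_inP => x; rewrite inE => /andP[_]; apply: HS.
  have [->|xx0] := eqVneq x x0; first by rewrite e0.
  by apply: HS'; rewrite inE xS andbT inE.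
rewrite -[RHS](IHk S' (fun x => if x == x0 then t else z x) (leq_trans cS' Sk)).
apply: eq_bigr => j _; rewrite scalerA; congr (_ *: _).
rewrite [RHS](bigD1 x0) /=; last by rewrite !inE eqxx.
rewrite eqxx; congr (_ * _); apply: eq_big => [x|x].
  by rewrite !inE; case: (eqVneq x x0) => [->|]; rewrite ?x0S ?andbT ?andbF.
by rewrite inE => xS; case: eqP => // xx0; rewrite xx0 x0S in xS.
Qed.

End PolynomialMaps.

Section Words.

Variables (N : nat).
Implicit Types (p q : 'rV[nat]_N) (w : seq 'I_N).

Definition unit_exp (k : 'I_N) : 'rV[nat]_N := \row_j (j == k : nat).

Definition content w : 'rV[nat]_N := \sum_(k <- w) unit_exp k.

Lemma unit_expE k j : unit_exp k ord0 j = (j == k : nat).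
Proof. by rewrite mxE. Qed.

Lemma contentE w k : content w ord0 k = count_mem k w.
Proof.
rewrite exponent_sum; elim: w => [|j w IHw]; first by rewrite big_nil.
by rewrite big_cons IHw unit_expE /= eq_sym.
Qed.

Lemma total_degree_unit k : total_degree (unit_exp k) = 1%N.
Proof.
rewrite /total_degree (bigD1 k) //= unit_expE eqxx big1 // => j jk.
by rewrite unit_expE (negPf jk).
Qed.

Lemma total_degree_content w : total_degree (content w) = size w.
Proof.
elim: w => [|k w IHw]; rewrite /content ?big_nil ?big_cons.
  by rewrite /total_degree big1 // => k; rewrite mxE.
by rewrite total_degreeD IHw total_degree_unit.
Qed.

Lemma exp_pos_split q k : (0 < q ord0 k)%N -> exists q', q = q' + unit_exp k.
Proof.
move=> qk; exists (\row_j (q ord0 j - (j == k))%N); apply: exponentP => j.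
rewrite exponentD !mxE subnK //; have [->|] := eqVneq j k; first exact: qk.
by [].
Qed.

Lemma exp_ind (P : 'rV[nat]_N -> Prop) :
    P 0 -> (forall q k, P q -> P (q + unit_exp k)) ->
  forall q, P q.
Proof.
move=> P0 PS q; have [d] := ubnP (total_degree q).
elim: d q => // d IHd q; rewrite ltnS => qd.
have [q0|[k qk]] : total_degree q = 0%N \/ exists k, (0 < q ord0 k)%N.
  have [|/existsPn H] := boolP [exists k, (0 < q ord0 k)%N].
    by move/existsP; right.
  left; rewrite /total_degree big1 // => k _.
  by have := H k; rewrite -eqn0Ngt => /eqP.
- by rewrite (total_degree0 q0).
have [q' q'E] := exp_pos_split qk; rewrite q'E; apply: PS; apply: IHd.
by apply: leq_trans qd; rewrite q'E total_degreeD total_degree_unit addn1.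
Qed.

Lemma content_onto p : exists w, content w = p.
Proof.
elim/exp_ind: p => [|q k [w <-]]; first by exists [::]; rewrite /content big_nil.
by exists (k :: w); rewrite /content big_cons addrC.
Qed.

Fixpoint words (s : seq 'I_N) (j : nat) : seq (seq 'I_N) :=
  if j is j'.+1 then [seq k :: w | k <- s, w <- words s j'] else [:: [::]].

Lemma mem_words s j w : (w \in words s j) = (size w == j) && all (mem s) w.
Proof.
elim: j w => [|j IHj] [|k w] //=.
- by apply/allpairsP => -[[a b] [_ _]].
apply/allpairsP/idP => [[[a b] [/= sa]]|/and3P[]].
  by rewrite IHj => /andP[/eqP <- bs] [-> ->]; rewrite eqxx /= bs sa.
rewrite eqSS => sw ks ws; exists (k, w); split=> //.
by rewrite IHj sw.
Qed.

End Words.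

(** * Upper triangular matrices and orders on the positive roots *)

Section Nplus.

Variables (C : fieldType) (n : nat).
Implicit Types X Y : 'M[C]_n.+1.

Lemma nplusP X : reflect (forall a b : 'I_n.+1, (b <= a)%N -> X a b = 0)
  (X \in @nplus C n).
Proof.
rewrite inE; apply: (iffP forallP) => [H a b ab|H a].
  by apply/eqP; have /forallP/(_ b) := H a; rewrite ab.
by apply/forallP => b; apply/implyP => /H ->.
Qed.

Lemma nplus0 : 0 \in @nplus C n.
Proof. by apply/nplusP => a b _; rewrite mxE. Qed.

Lemma nplusD X Y : X \in @nplus C n -> Y \in @nplus C n -> X + Y \in @nplus C n.
Proof.
by move=> /nplusP HX /nplusP HY; apply/nplusP => a b ab; rewrite mxE HX ?HY ?addr0.
Qed.

Lemma nplusZ c X : X \in @nplus C n -> c *: X \in @nplus C n.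
Proof. by move=> /nplusP HX; apply/nplusP => a b ab; rewrite mxE HX ?mulr0. Qed.

Lemma nplusM X Y : X \in @nplus C n -> Y \in @nplus C n -> X *m Y \in @nplus C n.
Proof.
move=> /nplusP HX /nplusP HY; apply/nplusP => a b ab; rewrite mxE big1 // => c _.
have [ca|ac] := leqP c a; first by rewrite HX // mul0r.
by rewrite HY ?mulr0 // (leq_trans ab) // ltnW.
Qed.

Lemma nplus_br X Y : X \in @nplus C n -> Y \in @nplus C n ->
  X *m Y - Y *m X \in @nplus C n.
Proof.
by move=> nX nY; rewrite -scaleN1r nplusD ?nplusZ ?nplusM.
Qed.

Lemma delta_nplus (a b : 'I_n.+1) : (a < b)%N -> delta_mx a b \in @nplus C n.
Proof.
move=> ab; apply/nplusP => c d dc; rewrite mxE.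
case: eqP => //= ca; case: eqP => //= db; move: ab.
by rewrite -ca -db ltnNge dc.
Qed.

Lemma sln_trace X : (X \in @sln C n) = (\tr X == 0).
Proof. by []. Qed.

Lemma nplus_sln : {subset @nplus C n <= @sln C n}.
Proof.
by move=> X /nplusP HX; rewrite sln_trace /mxtrace big1 // => a _; rewrite HX.
Qed.

Lemma nplus_borel : {subset @nplus C n <= @borel C n}.
Proof.
move=> X nX; rewrite inE; apply/andP; split; first exact: nplus_sln.
apply/forallP => a; apply/forallP => b; apply/implyP => ba.
by have /nplusP -> := nX; rewrite // ltnW.
Qed.

End Nplus.

Section AdaptedOrders.

Variables (n : nat) (I : {set 'I_n.+1}) (beta : 'I_(npos n) -> posroot n).

Definition rrow k := (val (beta k)).1.
Definition rcol k := (val (beta k)).2.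

(** The roots whose root vectors do not kill the extremal vector with index set [I]:
    they move an element of [I] to a smaller element outside [I]. The column of one
    such root is never the row of another, so their root vectors commute. *)
Definition moving k := (rrow k \notin I) && (rcol k \in I).

Definition adapted : Prop :=
  [/\ bijective beta,
      (forall k l, moving k -> moving l -> (k < l)%N =
        (rrow k < rrow l)%N || (rrow k == rrow l) && (rcol l < rcol k)%N) &
      (forall k l, moving k -> ~~ moving l -> (k < l)%N)].

Lemma rrow_lt_rcol k : (rrow k < rcol k)%N.
Proof. exact: (valP (beta k)). Qed.

Lemma root_index_inj k l : bijective beta ->
  rrow k = rrow l -> rcol k = rcol l -> k = l.
Proof.
move=> /bij_inj inj rkl ckl; apply: inj; apply: val_inj.
rewrite [LHS]surjective_pairing [RHS]surjective_pairing.
by congr pair.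
Qed.

End AdaptedOrders.

(** Sort the roots by a numerical key which encodes the required comparisons. *)
Lemma adapted_exists n (I : {set 'I_n.+1}) : exists beta, @adapted n I beta.
Proof.
pose mv (al : posroot n) := ((val al).1 \notin I) && ((val al).2 \in I).
(* digits: moving or not, then the row, then the reversed column *)
pose key (al : posroot n) : nat :=
  (~~ mv al * (n.+1 * n.+1) + ((val al).1 * n.+1 + (n - (val al).2)))%N.
have subn (a : 'I_n.+1) : (n - a < n.+1)%N by rewrite ltnS leq_subr.
have low (al : posroot n) :
    ((val al).1 * n.+1 + (n - (val al).2) < n.+1 * n.+1)%N.
  apply: (@leq_trans ((val al).1.+1 * n.+1)); last by rewrite leq_mul2r ltn_ord.
  by rewrite mulSnr ltn_add2l.
have lexE (a a' b b' : 'I_n.+1) :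
    (a * n.+1 + (n - b) < a' * n.+1 + (n - b'))%N =
    (a < a')%N || (a == a') && (b' < b)%N.
  have [lt|gt|/val_inj ->] := ltngtP a a'; rewrite -val_eqE /=.
  - apply: (@leq_trans (a.+1 * n.+1)); first by rewrite mulSnr ltn_add2l.
    by apply: (leq_trans _ (leq_addr _ _)); rewrite leq_mul2r lt.
  - rewrite (gtn_eqF gt) /=; apply/negbTE; rewrite -leqNgt.
    apply: (@leq_trans (a'.+1 * n.+1)).
      by rewrite mulSnr leq_add2l ltnW.
    by apply: (leq_trans _ (leq_addr _ _)); rewrite leq_mul2r gt.
  - rewrite eqxx ltn_add2l /=; apply: ltn_sub2lE.
    by rewrite -ltnS.
have keyE al al' : mv al -> mv al' -> (key al < key al')%N =
    ((val al).1 < (val al').1)%N ||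
    ((val al).1 == (val al').1) && ((val al').2 < (val al).2)%N.
  by move=> mal mal'; rewrite /key mal mal' !mul0n !add0n lexE.
have keyB al al' : mv al -> ~~ mv al' -> (key al < key al')%N.
  move=> mal mal'; rewrite /key mal mal' mul0n mul1n add0n.
  by apply: leq_trans (low _) (leq_addr _ _).
pose s := sort (fun al al' => key al <= key al')%N (enum {: posroot n}).
have ss : size s = npos n by rewrite size_sort -cardE.
have us : uniq s by rewrite sort_uniq enum_uniq.
have sk : sorted (fun al al' => key al <= key al')%N s.
  by apply: sort_sorted => x y; apply: leq_total.
have [al0|npos0] := pickP [pred al : posroot n | true]; last first.
  have npos_eq0 : npos n = 0%N by apply: eq_card0 => al; have := npos0 al.
  have no (k : 'I_(npos n)) : False by have := ltn_ord k; rewrite [X in (_ < X)%N]npos_eq0.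
  exists (fun k => False_rect _ (no k)); split; try by move=> k; case: (no k).
  by exists (fun al => enum_rank al) => k; [case: (no k) | have := npos0 k].
move=> _; pose beta (k : 'I_(npos n)) := nth al0 s k.
have binj : injective beta.
  move=> k l /eqP; rewrite nth_uniq ?ss ?ltn_ord // => /eqP; exact: val_inj.
have key_lt (k l : 'I_(npos n)) : (key (beta k) < key (beta l))%N -> (k < l)%N.
  apply: contraLR; rewrite -!leqNgt => lk.
  have tr : transitive (fun al al' => key al <= key al')%N.
    by move=> x y z; apply: leq_trans.
  have rf : reflexive (fun al al' => key al <= key al')%N.
    by move=> x; apply: leqnn.
  apply: (sorted_leq_nth tr rf al0 sk) => //.
    by rewrite -topredE /= ss ltn_ord.
  by rewrite -topredE /= ss ltn_ord.
exists beta; split.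
- by apply: inj_card_bij => //; rewrite card_ord.
- move=> k l mk ml; rewrite -keyE //; apply/idP/idP => [kl|]; last exact: key_lt.
  rewrite ltnNge; apply/negP; rewrite leq_eqVlt => /orP[|/key_lt]; last first.
    by rewrite ltnNge ltnW.
  move=> /eqP e; have := keyE _ _ mk ml; have := keyE _ _ ml mk.
  rewrite e ltnn => /esym/norP[r1 c1] /esym/norP[r2 c2].
  have r : (val (beta k)).1 = (val (beta l)).1.
    by apply: ord_inj; apply/eqP; rewrite -leqNgt in r1; rewrite -leqNgt in r2; rewrite eqn_leq r1 r2.
  rewrite r eqxx /= in c1 c2.
  have c : (val (beta k)).2 = (val (beta l)).2.
    by apply: ord_inj; apply/eqP; rewrite -leqNgt in c1; rewrite -leqNgt in c2; rewrite eqn_leq c1 c2.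
  move: kl; suff -> : k = l by rewrite ltnn.
  apply: binj; apply: val_inj.
  by rewrite [LHS]surjective_pairing [RHS]surjective_pairing r c.
- by move=> k l mk ml; apply/key_lt/keyB.
Qed.

(** * Cyclic modules generated by an extremal vector *)

Section ExtremalCyclic.

Variables (C : numFieldType) (n : nat) (I : {set 'I_n.+1}).
Variables (beta : 'I_(npos n) -> posroot n).

Notation N := (npos n).
Notation row := (rrow beta).
Notation col := (rcol beta).
Notation good := (moving I beta).
Notation E k := (root_vector C (beta k)).
Implicit Types p q : 'rV[nat]_(npos n).
Notation cpoint := (chain_point good (nested row col)).

Definition rank_one (g : 'I_n.+1 -> C) : 'M[C]_n.+1 :=
  \matrix_(a, b) (if (a \notin I) && (b \in I) then g a * g b else 0).

(** The four facts on which the computation of the essential exponents rests. The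
    third one bounds the nilpotency order of all rank one elements at once, and
    yields every straightening relation; the fourth one gives functionals that are
    triangular with respect to the order, and yields linear independence. Each of
    the four passes to tensor powers and along embeddings. *)
Definition extremal_cyclic (W : vectType C) (act : 'M[C]_n.+1 -> W -> W)
    (v : W) (m : nat) : Prop :=
  [/\ lie_module (@nplus C n) act fullv,
      forall a b : 'I_n.+1, (a < b)%N -> (a \in I) || (b \notin I) ->
        act (delta_mx a b) v = 0,
      forall g k, rank_one g \in @nplus C n -> (m < k)%N ->
        iter k (act (rank_one g)) v = 0 &
      forall p, cpoint m p -> exists phi : W -> C^o,
        [/\ linear phi, phi (monomial_act act beta p v) != 0 &
            forall q, phi (monomial_act act beta q v) != 0 -> hlex_le p q]].

Lemma E_nplus k : E k \in @nplus C n.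
Proof. exact/delta_nplus/(valP (beta k)). Qed.

Lemma E_mulmx k l : good k -> good l -> E k *m E l = 0.
Proof.
move=> /andP[_ bI] /andP[aI _]; rewrite /root_vector mul_delta_mx_cond.
case: eqP => [ab|_]; last by rewrite mulr0n.
by move: bI; rewrite /rcol ab -/(rrow beta l) (negPf aI).
Qed.

Hypothesis Hbeta : adapted I beta.

Let beta_bij : bijective beta. Proof. by case: Hbeta. Qed.

Lemma nplus_expand X : X \in @nplus C n -> X = \sum_k X (row k) (col k) *: E k.
Proof.
move=> /nplusP HX; apply/matrixP => a b; rewrite summxE.
have [ba|ab] := leqP b a.
  rewrite HX // big1 // => k _; rewrite !mxE.
  case: (a =P _) => [aE|]; last by rewrite mulr0.
  case: (b =P _) => [bE|]; last by rewrite mulr0.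
  by move: ba; rewrite aE bE leqNgt rrow_lt_rcol.
case: beta_bij => f fK Kf.
pose al : posroot n := exist (fun ab : 'I_n.+1 * 'I_n.+1 => ab.1 < ab.2)%N (a, b) ab.
pose k0 := f al; have k0E : beta k0 = al by rewrite Kf.
rewrite (bigD1 k0) //= big1 ?addr0 => [|k kk0].
  by rewrite !mxE /rrow /rcol k0E /= !eqxx mulr1.
rewrite !mxE; case: (a =P _) => [aE|]; last by rewrite mulr0.
case: (b =P _) => [bE|]; last by rewrite mulr0.
case/eqP: kk0; apply: (root_index_inj beta_bij).
  by rewrite /rrow k0E /= aE.
by rewrite /rcol k0E /= bE.
Qed.

Section Module.

Variables (W : vectType C) (act : 'M[C]_n.+1 -> W -> W) (v : W).
Notation mon q := (monomial_act act beta q v).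

Hypothesis Lact : lie_module (@nplus C n) act fullv.
Hypothesis kill : forall a b : 'I_n.+1, (a < b)%N -> (a \in I) || (b \notin I) ->
  act (delta_mx a b) v = 0.

Let act_lin k : linear (act (E k)).
Proof. exact/(lie_linear Lact)/E_nplus. Qed.

Lemma act_expand X u : X \in @nplus C n ->
  act X u = \sum_k X (row k) (col k) *: act (E k) u.
Proof.
move=> nX; rewrite {1}(nplus_expand nX).
rewrite (lie_act_sum Lact) ?nplus0 //; first last.
- by move=> k _; rewrite nplusZ // E_nplus.
- by move=> ? ?; apply: nplusD.
by apply: eq_bigr => k _; rewrite (lie_actZ Lact) ?nplus0 ?E_nplus.
Qed.

Lemma kill_bad k : ~~ good k -> act (E k) v = 0.
Proof.
rewrite negb_and negbK => gk; apply: kill => //; exact: (valP (beta k)).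
Qed.

Lemma act_E_comm k l u : good k -> good l ->
  act (E k) (act (E l) u) = act (E l) (act (E k) u).
Proof.
move=> gk gl; rewrite (lie_actC Lact) ?E_nplus // !E_mulmx // subr0.
by rewrite (lie_act0 Lact) ?nplus0 ?addr0.
Qed.

Lemma iter_E_comm k l j u : good k -> good l ->
  act (E k) (iter j (act (E l)) u) = iter j (act (E l)) (act (E k) u).
Proof.
by move=> gk gl; elim: j => //= j IHj; rewrite act_E_comm // IHj.
Qed.

Lemma iter_lin0 (f : W -> W) j : linear f -> iter j f 0 = 0.
Proof. by move=> lf; elim: j => //= j ->; apply: lin0. Qed.

Lemma mon0 : mon 0 = v.
Proof.
rewrite /monomial_act; elim: (enum _) => //= k s ->.
by rewrite mxE.
Qed.

(** The root vectors killing the generator are the last ones in the order, so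
    in an ordered monomial they act first. *)
Lemma mon_bad q k : ~~ good k -> q ord0 k != 0%N -> mon q = 0.
Proof.
move=> bk qk; rewrite /monomial_act.
have : pairwise (fun a b : 'I_N => good b ==> good a) (enum 'I_N).
  have : pairwise (fun a b : 'I_N => a < b)%N (enum 'I_N).
    rewrite -sorted_pairwise; last by move=> a b c; apply: ltn_trans.
    by have := iota_ltn_sorted 0 N; rewrite -val_enum_ord sorted_map.
  apply: sub_pairwise => a b ab; apply/implyP => gb.
  apply: contraLR ab => ba; rewrite -leqNgt ltnW //.
  by case: Hbeta => _ _; apply.
have : k \in enum 'I_N by rewrite mem_enum.
elim: (enum _) k bk qk => // l s IHs k bk qk; rewrite inE [pairwise _ _]/=.
move=> ks /andP[/allP gls pws].
have [/hasP[j js /andP[bj qj]]|/hasPn noj] :=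
    boolP (has (fun j => ~~ good j && (q ord0 j != 0%N)) s).
  by rewrite /= (IHs j) // iter_lin0.
have kl : k = l.
  by case/predU1P: ks => // ks; have := noj k ks; rewrite bk qk.
have sv : foldr (fun k u => iter (q ord0 k) (act (E k)) u) v s = v.
  elim: s {IHs ks pws} gls noj => //= j s IHs gls noj.
  rewrite IHs; last first.
  - by move=> i si; apply: noj; rewrite inE si orbT.
  - by move=> i si; apply: gls; rewrite inE si orbT.
  have := gls j (mem_head _ _); rewrite -kl (negPf bk) implybF => bj.
  by have := noj j (mem_head _ _); rewrite bj /= negbK => /eqP ->.
rewrite /= sv -kl; case: (q ord0 k) qk => // j _.
by rewrite iterSr kill_bad // iter_lin0.
Qed.

Lemma mon_shift q k : good k -> (forall l, ~~ good l -> q ord0 l = 0%N) ->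
  act (E k) (mon q) = mon (q + unit_exp k).
Proof.
move=> gk gq; rewrite /monomial_act.
have : k \in enum 'I_N by rewrite mem_enum.
elim: (enum _) (enum_uniq 'I_N) => // l s IHs /= /andP[ls us].
rewrite exponentD unit_expE inE; have [kl _|kl /= ks] := eqVneq k l.
  rewrite kl addn1 iterS; congr (act _ (iter _ _ _)).
  elim: s ls {us IHs} => //= j s IHs; rewrite inE negb_or => /andP[lj ls].
  by rewrite exponentD unit_expE eq_sym (negPf lj) addn0 -IHs.
rewrite addn0 -IHs //.
have [gl|/gq ->] := boolP (good l); last by [].
exact: iter_E_comm.
Qed.

Lemma mon_shifts q w : (forall l, ~~ good l -> q ord0 l = 0%N) ->
  all good w -> foldr (fun k u => act (E k) u) (mon q) w = mon (q + content w).
Proof.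
move=> gq; elim: w => [|k w IHw] /=; first by rewrite /content big_nil addr0.
move=> /andP[gk gw]; rewrite IHw // mon_shift //.
  by congr (monomial_act _ _ _ _); rewrite /content big_cons -addrA [_ + unit_exp _]addrC.
move=> l bl; rewrite exponentD gq // contentE add0n.
apply/count_memPn; apply: contra bl; exact: (allP gw).
Qed.

Definition mon_span : {vspace W} := lspan [set u | exists q, u = mon q]%classic.

(** An arbitrary root vector is moved to the right past commuting ones; the
    commutators are again in the Lie algebra and act on shorter monomials. *)
Lemma mon_span_stable : stable (@nplus C n) act mon_span.
Proof.
pose U := mon_span.
have monU q : mon q \in U by apply: mem_lspan; exists q.
have stE k : good k -> forall u, u \in U -> act (E k) u \in U.
  move=> gk; apply: lspan_ind.
  - by rewrite lin0 ?mem0v.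
  - by move=> c x y xU yU; rewrite act_lin memvD // memvZ.
  - move=> _ [q ->].
    have [/existsP[l /andP[bl ql]]|/existsPn gq] :=
      boolP [exists l, ~~ good l && (q ord0 l != 0%N)].
      by rewrite (mon_bad bl ql) lin0 ?mem0v.
    rewrite mon_shift // => l bl; apply/eqP.
    by have := gq l; rewrite bl /= negbK.
suff main q X : X \in @nplus C n -> act X (mon q) \in U.
  move=> X u nX; move: u; apply: lspan_ind.
  - by rewrite (lin0 (lie_linear Lact nX)) mem0v.
  - by move=> c x y xU yU; rewrite (lie_linear Lact nX) memvD // memvZ.
  - by move=> _ [q ->]; apply: main.
have [/existsP[l /andP[bl ql]]|/existsPn gq] :=
  boolP [exists l, ~~ good l && (q ord0 l != 0%N)].
  move=> nX; rewrite (mon_bad bl ql) (lin0 (lie_linear Lact nX)); exact: mem0v.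
have {}gq l : ~~ good l -> q ord0 l = 0%N.
  by move=> bl; apply/eqP; have := gq l; rewrite bl /= negbK.
elim/exp_ind: q gq X => [|q k IHq] gq X nX.
  rewrite mon0 act_expand // memv_suml // => k _; apply: memvZ.
  have [gk|bk] := boolP (good k); last by rewrite kill_bad ?mem0v.
  by apply: stE => //; rewrite -mon0.
have gk : good k.
  by apply: contraT => /gq; rewrite exponentD unit_expE eqxx addn1.
have {}gq l : ~~ good l -> q ord0 l = 0%N.
  by move=> /gq; rewrite exponentD => /eqP; rewrite addn_eq0 => /andP[/eqP].
rewrite -mon_shift // (lie_actC Lact) ?E_nplus // memvD //.
  by apply: stE => //; apply: IHq.
by apply: IHq => //; rewrite nplus_br ?E_nplus.
Qed.

Lemma Ug_mon_span : Ug (@nplus C n) act v = mon_span.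
Proof.
apply/eqP; rewrite eqEsubv Ug_min /=; first last.
- by apply: mem_lspan; exists 0; rewrite mon0.
- exact: mon_span_stable.
have st : stable (@nplus C n) act (Ug (@nplus C n) act v).
  by apply: Ug_stable => X; apply: lie_linear.
apply: lspan_sub => _ [q ->]; rewrite /monomial_act.
elim: (enum _) => [|k s IHs] /=; first exact: Ug_gen.
elim: (q ord0 k) => //= j IHj; apply: st => //; exact: E_nplus.
Qed.

(** The degree of the vertex [x] in the multigraph with [q k] edges joining the row
    and the column of [k]. It is the exponent of [g x] in the coefficient of the
    monomial [q] in a power of [rank_one g]. *)
Definition vertex_degree q (x : 'I_n.+1) : nat :=
  (\sum_k q ord0 k * ((row k == x) + (col k == x)))%N.

Lemma vertex_degreeD p q x :
  vertex_degree (p + q) x = (vertex_degree p x + vertex_degree q x)%N.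
Proof.
by rewrite /vertex_degree -big_split; apply: eq_bigr => k _; rewrite exponentD mulnDl.
Qed.

Lemma vertex_degree_unit k x :
  vertex_degree (unit_exp k) x = ((row k == x) + (col k == x))%N.
Proof.
rewrite /vertex_degree (bigD1 k) //= unit_expE eqxx mul1n big1 ?addn0 // => j jk.
by rewrite unit_expE (negPf jk).
Qed.

Lemma prod_vertex_degree (z : 'I_n.+1 -> C) w :
  \prod_(k <- w) (z (row k) * z (col k)) =
  \prod_x z x ^+ vertex_degree (content w) x.
Proof.
have vertex y : z y = \prod_x z x ^+ (y == x).
  rewrite (bigD1 y) //= eqxx big1 ?mulr1 // => x; rewrite eq_sym.
  by move=> /negPf ->.
elim: w => [|k w IHw].
  rewrite /content !big_nil big1 // => x _.
  by rewrite /vertex_degree big1 // => k _; rewrite mxE.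
rewrite /content !big_cons IHw (vertex (row k)) (vertex (col k)) -!big_split /=.
by apply: eq_bigr => x _; rewrite vertex_degreeD vertex_degree_unit !exprD.
Qed.

(** Rows lie outside [I] and columns inside, so a single function records both kinds
    of margins. *)
Lemma vertex_degree_margins p q :
    (forall k, ~~ good k -> p ord0 k = 0%N) ->
    (forall k, ~~ good k -> q ord0 k = 0%N) ->
    (forall x, vertex_degree p x = vertex_degree q x) ->
  same_margins row col p q.
Proof.
have rowE (r : 'rV[nat]_N) x : (forall k, ~~ good k -> r ord0 k = 0%N) ->
    (\sum_(k | row k == x) r ord0 k = if x \in I then 0 else vertex_degree r x)%N.
  move=> gr; rewrite big_mkcond /vertex_degree /=; case: ifP => xI.
    rewrite big1 // => k _; case: eqP => // kx.
    by rewrite gr // /moving kx xI.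
  apply: eq_bigr => k _; have [/andP[_ cI]|/gr ->] := boolP (good k).
    rewrite [col k == x](_ : _ = false); last by apply: contraFF xI => /eqP <-.
    by rewrite addn0; case: eqP; rewrite ?muln1 ?muln0.
  by rewrite mul0n; case: eqP.
have colE (r : 'rV[nat]_N) x : (forall k, ~~ good k -> r ord0 k = 0%N) ->
    (\sum_(k | col k == x) r ord0 k = if x \in I then vertex_degree r x else 0)%N.
  move=> gr; rewrite big_mkcond /vertex_degree /=; case: ifP => xI; last first.
    rewrite big1 // => k _; case: eqP => // kx.
    by rewrite gr // /moving kx xI andbF.
  apply: eq_bigr => k _; have [/andP[rI _]|/gr ->] := boolP (good k).
    rewrite [row k == x](_ : _ = false); last by apply: contraNF rI => /eqP ->.
    by case: eqP; rewrite ?muln1 ?muln0.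
  by rewrite mul0n; case: eqP.
move=> gp gq pq; split=> x.
  by rewrite (rowE p) // (rowE q) // pq.
by rewrite (colE p) // (colE q) // pq.
Qed.

Lemma index_lex k l : good k -> good l -> (k < l)%N =
  (row k < row l)%N || (row k == row l) && (col l < col k)%N.
Proof. by case: Hbeta => _ + _; apply. Qed.

Lemma iter_rank_one (g z : 'I_n.+1 -> C) (s : seq 'I_N) j :
    all good s -> uniq s -> rank_one g \in @nplus C n ->
    (forall k, good k ->
       g (row k) * g (col k) = if k \in s then z (row k) * z (col k) else 0) ->
  iter j (act (rank_one g)) v =
  \sum_(w <- words s j) (\prod_(k <- w) (z (row k) * z (col k))) *:
     mon (content w).
Proof.
move=> gs us nX gE.
have actE u : act (rank_one g) u = \sum_(k <- s) (z (row k) * z (col k)) *: act (E k) u.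
  rewrite act_expand // (big_uniq _ us) [X in _ = X]big_mkcond /=.
  apply: eq_bigr => k _.
  rewrite mxE -/(good k); case: ifP => gk; last first.
    rewrite scale0r; case: ifP => // ks.
    by have := allP gs k ks; rewrite gk.
  by rewrite gE //; case: ifP => // _; rewrite scale0r.
elim: j => [|j IHj].
  by rewrite big_seq1 /content !big_nil scale1r mon0.
rewrite iterS IHj actE big_allpairs_dep; apply: eq_big_seq => k ks.
have gk := allP gs k ks.
rewrite (lin_sum (@act_lin k)) scaler_sumr; apply: eq_big_seq => w.
rewrite mem_words => /andP[_ /allP ws].
rewrite (linZ (@act_lin k)) scalerA big_cons mon_shift //; last first.
  move=> l bl; rewrite contentE; apply/count_memPn.
  by apply: contra bl => /ws /(allP gs).
by rewrite /content big_cons addrC.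
Qed.

(** The power of a rank one element vanishes on the generator for all values of
    its entries, so each coefficient of its expansion vanishes separately. The
    coefficient whose margins are those of the part of [p] on the violating
    chain has that part as its largest exponent. *)
Lemma straighten m p :
    (forall g k, rank_one g \in @nplus C n -> (m < k)%N ->
       iter k (act (rank_one g)) v = 0) ->
  ~~ cpoint m p -> mon p \in filt_lt act beta v p.
Proof.
move=> nil; rewrite negb_and => cp.
have [/existsP[l /andP[bl ql]]|/existsPn gp] :=
  boolP [exists l, ~~ good l && (p ord0 l != 0%N)].
  by rewrite (mon_bad bl ql) mem0v.
have {}gp l : ~~ good l -> p ord0 l = 0%N.
  by move=> bl; apply/eqP; have := gp l; rewrite bl /= negbK.
move: cp; have -> /= : [forall k, good k || (p ord0 k == 0%N)].
  by apply/forallP => k; case: (boolP (good k)) => //= /gp ->.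
rewrite negb_forall => /existsP[c]; rewrite negb_imply -ltnNge => /andP[/chainP cc mc].
pose c1 := [set k in c | (0 < p ord0 k)%N]%SET.
have c1P k : (k \in c1) = (k \in c) && (0 < p ord0 k)%N by rewrite inE.
have gc1 k : k \in c1 -> good k.
  by rewrite c1P => /andP[_]; apply: contraTT => /gp ->.
pose p0 : 'rV[nat]_N := \row_k (if k \in c1 then p ord0 k else 0)%N.
pose q0 : 'rV[nat]_N := \row_k (if k \in c1 then 0 else p ord0 k)%N.
have pE : p = p0 + q0.
  by apply: exponentP => k; rewrite exponentD !mxE; case: ifP; rewrite ?addn0.
have gp0 l : ~~ good l -> p0 ord0 l = 0%N by move=> bl; rewrite mxE gp // if_same.
have gq0 l : ~~ good l -> q0 ord0 l = 0%N by move=> bl; rewrite mxE gp // if_same.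
have cp0 : chain (nested row col) [set k | (0 < p0 ord0 k)%N]%SET.
  apply/chainP => k l; rewrite !inE !mxE !c1P; case: ifP => // /andP[kc _] _.
  by case: ifP => // /andP[lc _] _; apply: cc.
set K := total_degree p0.
have mK : (m < K)%N.
  apply: (leq_trans mc); rewrite /K /total_degree big_mkcond; apply: leq_sum => k _.
  rewrite mxE c1P; case: (k \in c) => //=.
  by case: ifP => //; rewrite lt0n => /negbFE/eqP ->.
(* the rows and columns of the chain span a full rectangle of positive roots *)
pose inA x := [exists k in c1, row k == x].
pose inB x := [exists k in c1, col k == x].
have inAI x : inA x -> x \notin I.
  by case/exists_inP=> k /gc1 /andP[rI _] /eqP <-.
have inBI x : inB x -> x \in I.
  by case/exists_inP=> k /gc1 /andP[_ cI] /eqP <-.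
have AB (x y : 'I_n.+1) : inA x -> inB y -> (x < y)%N.
  case/exists_inP=> k kc /eqP <-; case/exists_inP=> l lc /eqP <-.
  move: kc lc; rewrite !c1P => /andP[kc _] /andP[lc _].
  have /orP[/andP[rkl _]|/andP[_ ckl]] := cc k l kc lc.
    exact: leq_ltn_trans rkl (rrow_lt_rcol _ _).
  exact: leq_trans (rrow_lt_rcol _ _) ckl.
pose s := [seq k <- enum 'I_N | good k && (inA (row k) && inB (col k))].
have sP k : (k \in s) = good k && (inA (row k) && inB (col k)).
  by rewrite mem_filter mem_enum andbT.
have gs : all good s by apply/allP => k; rewrite sP => /andP[].
have us : uniq s by rewrite filter_uniq ?enum_uniq.
(* the coefficient of the margins of [p0] in the power of order [K] *)
have rel0 : \sum_(w <- words s K | [forall x, vertex_degree (content w) x ==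
    vertex_degree p0 x]) mon (content w) = 0.
  apply: extract_coef => z.
  (* the entries are kept free on the rectangle and vanish elsewhere *)
  pose g x := if inA x || inB x then z x else 0.
  have gE k : good k -> g (row k) * g (col k) =
      if k \in s then z (row k) * z (col k) else 0.
    rewrite sP => gk; rewrite gk /g /=; case/andP: gk => rI cI.
    have -> : inB (row k) = false by apply: contraNF rI => /inBI.
    have -> : inA (col k) = false by apply: contraTF cI => /inAI.
    by rewrite orbF /=; case: (inA _) => /=; case: (inB _); rewrite ?mulr0 ?mul0r.
  have nX : rank_one g \in @nplus C n.
    apply/nplusP => a b ba; rewrite mxE; case: ifP => // /andP[aI bI].
    rewrite /g; have -> : inB a = false by apply: contraNF aI => /inBI.
    have -> : inA b = false by apply: contraTF bI => /inAI.
    rewrite orbF /=; case: (boolP (inA a)) => [Aa|]; rewrite ?mul0r //.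
    case: (boolP (inB b)) => [Bb|]; rewrite ?mulr0 //.
    by have := AB a b Aa Bb; rewrite ltnNge ba.
  rewrite -[RHS](nil g K nX mK) (iter_rank_one K gs us nX gE).
  by apply: eq_bigr => w _; rewrite prod_vertex_degree.
have goodW w : w \in words s K -> forall l, ~~ good l -> content w ord0 l = 0%N.
  rewrite mem_words => /andP[_ /allP ws] l bl.
  rewrite contentE; apply/count_memPn; apply: contra bl => /ws /(allP gs).
  exact.
have [w0 w0E] := content_onto q0.
have gw0 : all good w0.
  apply/allP => k kw; apply: contraLR kw => /gq0.
  by rewrite -w0E contentE => /eqP; rewrite -leqn0 leqNgt -has_count has_pred1.
pose app u := foldr (fun k u => act (E k) u) u w0.
have lapp : linear app.
  rewrite /app => a x y; elim: (w0) => //= k w ->.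
  exact: (act_lin k).
have {rel0} := congr1 app rel0.
rewrite (lin0 lapp) (lin_sum lapp) big_seq_cond.
under eq_bigr => w /andP[/goodW gw _] do rewrite /app mon_shifts // w0E.
rewrite -big_seq_cond (bigID (fun w => content w == p0)) /=.
rewrite (eq_bigr (fun=> mon p)); last first.
  by move=> w /andP[_ /eqP ->]; rewrite pE.
rewrite big_const_seq iter_addr_0 => /eqP; rewrite addr_eq0 => /eqP rel.
set nb := count _ _ in rel.
(* the coefficient counts the words with content [p0] *)
suff nb0 : (0 < nb)%N.
  have -> : mon p = nb%:R^-1 *: (mon p *+ nb).
    by rewrite -scaler_nat scalerA mulVf ?scale1r // pnatr_eq0 -lt0n.
  rewrite rel memvZ // memvN big_seq_cond memv_suml // => w.
  case/andP=> ws /andP[/forallP dw cw]; apply: mem_lspan.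
  exists (content w + q0); rewrite // [X in hlex_lt _ X]pE hlex_add.
  apply: (staircase_max (row := row) (col := col) (good := good)) => //.
  - exact: index_lex.
  - exact: goodW.
  - apply: vertex_degree_margins => //; first exact: goodW.
    by move=> x; apply/esym/eqP/dw.
  - by rewrite eq_sym.
rewrite /nb -has_count; have [w1 w1E] := content_onto p0.
apply/hasP; exists w1; last first.
  by rewrite w1E eqxx andbT; apply/forallP => x.
rewrite mem_words -total_degree_content w1E eqxx /=; apply/allP => k kw.
have : (0 < p0 ord0 k)%N by rewrite -w1E contentE -has_count has_pred1.
rewrite mxE; case: ifP => // kc _; change (is_true (k \in s)).
rewrite sP gc1 //=; apply/andP; split.
  by apply/exists_inP; exists k.
by apply/exists_inP; exists k.
Qed.

End Module.

End ExtremalCyclic.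

(** * Essential exponents and dimension *)

Section EssentialExponents.

Variables (C : numFieldType) (n : nat) (I : {set 'I_n.+1}).
Variables (beta : 'I_(npos n) -> posroot n).
Variables (W : vectType C) (act : 'M[C]_n.+1 -> W -> W) (v : W) (m : nat).

Notation N := (npos n).
Notation nest := (nested (rrow beta) (rcol beta)).
Notation cpoint := (chain_point (moving I beta) nest).
Notation mon q := (monomial_act act beta q v).
Implicit Types p q : 'rV[nat]_(npos n).

Hypothesis Hbeta : adapted I beta.
Hypothesis Hext : extremal_cyclic I beta act v m.

(** A smaller exponent is not above [p], so the functional kills its monomial. *)
Lemma functional_span p (phi : W -> C^o) u : linear phi ->
    (forall q, phi (mon q) != 0 -> hlex_le p q) ->
  u \in filt_lt act beta v p -> phi u = 0.
Proof.
move=> lphi tri; move: u; apply: lspan_ind.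
- exact: lin0.
- by move=> c x y x0 y0; rewrite lphi x0 y0 scaler0 addr0.
move=> _ [q qp ->]; apply/eqP; apply: contraTT qp => /tri pq.
by rewrite hlex_le_lt.
Qed.

(** Exponents violating a chain inequality are straightened; for the others the
    triangular functional separates the monomial from the smaller ones. *)
Lemma essentialE p : essential act beta v p <-> cpoint m p.
Proof.
case: (Hext) => Lact kill nil fun_ex; split=> [ess|cp].
  apply: contraNT ess => /(straighten Hbeta Lact kill nil) monlt.
  rewrite eqEsubv; apply/andP; split; apply: lspan_sub => _ [q qp ->].
    by case/predU1P: qp => [->//|qp]; apply: mem_lspan; exists q.
  by apply: mem_lspan; exists q => //; rewrite /hlex_le qp orbT.
have [phi [lphi phip tri]] := fun_ex p cp.
apply/eqP => filtE; case/eqP: phip; apply: functional_span lphi tri _.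
by rewrite -filtE; apply: mem_lspan; exists p; rewrite ?hlex_le_refl.
Qed.

Lemma mon_chain_span p :
  mon p \in <<[seq mon q | q <- chain_points (moving I beta) nest m]>>%VS.
Proof.
case: Hext => Lact kill nil _; elim/hlex_ind: p => p IHp.
have [cp|ncp] := boolP (cpoint m p).
  apply/memv_span/map_f; rewrite mem_chain_points //; exact: nested_refl.
apply: subvP (straighten Hbeta Lact kill nil ncp).
by apply: lspan_sub => _ [q qp ->]; apply: IHp.
Qed.

(** Straightening terminates because the order is well founded, and in decreasing
    order the monomials are independent by the triangular functionals. *)
Lemma dim_Ug_chain : \dim (Ug (@nplus C n) act v) =
  size (chain_points (moving I beta) nest m).
Proof.
case: (Hext) => Lact kill nil fun_ex; rewrite (Ug_mon_span Hbeta Lact kill).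
set L := chain_points _ _ _.
pose ge p q := hlex_le q p.
have perm : perm_eq (sort ge L) L by rewrite perm_sort.
rewrite -(size_sort ge) -(size_map (fun q => mon q)).
have sortL : sorted ge (sort ge L).
  by apply: sort_sorted => p q; apply: hlex_le_total.
have uL : uniq (sort ge L) by rewrite sort_uniq chain_points_uniq.
have cL p : p \in sort ge L -> cpoint m p.
  by rewrite mem_sort mem_chain_points //; apply: nested_refl.
have -> : mon_span beta act v = <<[seq mon q | q <- sort ge L]>>%VS.
  apply/eqP; rewrite eqEsubv; apply/andP; split.
    apply: lspan_sub => _ [q ->]; apply: subvP (mon_chain_span q).
    by apply: sub_span => x; rewrite (eq_mem_map _ (perm_mem perm)).
  by apply/span_subvP => _ /mapP[q _ ->]; apply: mem_lspan; exists q.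
apply/eqP; rewrite -/(free _).
elim: (sort ge L) sortL uL cL => [|p s IHs]; first by rewrite nil_free.
move=> /= pths /andP[ps us] cps; rewrite free_cons; apply/andP; split; last first.
  apply: IHs => //; first exact: path_sorted pths.
  by move=> q qs; apply: cps; rewrite inE qs orbT.
have /fun_ex[phi [lphi phip tri]] := cps p (mem_head _ _).
apply: contra phip => monps; apply/eqP.
apply: (functional_span lphi tri); apply: subvP monps.
apply/span_subvP => _ /mapP[q qs ->]; apply: mem_lspan; exists q => //.
have tr : transitive ge by move=> a b c ba ac; apply: hlex_le_trans ac ba.
have := order_path_min tr pths => /allP/(_ q qs) /predU1P[qp|//].
by move: ps; rewrite -qp qs.
Qed.

End EssentialExponents.

(** * Tensor powers *)

Section TensorPowers.

Variables (C : numFieldType) (n : nat) (W : vectType C) (B : finType).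
Variables (e : B -> W) (co : B -> W -> C^o).
Hypothesis co_lin : forall b, linear (co b).
Hypothesis coE : forall x, x = \sum_b co b x *: e b.
Variables (r : nat) (act : 'M[C]_n.+1 -> W -> W).
Implicit Types (X Y : 'M[C]_n.+1) (t : {ffun 'I_r -> B}).

(** The tensor power in coordinates with respect to an arbitrary family of vectors
    and functionals. It covers the coordinates [vbasis] of an abstract space as well
    as the monomial basis of the exterior algebra, in which weights and the
    hermitian form are visible. *)
Definition tpow : vectType C := {ffun {ffun 'I_r -> B} -> C^o}.
Implicit Types F : tpow.

Definition upd (T : Type) (t : 'I_r -> T) (k : 'I_r) (b : T) :=
  fun l => if l == k then b else t l.

Definition tpow_pure (u : 'I_r -> W) : tpow :=
  [ffun t : {ffun 'I_r -> B} => \prod_k co (t k) (u k)].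

(** The operator with matrix [A] acting on the tensor position [k]. *)
Definition slot (k : 'I_r) (A : B -> B -> C) F : tpow :=
  [ffun t : {ffun 'I_r -> B} =>
     \sum_b A (t k) b * (F : {ffun _}) [ffun l => upd t k b l]].

Definition act_coef X (b c : B) : C := co b (act X (e c)).

Definition tpow_act X F : tpow :=
  [ffun t : {ffun 'I_r -> B} =>
     \sum_k \sum_b act_coef X (t k) b * (F : {ffun _}) [ffun l => upd t k b l]].

Lemma tpow_actE X F : tpow_act X F = \sum_k slot k (act_coef X) F.
Proof. by apply/ffunP => t; rewrite sum_ffunE !ffunE; apply: eq_bigr => k _; rewrite ffunE. Qed.

Lemma slot_lin k A : linear (slot k A).
Proof.
move=> c F G; apply/ffunP => t; rewrite !ffunE scaler_sumr -big_split /=.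
by apply: eq_bigr => b _; rewrite !ffunE mulrDr mulrCA.
Qed.

Lemma slot_mul k A A' F :
  slot k A (slot k A' F) = slot k (fun b c => \sum_d A b d * A' d c) F.
Proof.
apply/ffunP => t; rewrite !ffunE.
under eq_bigr do rewrite ffunE mulr_sumr.
rewrite exchange_big /=; apply: eq_bigr => c _; rewrite mulr_suml.
apply: eq_bigr => b _; rewrite ffunE /upd eqxx mulrA; congr (_ * F _).
by apply/ffunP => l; rewrite !ffunE; case: eqP.
Qed.

Lemma slot_comm k l A A' F : k != l ->
  slot k A (slot l A' F) = slot l A' (slot k A F).
Proof.
move=> kl; apply/ffunP => t; rewrite !ffunE.
under eq_bigr do rewrite ffunE mulr_sumr.
under [RHS]eq_bigr do rewrite ffunE mulr_sumr.
rewrite exchange_big /=; apply: eq_bigr => c _; apply: eq_bigr => b _.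
rewrite !ffunE /upd (negPf kl) eq_sym (negPf kl) mulrCA; congr (_ * (_ * F _)).
apply/ffunP => j; rewrite !ffunE; case: eqP => // ->.
by rewrite eq_sym (negPf kl).
Qed.

Lemma tpow_act_lin X : linear (tpow_act X).
Proof.
move=> c F G; rewrite !tpow_actE scaler_sumr -big_split.
by apply: eq_bigr => k _; apply: slot_lin.
Qed.

(** Operators in distinct positions commute, so only the terms in which both
    operators act in the same position survive in a commutator. *)
Lemma tpow_lie (g : {pred 'M[C]_n.+1}) :
  lie_module g act fullv -> lie_module g tpow_act fullv.
Proof.
move=> Lg; split.
- by move=> X F _ _; apply: memvf.
- by move=> X _ F G _ _ c; apply: tpow_act_lin.
- case: Lg => _ _ H _ X Y gX gY F _ c; apply/ffunP => t.
  rewrite !ffunE scaler_sumr -big_split; apply: eq_bigr => k _ /=.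
  rewrite scaler_sumr -big_split; apply: eq_bigr => b _ /=.
  by rewrite /act_coef H ?memvf // co_lin mulrDl -mulrA.
move=> X Y gX gY F _.
have coefM (Z T : 'M[C]_n.+1) b c : Z \in g ->
    \sum_d act_coef Z b d * act_coef T d c = co b (act Z (act T (e c))).
  move=> gZ; rewrite [act T _]coE (lin_sum (lie_linear Lg gZ)) (lin_sum (co_lin b)).
  apply: eq_bigr => d _.
  by rewrite (linZ (lie_linear Lg gZ)) (linZ (co_lin b)) mulrC.
have actM (Z T : 'M[C]_n.+1) : Z \in g -> tpow_act Z (tpow_act T F) =
    \sum_k (slot k (fun b c => co b (act Z (act T (e c)))) F +
      \sum_(l | l != k) slot k (act_coef Z) (slot l (act_coef T) F)).
  move=> gZ; rewrite !tpow_actE; apply: eq_bigr => k _.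
  rewrite (lin_sum (slot_lin k (act_coef Z))) (bigD1 k) //=; congr (_ + _).
  rewrite slot_mul; apply/ffunP => t; rewrite !ffunE; apply: eq_bigr => b _.
  by rewrite coefM.
rewrite !actM // !big_split /=.
have -> : \sum_(k < r) \sum_(l < r | l != k)
    slot k (act_coef X) (slot l (act_coef Y) F) =
  \sum_(k < r) \sum_(l < r | l != k)
    slot k (act_coef Y) (slot l (act_coef X) F).
  rewrite (exchange_big_dep xpredT) //=; apply: eq_bigr => k _.
  under eq_bigl do rewrite eq_sym.
  by apply: eq_bigr => l lk; rewrite slot_comm.
rewrite opprD addrACA subrr addr0 tpow_actE -sumrB; apply: eq_bigr => k _.
apply/ffunP => t; rewrite !ffunE -sumrB; apply: eq_bigr => b _.
rewrite -mulrBl; congr (_ * _); rewrite /act_coef.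
case: Lg => _ _ _ H; rewrite H ?memvf //.
by rewrite (linD (co_lin _)) (linN (co_lin _)).
Qed.

Lemma eq_tpow_pure u w : u =1 w -> tpow_pure u = tpow_pure w.
Proof. by move=> uw; apply/ffunP => t; rewrite !ffunE; apply: eq_bigr => k _; rewrite uw. Qed.

Lemma tpow_pure0 u k : u k = 0 -> tpow_pure u = 0.
Proof.
move=> uk; apply/ffunP => t; rewrite !ffunE (bigD1 k) //= uk.
by rewrite (lin0 (co_lin _)) mul0r.
Qed.

Lemma tpow_leibniz X (u : 'I_r -> W) : linear (act X) ->
  tpow_act X (tpow_pure u) = \sum_k tpow_pure (upd u k (act X (u k))).
Proof.
move=> lX; apply/ffunP => t; rewrite sum_ffunE ffunE.
apply: eq_bigr => k _; rewrite ffunE (bigD1 k) //= /upd eqxx.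
rewrite {1}[u k]coE (lin_sum lX) (lin_sum (co_lin _)) mulr_suml.
apply: eq_bigr => b _; rewrite (linZ lX) (linZ (co_lin _)) ffunE (bigD1 k) //=.
rewrite ffunE eqxx mulrCA mulrA; congr (_ * _).
by apply: eq_bigr => l lk; rewrite ffunE (negPf lk).
Qed.

Definition tpow_functional (phi : 'I_r -> W -> C^o) F : C^o :=
  \sum_t (F : {ffun _}) t * \prod_k phi k (e (t k)).

Lemma tpow_functional_lin phi : linear (tpow_functional phi).
Proof.
move=> c F G; rewrite /tpow_functional scaler_sumr -big_split.
by apply: eq_bigr => t _; rewrite !ffunE mulrDl -mulrA.
Qed.

Lemma tpow_functional_pure phi u : (forall k, linear (phi k)) ->
  tpow_functional phi (tpow_pure u) = \prod_k phi k (u k).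
Proof.
move=> lphi; rewrite /tpow_functional.
transitivity (\sum_(t : {ffun 'I_r -> B}) \prod_k (co (t k) (u k) * phi k (e (t k)))).
  by apply: eq_bigr => t _; rewrite ffunE -big_split.
rewrite -(bigA_distr_bigA (fun k b => co b (u k) * phi k (e b))) /=.
apply: eq_bigr => k _; rewrite [u k in RHS]coE (lin_sum (lphi k)).
by apply: eq_bigr => b _; rewrite (linZ (lphi k)).
Qed.

(** Each of the [j] factors chooses a position; the list records the choices with
    multiplicity. *)
Lemma iter_tpow_pure X v j : linear (act X) ->
  exists2 L : seq {ffun 'I_r -> nat}, forall d, d \in L -> (\sum_k d k = j)%N &
    iter j (tpow_act X) (tpow_pure (fun=> v)) =
    \sum_(d <- L) tpow_pure (fun k => iter (d k) (act X) v).
Proof.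
move=> lX; elim: j => [|j [L LP IHj]].
  exists [:: [ffun=> 0%N]] => [d|]; last first.
    by rewrite big_seq1; apply: eq_tpow_pure => k; rewrite ffunE.
  by rewrite inE => /eqP ->; rewrite big1 // => k _; rewrite ffunE.
exists [seq [ffun l => (d l + (l == k))%N] | d : {ffun 'I_r -> nat} <- L,
                                              k <- enum 'I_r].
  move=> _ /allpairsP[[d k] [/= /LP dj _ ->]].
  under eq_bigr do rewrite ffunE.
  rewrite big_split /= dj (bigD1 k) //= eqxx big1 ?addn1 // => l lk.
  by rewrite (negPf lk).
rewrite iterS IHj big_allpairs_dep (lin_sum (tpow_act_lin X)).
apply: eq_bigr => d _; rewrite tpow_leibniz // big_enum; apply: eq_bigr => k _.
apply: eq_tpow_pure => l; rewrite /upd ffunE; case: eqP => [->|_].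
  by rewrite addn1.
by rewrite addn0.
Qed.

Variables (I : {set 'I_n.+1}) (beta : 'I_(npos n) -> posroot n).
Hypothesis Hbeta : adapted I beta.
Variables (v : W) (m : nat).
Hypothesis Hext : extremal_cyclic I beta act v m.

Notation N := (npos n).
Notation good := (moving I beta).
Notation mon q := (monomial_act act beta q v).
Notation tmon q := (monomial_act tpow_act beta q (tpow_pure (fun=> v))).
Implicit Types p q : 'rV[nat]_(npos n).

Let Lact : lie_module (@nplus C n) act fullv. Proof. by case: Hext. Qed.
Let kill (a b : 'I_n.+1) : (a < b)%N -> (a \in I) || (b \notin I) ->
  act (delta_mx a b) v = 0.
Proof. by case: Hext => _ + _ _; apply. Qed.

Lemma tpow_kill (a b : 'I_n.+1) : (a < b)%N -> (a \in I) || (b \notin I) ->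
  tpow_act (delta_mx a b) (tpow_pure (fun=> v)) = 0.
Proof.
move=> ab aI; rewrite tpow_leibniz; last exact/(lie_linear Lact)/delta_nplus.
by rewrite big1 // => k _; apply: (tpow_pure0 (k := k)); rewrite /upd eqxx kill.
Qed.

(** A monomial acts on a pure tensor by distributing its factors over the
    tensor positions; the list records the distributions with multiplicity. *)
Lemma tpow_mon q : (forall l, ~~ good l -> q ord0 l = 0%N) ->
  exists2 L : seq {ffun 'I_r -> 'rV[nat]_N},
    forall d : {ffun 'I_r -> 'rV[nat]_N}, (d \in L) = (\sum_k d k == q) &
    tmon q = \sum_(d <- L) tpow_pure (fun k => mon (d k)).
Proof.
elim/exp_ind: q => [_|q k IHq gq].
  exists [:: [ffun=> 0]] => [d|]; last first.
    rewrite big_seq1 !mon0; apply: eq_tpow_pure => k.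
    by rewrite ffunE mon0.
  rewrite inE; apply/eqP/eqP => [->|d0].
    by rewrite big1 // => k _; rewrite ffunE.
  apply/ffunP => k; rewrite ffunE; apply: exponentP => j; rewrite mxE.
  have := congr1 (fun x : 'rV[nat]_N => x ord0 j) d0.
  rewrite exponent_sum mxE => /eqP; rewrite sum_nat_eq0 => /forallP/(_ k) /eqP.
  exact.
have gk : good k.
  by apply: contraT => /gq; rewrite exponentD unit_expE eqxx addn1.
have {}gq l : ~~ good l -> q ord0 l = 0%N.
  by move=> /gq; rewrite exponentD => /eqP; rewrite addn_eq0 => /andP[/eqP].
have [L LP Lq] := IHq gq.
exists [seq [ffun j => d j + (if j == l then unit_exp k else 0)]
  | d : {ffun 'I_r -> 'rV[nat]_N} <- L, l <- enum 'I_r] => [d'|].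
  apply/allpairsP/eqP => [[[d l] /= [dL _ ->]]|d'E].
    under eq_bigr do rewrite ffunE.
    move: dL; rewrite LP big_split /= => /eqP ->; congr (_ + _).
    by rewrite (bigD1 l) //= eqxx big1 ?addr0 // => j /negPf ->.
  have [l d'l] : exists l, (0 < d' l ord0 k)%N.
    apply/existsP; apply: contraPT d'E => /existsPn d'0 /(congr1 (fun x : 'rV[nat]_N => x ord0 k)).
    rewrite exponent_sum big1 ?exponentD ?unit_expE ?eqxx ?addn1 // => l _.
    by have := d'0 l; rewrite -eqn0Ngt => /eqP.
  have [x xE] := exp_pos_split d'l.
  pose d := [ffun j => if j == l then x else d' j].
  have d'd : d' = [ffun j => d j + (if j == l then unit_exp k else 0)].
    apply/ffunP => j; rewrite !ffunE; case: eqP => [->|_]; first exact: xE.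
    by rewrite addr0.
  exists (d, l); split; rewrite ?mem_enum //= LP.
  suff : \sum_j d j + unit_exp k == q + unit_exp k.
    move=> /eqP sE; apply/eqP/exponentP => j.
    have := congr1 (fun x : 'rV[nat]_N => x ord0 j) sE.
    by rewrite !exponentD => /addIn.
  rewrite -d'E d'd; under [X in _ == X]eq_bigr do rewrite ffunE.
  rewrite big_split /=; apply/eqP; congr (_ + _).
  by rewrite (bigD1 l) //= eqxx big1 ?addr0 // => j /negPf ->.
rewrite -(mon_shift _ (tpow_lie Lact) gk gq) Lq big_allpairs_dep.
rewrite (lin_sum (tpow_act_lin _)); apply: eq_big_seq => d; rewrite LP => /eqP dq.
rewrite tpow_leibniz; last exact/(lie_linear Lact)/E_nplus.
rewrite big_enum; apply: eq_bigr => l _; apply: eq_tpow_pure => j.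
rewrite /upd ffunE; case: eqP => [->|_]; last by rewrite addr0.
rewrite (mon_shift _ Lact gk) // => i /gq /eqP; rewrite -dq exponent_sum sum_nat_eq0.
by move=> /forallP/(_ l) /eqP.
Qed.

(** Nilpotency follows from the pigeonhole principle: among more than [r * m]
    factors, more than [m] act in the same position. For the functionals, a chain
    point of the dilated polytope is decomposed as a sum of [r] chain points; the
    product of their functionals only sees the distributions of an exponent over
    the positions which dominate this decomposition position by position. *)
Lemma tpow_extremal :
  extremal_cyclic I beta tpow_act (tpow_pure (fun=> v)) (r * m).
Proof.
have [_ _ nil fun_ex] := Hext; split.
- exact: tpow_lie.
- exact: tpow_kill.
- move=> g k nX rmk.
  have [L LP ->] := iter_tpow_pure v k (lie_linear Lact nX).
  apply: big1_seq => d /andP[_ /LP dk].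
  have [l dl] : exists l, (m < d l)%N.
    apply/existsP; apply: contraLR rmk => /existsPn dm; rewrite -leqNgt -dk.
    apply: (@leq_trans (\sum_(l < r) m)%N); last by rewrite sum_nat_const card_ord.
    by apply: leq_sum => l _; have := dm l; rewrite -leqNgt.
  by apply: (tpow_pure0 (k := l)); apply: nil.
move=> p /(chain_point_split (@nested_refl _ _ _ _)
  (nested_anti (fun k l => @root_index_inj n beta k l (let: And3 b _ _ := Hbeta in b)))
  (@nested_trans _ _ _ _))[f fP pE].
have /fin_all_exists[phi phiP] := fun k => fun_ex (f k) (fP k).
have lphi k : linear (phi k) by case: (phiP k).
have tri k q : phi k (mon q) != 0 -> hlex_le (f k) q by case: (phiP k) => _ _; apply.
exists (tpow_functional phi).
have monE q (L : seq {ffun 'I_r -> 'rV[nat]_N}) :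
    tmon q = \sum_(d <- L) tpow_pure (fun k => mon (d k)) ->
    tpow_functional phi (tmon q) = \sum_(d <- L) \prod_k phi k (mon (d k)).
  move=> ->; rewrite (lin_sum (tpow_functional_lin phi)).
  by apply: eq_bigr => d _; rewrite tpow_functional_pure.
have prod_le (d : {ffun 'I_r -> 'rV[nat]_N}) :
    \prod_k phi k (mon (d k)) != 0 -> forall k, hlex_le (f k) (d k).
  by move=> /prodf_neq0 H k; apply/tri/H.
split; first exact: tpow_functional_lin.
  have gp l : ~~ good l -> p ord0 l = 0%N.
    move=> bl; rewrite pE exponent_sum big1 // => k _.
    by have /chain_pointP[H _] := fP k; apply: H.
  have [L LP /monE ->] := tpow_mon gp.
  pose f' := [ffun k => f k].
  have fL : f' \in L by rewrite LP pE; under eq_bigr do rewrite ffunE.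
  rewrite (bigID (pred1 f')) /= [X in _ + X]big1_seq ?addr0 => [|d]; last first.
    rewrite LP => /andP[df /eqP dp]; apply/eqP; apply: contraNT df => /prod_le fd.
    have := hlex_sum_eq fd; rewrite dp -pE => /(_ erefl) fd'.
    by apply/eqP/ffunP => k; rewrite ffunE fd'.
  rewrite (eq_bigr (fun=> \prod_k phi k (mon (f k)))); last first.
    by move=> d /eqP ->; apply: eq_bigr => k _; rewrite ffunE.
  rewrite big_const_seq iter_addr_0 mulrn_eq0 negb_or; apply/andP; split.
    by rewrite -lt0n -has_count; apply/hasP; exists f' => /=.
  by apply/prodf_neq0 => k _; case: (phiP k).
move=> q; have [/existsP[l /andP[bl ql]]|/existsPn gq] :=
  boolP [exists l, ~~ good l && (q ord0 l != 0%N)].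
  rewrite (mon_bad Hbeta (tpow_lie Lact) tpow_kill bl ql).
  by rewrite (lin0 (tpow_functional_lin phi)) eqxx.
have {}gq l : ~~ good l -> q ord0 l = 0%N.
  by move=> bl; apply/eqP; have := gq l; rewrite bl /= negbK.
have [L LP /monE ->] := tpow_mon gq.
have [/hasP[d dL dn0]|/hasPn all0] :=
    boolP (has (fun d : {ffun 'I_r -> 'rV[nat]_N} => \prod_k phi k (mon (d k)) != 0) L).
  move=> _; move: dL; rewrite LP pE => /eqP <-; apply: hlex_le_sum => k _.
  exact: prod_le.
rewrite big1_seq ?eqxx // => d /andP[_ dL].
by apply/eqP; have := all0 d dL; rewrite negbK.
Qed.

End TensorPowers.

(** * The exterior algebra *)

Section FockSpace.

Variables (C : numFieldType) (n : nat).
Implicit Types (a b c d x : 'I_n.+1) (J K : {set 'I_n.+1}) (X Y : 'M[C]_n.+1).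

(** The exterior algebra of the natural module, as functions on its basis indexed by
    subsets. *)
Definition fock : vectType C := {ffun {set 'I_n.+1} -> C^o}.
Implicit Types f : {ffun {set 'I_n.+1} -> C^o}.

(** The sign of the reordering which brings the basis vector of [a] to its place. *)
Definition fock_sign a J : C := (-1) ^+ #|[set x in J | (x < a)%N]|.

Lemma fock_sign_neq0 a J : fock_sign a J != 0.
Proof. by rewrite signr_eq0. Qed.

Lemma fock_signU a b J : b \notin J ->
  fock_sign a (b |: J) = fock_sign a J * (-1) ^+ (b < a)%N.
Proof.
move=> bJ; rewrite /fock_sign -exprD; congr (_ ^+ _).
rewrite [in LHS](cardsD1 b) !inE eqxx /= addnC; congr (_ + _)%N.
apply: eq_card => x; rewrite !inE; have [->|] //= := eqVneq x b.
by rewrite (negPf bJ).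
Qed.

Lemma fock_signD a b J : b \in J ->
  fock_sign a (J :\ b) = fock_sign a J * (-1) ^+ (b < a)%N.
Proof.
move=> bJ; rewrite -[in RHS](finset.setD1K bJ) fock_signU ?finset.setD11 //.
by rewrite -mulrA -exprD addnn -signr_odd odd_double expr0 mulr1.
Qed.

Definition creation a f : {ffun {set 'I_n.+1} -> C^o} :=
  [ffun J : {set 'I_n.+1} => if a \in J then fock_sign a J * f (J :\ a) else 0].

Definition annihilation b f : {ffun {set 'I_n.+1} -> C^o} :=
  [ffun J : {set 'I_n.+1} => if b \in J then 0 else fock_sign b J * f (b |: J)].

Lemma creation_lin a : linear (creation a).
Proof.
move=> s f g; apply/ffunP => J; rewrite !ffunE; case: ifP => _.
  by rewrite mulrDr mulrCA.
by rewrite scaler0 addr0.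
Qed.

Lemma annihilation_lin a : linear (annihilation a).
Proof.
move=> s f g; apply/ffunP => J; rewrite !ffunE; case: ifP => _.
  by rewrite scaler0 addr0.
by rewrite mulrDr mulrCA.
Qed.

Lemma sign_ltn_anti a b : a != b ->
  (-1) ^+ (a < b)%N = - (-1) ^+ (b < a)%N :> C.
Proof.
rewrite neq_ltn => /orP[] h; rewrite h ltnNge ltnW //= expr0 expr1 ?opprK //.
Qed.

Lemma creationC a b f : creation a (creation b f) = - creation b (creation a f).
Proof.
apply/ffunP => J; rewrite !ffunE !inE.
have [->|ab] := eqVneq a b; first by case: ifP; rewrite /= ?mulr0 oppr0.
have ba := ab; rewrite eq_sym in ba.
rewrite /=; case: (boolP (a \in J)) => aJ; case: (boolP (b \in J)) => bJ;
  rewrite ?mulr0 ?oppr0 //.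
rewrite !fock_signD // (sign_ltn_anti ab) !mulrA.
have -> : J :\ a :\ b = J :\ b :\ a.
  by apply/finset.setP => x; rewrite !inE andbCA.
by rewrite mulrN mulNr; congr (- (_ * _)); rewrite [fock_sign a J * _]mulrC.
Qed.

Lemma annihilationC a b f :
  annihilation a (annihilation b f) = - annihilation b (annihilation a f).
Proof.
apply/ffunP => J; rewrite !ffunE !inE.
have [->|ab] := eqVneq a b; first by case: ifP; rewrite /= ?mulr0 oppr0.
have ba := ab; rewrite eq_sym in ba.
rewrite /=; case: (boolP (a \in J)) => aJ; case: (boolP (b \in J)) => bJ;
  rewrite ?mulr0 ?oppr0 //.
rewrite !fock_signU // (sign_ltn_anti ab) !mulrA.
have -> : b |: (a |: J) = a |: (b |: J).
  by apply/finset.setP => x; rewrite !inE orbCA.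
by rewrite mulrN mulNr; congr (- (_ * _)); rewrite [fock_sign a J * _]mulrC.
Qed.

(** The canonical anticommutation relation. *)
Lemma annihilation_creation a b f :
  annihilation b (creation a f) = (a == b)%:R *: f - creation a (annihilation b f).
Proof.
apply/ffunP => J; rewrite !ffunE !inE.
have [<-|ab] := eqVneq a b.
  rewrite /= scale1r; case: (boolP (a \in J)) => aJ.
    rewrite finset.setD1K // fock_signD // ltnn expr0 mulr1 mulrA.
    by rewrite -expr2 sqrr_sign mul1r subrr.
  rewrite fock_signU // ltnn expr0 mulr1 mulrA -expr2 sqrr_sign mul1r subr0.
  by rewrite finset.setU1K.
rewrite /= scale0r add0r /=.
case: (boolP (a \in J)) => aJ; case: (boolP (b \in J)) => bJ;
  rewrite ?mulr0 ?oppr0 //.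
have -> : (b |: J) :\ a = b |: (J :\ a).
  apply/finset.setP => x; rewrite !inE; have [->|] //= := eqVneq x b.
  by rewrite eq_sym ab.
have ba : b != a by rewrite eq_sym.
rewrite fock_signU // fock_signD // (sign_ltn_anti ba) !mulrA.
by rewrite mulrN mulNr; congr (- (_ * _)); rewrite [fock_sign b J * _]mulrC.
Qed.

Definition fock_act X f : {ffun {set 'I_n.+1} -> C^o} :=
  \sum_(ab : 'I_n.+1 * 'I_n.+1)
    X ab.1 ab.2 *: creation ab.1 (annihilation ab.2 f).

Lemma fock_act_lin X : linear (fock_act X).
Proof.
move=> s f g; rewrite /fock_act scaler_sumr -big_split; apply: eq_bigr => ab _ /=.
by rewrite annihilation_lin creation_lin scalerDr !scalerA mulrC.
Qed.

Lemma fock_act_linl s X Y f :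
  fock_act (s *: X + Y) f = s *: fock_act X f + fock_act Y f.
Proof.
rewrite /fock_act scaler_sumr -big_split; apply: eq_bigr => ab _ /=.
by rewrite !mxE scalerDl scalerA.
Qed.

(** Normal ordering. The correction is symmetric in [X] and [Y], whence the Lie
    bracket relation. *)
Lemma fock_act_mul X Y f : fock_act X (fock_act Y f) = fock_act (X *m Y) f -
  \sum_(ab : 'I_n.+1 * 'I_n.+1) \sum_(cd : 'I_n.+1 * 'I_n.+1)
    (X ab.1 ab.2 * Y cd.1 cd.2) *:
      creation ab.1 (creation cd.1 (annihilation ab.2 (annihilation cd.2 f))).
Proof.
have -> : fock_act (X *m Y) f =
  \sum_(ab : 'I_n.+1 * 'I_n.+1) \sum_(cd : 'I_n.+1 * 'I_n.+1)
    (X ab.1 ab.2 * Y cd.1 cd.2) *: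
      ((cd.1 == ab.2)%:R *: creation ab.1 (annihilation cd.2 f)).
  rewrite /fock_act -(pair_bigA _ (fun a b =>
    (X *m Y) a b *: creation a (annihilation b f))) /=.
  rewrite -[RHS](pair_bigA _ (fun a b => \sum_(cd : 'I_n.+1 * 'I_n.+1)
    (X a b * Y cd.1 cd.2) *:
      ((cd.1 == b)%:R *: creation a (annihilation cd.2 f)))) /=.
  apply: eq_bigr => a _.
  transitivity (\sum_b \sum_d (X a b * Y b d) *: creation a (annihilation d f)).
    rewrite exchange_big /=; apply: eq_bigr => d _; rewrite mxE scaler_suml.
    by apply: eq_bigr.
  apply: eq_bigr => b _.
  rewrite -[RHS](pair_bigA _ (fun c d => (X a b * Y c d) *:
    ((c == b)%:R *: creation a (annihilation d f)))) /= [RHS](bigD1 b) //=.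
  rewrite [X in _ = _ + X]big1 ?addr0; last first.
    by move=> c cb; rewrite big1 // => d _; rewrite (negPf cb) scale0r scaler0.
  by apply: eq_bigr => d _; rewrite eqxx scale1r.
rewrite {1}/fock_act -sumrB; apply: eq_bigr => ab _.
rewrite /fock_act (lin_sum (@annihilation_lin _)) (lin_sum (@creation_lin _)).
rewrite scaler_sumr -sumrB; apply: eq_bigr => cd _.
rewrite (linZ (@annihilation_lin _)) (linZ (@creation_lin _)) [LHS]scalerA -[RHS]scalerBr.
congr (_ *: _); rewrite annihilation_creation (linD (@creation_lin _)).
rewrite (linZ (@creation_lin _)); congr (_ + _).
exact: (linN (@creation_lin _)).
Qed.

Lemma fock_lie (g : {pred 'M[C]_n.+1}) : lie_module (V := fock) g fock_act fullv.
Proof.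
split.
- by move=> X u _ _; apply: memvf.
- by move=> X _ u w _ _ c; apply: fock_act_lin.
- by move=> X Y _ _ u _ c; apply: fock_act_linl.
move=> X Y _ _ u _; rewrite -scaleN1r addrC fock_act_linl scaleN1r !fock_act_mul.
set S1 := \sum_ab _; set S2 := \sum_ab _.
suff -> : S1 = S2 by rewrite opprB addrA subrK addrC.
rewrite /S1 exchange_big; apply: eq_bigr => cd _; apply: eq_bigr => ab _ /=.
rewrite creationC annihilationC mulrC; congr (_ *: _).
by rewrite !(linN (@creation_lin _)) opprK.
Qed.

Lemma fock_act_delta a b f :
  fock_act (delta_mx a b) f = creation a (annihilation b f).
Proof.
rewrite /fock_act (bigD1 (a, b)) //= big1 ?addr0.
  by rewrite mxE !eqxx scale1r.
move=> [c d] /negPf cd; rewrite mxE /=.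
by move: cd; rewrite /= xpair_eqE => ->; rewrite scale0r.
Qed.

Definition fock_basis J : {ffun {set 'I_n.+1} -> C^o} := [ffun K => (K == J)%:R].

Lemma fock_coord_lin J : linear ((fun f => f J) : fock -> C^o).
Proof. by move=> s f g; rewrite !ffunE. Qed.

Lemma fock_expand f : f = \sum_J f J *: fock_basis J.
Proof.
apply/ffunP => K; rewrite sum_ffunE (bigD1 K) //= !ffunE eqxx big1 ?addr0.
  exact: (esym (mulr1 _)).
by move=> J JK; rewrite !ffunE eq_sym (negPf JK); apply: mulr0.
Qed.

Lemma fock_delta_kill a b J : a != b -> (a \in J) || (b \notin J) ->
  fock_act (delta_mx a b) (fock_basis J) = 0.
Proof.
move=> ab abJ; rewrite fock_act_delta; apply/ffunP => K; rewrite !ffunE.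
case: ifP => // aK; case: ifP => [_|bK]; first by rewrite mulr0.
case: eqP => [KJ|_]; last by rewrite !mulr0.
by move: abJ; rewrite -KJ !inE !eqxx (negPf ab).
Qed.

End FockSpace.

(** * Extremal vectors of the exterior algebra *)

Section FockExtremal.

Variables (C : numFieldType) (n : nat) (I : {set 'I_n.+1}).
Variables (beta : 'I_(npos n) -> posroot n).
Hypothesis Hbeta : adapted I beta.

Notation N := (npos n).
Notation row := (rrow beta).
Notation col := (rcol beta).
Notation good := (moving I beta).
Notation fact := (@fock_act C n).
Notation vI := (fock_basis C I).
Notation mon q := (monomial_act (V := fock C n) fact beta q vI).
Implicit Types (p q : 'rV[nat]_(npos n)) (J K : {set 'I_n.+1}) (x : 'I_n.+1).
Implicit Types (f : {ffun {set 'I_n.+1} -> C^o}).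

Lemma char0_opp (V : lmodType C) (u : V) : u = - u -> u = 0.
Proof.
move=> /eqP; rewrite -subr_eq0 opprK -mulr2n -scaler_nat scaler_eq0.
by rewrite pnatr_eq0 => /eqP.
Qed.

(** A rank one matrix acts as the product of a combination of creations and a
    combination of annihilations, each of square zero. *)
Lemma fock_rank_one_sq (g : 'I_n.+1 -> C) f :
  fact (rank_one I g) (fact (rank_one I g) f) = 0.
Proof.
pose cr h : fock C n := \sum_(a | a \notin I) g a *: creation a h.
pose an h : fock C n := \sum_(b | b \in I) g b *: annihilation b h.
have lcr : linear (cr : fock C n -> fock C n).
  move=> s u w; rewrite /cr scaler_sumr -big_split; apply: eq_bigr => a _ /=.
  by rewrite creation_lin scalerDr !scalerA mulrC.
have lan : linear (an : fock C n -> fock C n).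
  move=> s u w; rewrite /an scaler_sumr -big_split; apply: eq_bigr => a _ /=.
  by rewrite annihilation_lin scalerDr !scalerA mulrC.
have actE h : fact (rank_one I g) h = cr (an h).
  rewrite /fock_act /cr /an.
  rewrite -(pair_bigA _ (fun a b =>
    rank_one I g a b *: creation a (annihilation b h))) /= [RHS]big_mkcond.
  apply: eq_bigr => a _ /=; case: ifP => aI; last first.
    by rewrite big1 // => b _; rewrite mxE aI scale0r.
  rewrite (lin_sum (@creation_lin _ _ a)) scaler_sumr [RHS]big_mkcond.
  apply: eq_bigr => b _; rewrite mxE aI /=; case: ifP => bI; last by rewrite scale0r.
  by rewrite (linZ (@creation_lin _ _ a)) scalerA.
have crcr h : cr (cr h) = 0.
  apply: char0_opp; rewrite {1}/cr.
  transitivity (\sum_(a | a \notin I) \sum_(c | c \notin I)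
      (g a * g c) *: creation a (creation c h)).
    apply: eq_bigr => a _; rewrite (lin_sum (@creation_lin _ _ a)) scaler_sumr.
    by apply: eq_bigr => c _; rewrite (linZ (@creation_lin _ _ a)) scalerA.
  rewrite exchange_big -sumrN /=; apply: eq_bigr => a _.
  rewrite (lin_sum (@creation_lin _ _ a)) scaler_sumr -sumrN.
  apply: eq_bigr => c _; rewrite creationC scalerN mulrC.
  by rewrite (linZ (@creation_lin _ _ a)) scalerA.
have ancr h : an (cr h) = - cr (an h).
  rewrite /an /cr.
  transitivity (\sum_(b | b \in I) \sum_(a | a \notin I)
      - ((g a * g b) *: creation a (annihilation b h))).
    apply: eq_bigr => b bI; rewrite (lin_sum (@annihilation_lin _ _ b)) scaler_sumr.
    apply: eq_bigr => a aI; rewrite (linZ (@annihilation_lin _ _ b)) scalerA.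
    rewrite annihilation_creation (_ : (a == b) = false) ?scale0r ?add0r.
      by rewrite scalerN mulrC.
    by apply: contraNF aI => /eqP ->.
  rewrite exchange_big -sumrN; apply: eq_bigr => a _ /=.
  rewrite (lin_sum (@creation_lin _ _ a)) scaler_sumr -sumrN.
  by apply: eq_bigr => b _; rewrite (linZ (@creation_lin _ _ a)) scalerA.
by rewrite !actE ancr (linN lcr) crcr oppr0.
Qed.

Notation rsum q x := (\sum_(k | row k == x) q ord0 k)%N.
Notation csum q x := (\sum_(k | col k == x) q ord0 k)%N.

Lemma sum_unit (P : pred 'I_N) k : (\sum_(l | P l) unit_exp k ord0 l)%N = P k.
Proof.
rewrite big_mkcond (bigD1 k) //= unit_expE eqxx big1 ?addn0; first by case: (P k).
by move=> l lk; rewrite unit_expE (negPf lk) if_same.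
Qed.

(** Weight bookkeeping: which basis vectors can occur in a monomial. *)
Lemma fock_mon_weight q J : (forall l, ~~ good l -> q ord0 l = 0%N) ->
  mon q J != 0 -> forall x, ((x \in J) + csum q x = (x \in I) + rsum q x)%N.
Proof.
elim/exp_ind: q J => [|q k IHq] J gq.
  rewrite mon0 ffunE pnatr_eq0 eqb0 negbK => /eqP -> x.
  by congr (_ + _)%N; rewrite !big1 // => k _; rewrite mxE.
have gk : good k.
  by apply: contraT => /gq; rewrite exponentD unit_expE eqxx addn1.
have {}gq l : ~~ good l -> q ord0 l = 0%N.
  by move=> /gq; rewrite exponentD => /eqP; rewrite addn_eq0 => /andP[/eqP].
rewrite -(mon_shift _ (fock_lie _) gk gq) fock_act_delta !ffunE.
case: ifP => aJ; last by rewrite eqxx.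
case: ifP => [_|bJ]; first by rewrite mulr0 eqxx.
rewrite !mulf_eq0 !negb_or => /and3P[_ _ /IHq H x].
have {H} := H gq x.
under [in X in _ -> X]eq_bigr do rewrite exponentD.
under [in X in _ -> (_ = X)]eq_bigr do rewrite exponentD.
rewrite !big_split !sum_unit /= !inE -/(row k) -/(col k).
have rc : row k != col k by rewrite neq_ltn rrow_lt_rcol.
rewrite ![_ == x]eq_sym; move: bJ; rewrite !inE => bJ.
have [xa|xa] := eqVneq x (row k).
  by rewrite xa (negPf rc) aJ /= => H; rewrite addn0 addn1 addnS -H.
have [xb|xb] := eqVneq x (col k); last by rewrite /= !addn0.
by rewrite xb; move: bJ; rewrite eq_sym (negPf rc) /= addn0 => -> <-; rewrite addn1.
Qed.

(** An antichain is a partial matching: its root vectors move distinct elements of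
    [I] to distinct elements outside [I], one after the other. *)
Lemma fock_antichain_mon p : chain_point good (nested row col) 1 p ->
  exists J (s : C), s != 0 /\ mon p = s *: fock_basis C J.
Proof.
elim/exp_ind: p => [_|q k IHq].
  by exists I, 1; rewrite oner_eq0 mon0 scale1r.
move=> cp; have /chain_pointP[gp ap] := cp.
have gk : good k.
  by apply: contraT => /gp; rewrite exponentD unit_expE eqxx addn1.
have gq l : ~~ good l -> q ord0 l = 0%N.
  by move=> /gp; rewrite exponentD => /eqP; rewrite addn_eq0 => /andP[/eqP].
have cq : chain_point good (nested row col) 1 q.
  apply/chain_pointP; split=> // c /ap; apply: leq_trans.
  by apply: leq_sum => l _; rewrite exponentD leq_addr.
have [J [s [s0 qE]]] := IHq cq.
have comp l : nested row col k l || nested row col l k -> q ord0 l = 0%N.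
  have [->|lk] := eqVneq l k.
    move=> _; have := chain_point_le (@nested_refl _ _ _ _) k cp.
    by rewrite exponentD unit_expE eqxx addn1 ltnS leqn0 => /eqP.
  have kl : k \notin [set l]%SET by rewrite inE eq_sym.
  move=> kl'; have ch : chain (nested row col) [set k; l]%SET.
    case/orP: kl' => h; last rewrite finset.setUC; apply: chain2 => //; exact: nested_refl.
  have := ap _ ch; rewrite big_setU1 //= big_set1 !exponentD !unit_expE eqxx (negPf lk).
  by rewrite addn0 addn1 addSn ltnS leqn0 addn_eq0 => /andP[_ /eqP].
have qJ : mon q J != 0.
  by rewrite qE !ffunE eqxx; rewrite (_ : s *: (1 : C^o) = s) //; apply: mulr1.
have wt := fock_mon_weight gq qJ.
have /andP[aI bI] := gk.
have aJ : row k \notin J.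
  have := wt (row k); rewrite (negPf aI) add0n [X in _ = X]big1; last first.
    move=> l /eqP rlk; apply: comp; rewrite /nested rlk leqnn /=; exact: leq_total.
  by case: (row k \in J).
have bJ : col k \in J.
  have := wt (col k); rewrite bI [X in (_ + X)%N]big1; last first.
    by move=> l /eqP clk; apply: comp; rewrite /nested clk leqnn !andbT leq_total.
  by case: (col k \in J).
have rc : row k != col k by rewrite neq_ltn rrow_lt_rcol.
pose J' := row k |: (J :\ col k).
pose h := creation (row k) (annihilation (col k) (fock_basis C J)).
have hE : h = h J' *: fock_basis C J'.
  apply/ffunP => K; rewrite [RHS]ffunE [fock_basis _ _ _]ffunE.
  case: eqP => [->|KJ']; first exact: (esym (mulr1 _)).
  rewrite scaler0 /h !ffunE; case: ifP => // aK; case: ifP => [_|bK].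
    by rewrite mulr0.
  case: eqP => [KJ|_]; last by rewrite !mulr0.
  case: KJ'; rewrite /J' -KJ; apply/finset.setP => x; move: bK; rewrite !inE.
  rewrite eq_sym (negPf rc) /= => bK.
  have [->|xa] := eqVneq x (row k); first by rewrite aK.
  by have [->|xb] /= := eqVneq x (col k); rewrite ?bK ?andbF.
exists J', (s * h J'); split.
  rewrite mulf_neq0 // /h /J' !ffunE !inE eqxx /= [col k == _]eq_sym (negPf rc) eqxx /=.
  rewrite !mulf_neq0 ?fock_sign_neq0 //.
  suff -> : col k |: ((row k |: (J :\ col k)) :\ row k) = J by rewrite eqxx oner_eq0.
  apply/finset.setP => x; rewrite !inE.
  have [->|xa] /= := eqVneq x (row k); first by rewrite (negPf rc) (negPf aJ).
  by have [->|xb] /= := eqVneq x (col k); rewrite ?bJ.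
rewrite -(mon_shift _ (fock_lie _) gk gq) fock_act_delta qE.
rewrite (linZ (@annihilation_lin _ _ _)) (linZ (@creation_lin _ _ _)).
by rewrite -scalerA -hE.
Qed.

(** The functional of an antichain is the coordinate at the basis vector reached by
    its monomial. A monomial involving this vector has the same margins, and the
    antichain is the smallest exponent with these margins. *)
Lemma fock_extremal : extremal_cyclic (W := fock C n) I beta fact vI 1.
Proof.
split.
- exact: fock_lie.
- by move=> a b ab; apply: fock_delta_kill; rewrite neq_ltn ab.
- move=> g [|[|k]] // nX _; rewrite !iterSr fock_rank_one_sq.
  exact/iter_lin0/(@fock_act_lin C n).
move=> p cp; have [J [s [s0 pE]]] := fock_antichain_mon cp.
have pJ : mon p J != 0.
  by rewrite pE !ffunE eqxx; rewrite (_ : s *: (1 : C^o) = s) //; apply: mulr1.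
exists (fun f : fock C n => (f : {ffun _}) J); split=> //.
  exact: fock_coord_lin.
move=> q qJ.
have gp : forall l, ~~ good l -> p ord0 l = 0%N by case/chain_pointP: cp.
have gq l : ~~ good l -> q ord0 l = 0%N.
  move=> bl; apply/eqP; apply: contraNT qJ => ql.
  rewrite (mon_bad Hbeta (fock_lie _) _ bl ql) ?ffunE ?eqxx // => a b ab.
  by apply: fock_delta_kill; rewrite neq_ltn ab.
have wp := fock_mon_weight gp pJ; have wq := fock_mon_weight gq qJ.
have rI (r : 'rV[nat]_N) x : (forall l, ~~ good l -> r ord0 l = 0%N) -> x \in I -> rsum r x = 0%N.
  move=> gr xI; rewrite big1 // => k /eqP kx; apply: gr.
  by rewrite /moving kx xI.
have cI (r : 'rV[nat]_N) x : (forall l, ~~ good l -> r ord0 l = 0%N) -> x \notin I -> csum r x = 0%N.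
  move=> gr xI; rewrite big1 // => k /eqP kx; apply: gr.
  by rewrite /moving kx (negPf xI) andbF.
apply: (antichain_min (row := row) (col := col) (good := good)) => //.
  by move=> k l; apply: index_lex.
split=> x; case: (boolP (x \in I)) => xI.
- by rewrite (rI p) ?(rI q).
- have := wp x; have := wq x; rewrite (negPf xI) !add0n (cI p) // (cI q) //.
  by move=> -> <-.
- have wpx := wp x; have := wq x; rewrite (rI q) // -[in RHS](rI p x gp xI) -wpx.
  by move/addnI.
- by rewrite (cI p) ?(cI q).
Qed.

End FockExtremal.

(** Only the values of operators on the generator occur, up to the nonzero factor. *)
Lemma extremal_transfer (C : numFieldType) n (I : {set 'I_n.+1})
    (beta : 'I_(npos n) -> posroot n) (V W : vectType C)
    (actV : 'M[C]_n.+1 -> V -> V) (actW : 'M[C]_n.+1 -> W -> W)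
    (psi : V -> W) (v : V) (w : W) (c : C) m :
    linear psi -> (forall x, psi x = 0 -> x = 0) ->
    (forall X x, X \in @nplus C n -> psi (actV X x) = actW X (psi x)) ->
    lie_module (@nplus C n) actV fullv -> c != 0 -> psi v = c *: w ->
  extremal_cyclic I beta actW w m -> extremal_cyclic I beta actV v m.
Proof.
move=> lpsi inj eqv LV c0 psiv [LW kill nil fun_ex].
have iterE X x k : X \in @nplus C n ->
    psi (iter k (actV X) x) = iter k (actW X) (psi x).
  by move=> nX; elim: k => //= k <-; apply: eqv.
have iterZ X x k : X \in @nplus C n ->
    iter k (actW X) (c *: x) = c *: iter k (actW X) x.
  move=> nX; elim: k => //= k ->; exact: linZ (lie_linear LW nX) _ _.
have monE q : psi (monomial_act actV beta q v) = c *: monomial_act actW beta q w.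
  rewrite /monomial_act; elim: (enum _) => //= k s IHs.
  by rewrite iterE ?E_nplus // IHs iterZ ?E_nplus.
split=> //.
- move=> a b ab abI; apply: inj; rewrite eqv ?delta_nplus // psiv.
  by rewrite (linZ (lie_linear LW (delta_nplus C ab))) kill // scaler0.
- by move=> g k nX mk; apply: inj; rewrite iterE // psiv iterZ // nil // scaler0.
move=> p /fun_ex[phi [lphi phip tri]].
have phiE q : phi (psi (monomial_act actV beta q v)) =
    c * phi (monomial_act actW beta q w) by rewrite monE (linZ lphi).
exists (phi \o psi); split.
- by move=> a x y /=; rewrite lpsi lphi.
- by rewrite /= phiE mulf_neq0.
- by move=> q; rewrite /= phiE mulf_eq0 negb_or => /andP[_ /tri].
Qed.

(** * Tensor powers of the exterior algebra *)

Section FockTensors.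

Variables (C : numClosedFieldType) (n m : nat).
Implicit Types (J K L : {set 'I_n.+1}) (X Y : 'M[C]_n.+1) (a b : 'I_n.+1).

Notation fk := (fock C n).
Notation focoord := ((fun J (f : {ffun {set 'I_n.+1} -> C^o}) => f J) :
  {set 'I_n.+1} -> fk -> C^o).
Notation fcoef := (act_coef (W := fk) (fock_basis C (n := n)) focoord (@fock_act C n)).

Definition ftens : vectType C := tpow C {set 'I_n.+1} m.
Implicit Types (F G : {ffun {ffun 'I_m -> {set 'I_n.+1}} -> C^o}).
Implicit Types (t : {ffun 'I_m -> {set 'I_n.+1}}).

Definition ftact X : ftens -> ftens :=
  tpow_act (W := fk) (r := m) (fock_basis C (n := n)) focoord (@fock_act C n) X.

Definition fpure J : ftens := tpow_pure (W := fk) (r := m) focoord (fun=> fock_basis C J).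

Lemma fpureE J t : (fpure J : {ffun _}) t = (t == [ffun=> J])%:R.
Proof.
rewrite ffunE; case: eqP => [->|tJ].
  by rewrite big1 // => k _; rewrite !ffunE eqxx.
have /existsP[k tk] : [exists k, t k != J].
  apply: contra_notT tJ => /existsPn tJ; apply/ffunP => k; rewrite ffunE.
  by apply/eqP; have := tJ k; rewrite negbK.
by rewrite (bigD1 k) //= ffunE (negPf tk) mul0r.
Qed.

Lemma ftact_lie (g : {pred 'M[C]_n.+1}) : lie_module g ftact fullv.
Proof.
apply: (@tpow_lie C n fk _ (fock_basis C (n := n)) focoord) => //.
- exact: fock_coord_lin.
- exact: fock_expand.
- exact: fock_lie.
Qed.

Lemma fcoef_delta X K L : fcoef X K L =
  \sum_(ab : 'I_n.+1 * 'I_n.+1)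
    X ab.1 ab.2 * creation ab.1 (annihilation ab.2 (fock_basis C L)) K.
Proof.
by rewrite /act_coef /fock_act sum_ffunE; apply: eq_bigr => ab _; rewrite ffunE.
Qed.

(** Whether the elementary matrix with indices [a] and [b] maps the basis vector of
    [L] to that of [K], up to sign. *)
Definition hop a b K L := [&& a \in K, b \notin K :\ a & b |: (K :\ a) == L].

Lemma hopE a b K L : creation a (annihilation b (fock_basis C L)) K =
  if hop a b K L then fock_sign C a (K :\ a) * fock_sign C b (K :\ a) else 0.
Proof.
rewrite !ffunE /hop; case: (boolP (a \in K)) => //= aK.
case: ifP => _ /=; first by rewrite mulr0.
rewrite [fock_sign C a (K :\ a)]fock_signD // ltnn expr0 mulr1.
by case: eqP => _; rewrite ?mulr1 ?mulr0.
Qed.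

Lemma hop_sym a b K L : hop a b K L ->
  [/\ hop b a L K, L :\ b = K :\ a & L = b |: (K :\ a)].
Proof.
move=> /and3P[aK bK /eqP LE].
have LK : L :\ b = K :\ a by rewrite -LE finset.setU1K.
split=> //; rewrite /hop LK finset.setD1K // eqxx andbT finset.setD11 andbT.
by rewrite -LE !inE eqxx.
Qed.

Lemma hop_adjoint a b K L :
  creation a (annihilation b (fock_basis C L)) K =
  (creation b (annihilation a (fock_basis C K)) L)^*.
Proof.
have real x J : (fock_sign C x J)^* = fock_sign C x J by rewrite rmorphXn rmorphN1.
rewrite !hopE; case: ifP => [/hop_sym[-> -> _]|hKL].
  by rewrite rmorphM /= !real mulrC.
by case: ifP => [/hop_sym[]|]; rewrite ?hKL ?rmorph0.
Qed.

Definition adjoint X : 'M[C]_n.+1 := \matrix_(a, b) (X b a)^*.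

Lemma fcoef_adjoint X K L : fcoef X K L = (fcoef (adjoint X) L K)^*.
Proof.
rewrite !fcoef_delta rmorph_sum /=.
rewrite -(pair_bigA _ (fun a b =>
  X a b * creation a (annihilation b (fock_basis C L)) K)) /=.
rewrite -(pair_bigA _ (fun a b =>
  (adjoint X a b * creation a (annihilation b (fock_basis C K)) L)^*)) /=.
rewrite exchange_big; apply: eq_bigr => a _; apply: eq_bigr => b _ /=.
by rewrite rmorphM /= mxE conjCK hop_adjoint.
Qed.

Definition fform F G : C := \sum_t F t * (G t)^*.

(** The contribution of each tensor position is symmetric under exchanging the old
    and the new index at that position. *)
Lemma fform_adjoint X F G : fform (ftact X F) G = fform F (ftact (adjoint X) G).
Proof.
rewrite /fform.
under eq_bigr do rewrite ffunE mulr_suml.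
under [RHS]eq_bigr do rewrite ffunE rmorph_sum mulr_sumr.
rewrite exchange_big [RHS]exchange_big; apply: eq_bigr => k _ /=.
under eq_bigr do rewrite mulr_suml.
under [RHS]eq_bigr do rewrite rmorph_sum mulr_sumr.
rewrite !pair_bigA /=.
pose h (tb : {ffun 'I_m -> {set 'I_n.+1}} * {set 'I_n.+1}) :=
  ([ffun l => upd tb.1 k tb.2 l], tb.1 k).
have hK : involutive h.
  move=> [t b]; rewrite /h /= ffunE /upd eqxx; congr pair.
  by apply/ffunP => l; rewrite !ffunE; case: eqP => [->|].
rewrite [RHS](reindex_inj (inv_inj hK)) /=; apply: eq_bigr => -[t b] _ /=.
rewrite rmorphM /= -fcoef_adjoint ffunE /upd eqxx mulrA [_ * F _]mulrC -!mulrA.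
congr (_ * (_ * (G _)^*)); apply/ffunP => l; rewrite !ffunE.
by case: eqP => [->|].
Qed.

Lemma fform_eq0 F : fform F F = 0 -> F = 0.
Proof.
move=> FF; apply/ffunP => t; rewrite [RHS]ffunE; apply/eqP.
have ge0 t' : 0 <= F t' * (F t')^* by apply: mul_conjC_ge0.
have /(_ t isT)/eqP := psumr_eq0P (fun t' _ => ge0 t') FF.
by rewrite mul_conjC_eq0.
Qed.

Lemma fform_linr F c G H : fform F (c *: G + H) = c^* * fform F G + fform F H.
Proof.
rewrite /fform mulr_sumr -big_split; apply: eq_bigr => t _ /=.
by rewrite !ffunE rmorphD rmorphM mulrDr mulrCA.
Qed.

Lemma fcoef_diag X K L : is_diag_mx X ->
  fcoef X K L = (K == L)%:R * \sum_(j in K) X j j.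
Proof.
move=> /is_diag_mxP dX; rewrite fcoef_delta.
rewrite -(pair_bigA _ (fun a b =>
  X a b * creation a (annihilation b (fock_basis C L)) K)) /=.
rewrite mulr_sumr [RHS]big_mkcond; apply: eq_bigr => a _ /=.
rewrite (bigD1 a) //= big1 ?addr0 => [|b ba]; last first.
  by rewrite dX ?mul0r //; apply: contraNneq ba => /ord_inj ->.
rewrite hopE /hop; case: (boolP (a \in K)) => aK; last by rewrite mulr0.
rewrite finset.setD11 finset.setD1K //= mulrC; case: eqP => _; last by rewrite !mul0r.
by rewrite -expr2 sqrr_sign.
Qed.

Lemma ftact_diag X F t : is_diag_mx X ->
  (ftact X F : {ffun _}) t = (\sum_k \sum_(j in t k) X j j) * F t.
Proof.
move=> dX; rewrite ffunE mulr_suml; apply: eq_bigr => k _.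
rewrite (bigD1 (t k)) //= fcoef_diag // eqxx mul1r [X in _ + X]big1 ?addr0 => [|b bt].
  congr (_ * _); congr (fun_of_fin F _); apply/ffunP => l; rewrite ffunE /upd.
  by case: eqP => [->|].
by rewrite fcoef_diag // eq_sym (negPf bt) !mul0r.
Qed.

End FockTensors.

(** * Triangular decomposition *)

Section BorelDecomposition.

Variables (C : fieldType) (n : nat).
Implicit Types X : 'M[C]_n.+1.

Definition nminus : {pred 'M[C]_n.+1} :=
  [pred X : 'M[C]_n.+1 |
     [forall a : 'I_n.+1, forall b : 'I_n.+1, (a <= b)%N ==> (X a b == 0)]].

Lemma nminusP X : reflect (forall a b : 'I_n.+1, (a <= b)%N -> X a b = 0)
  (X \in nminus).
Proof.
rewrite inE; apply: (iffP forallP) => [H a b ab|H a].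
  by apply/eqP; have /forallP/(_ b) := H a; rewrite ab.
by apply/forallP => b; apply/implyP => /H ->.
Qed.

Lemma nminus_sln : {subset nminus <= @sln C n}.
Proof.
by move=> X /nminusP HX; rewrite sln_trace /mxtrace big1 // => a _; rewrite HX.
Qed.

Lemma cartanP X : reflect (\tr X = 0 /\ is_diag_mx X) (X \in @cartan C n).
Proof. by rewrite inE; apply: (iffP andP) => -[/eqP]. Qed.

Lemma borelP X : reflect
  (\tr X = 0 /\ forall a b : 'I_n.+1, (b < a)%N -> X a b = 0) (X \in @borel C n).
Proof.
rewrite inE; apply: (iffP andP) => -[/eqP trX H]; split=> //.
  move=> a b ba; apply/eqP.
  by have /forallP/(_ a)/forallP/(_ b)/implyP/(_ ba) := H.
by apply/forallP => a; apply/forallP => b; apply/implyP => /H ->.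
Qed.

Lemma cartan_borel : {subset @cartan C n <= @borel C n}.
Proof.
move=> X /cartanP[trX /is_diag_mxP dX]; apply/borelP; split=> // a b ba.
by apply: dX; rewrite neq_ltn ba orbT.
Qed.

Lemma borel_sln : {subset @borel C n <= @sln C n}.
Proof. by move=> X /borelP[trX _]; rewrite sln_trace trX. Qed.

Lemma borel_split X : X \in @borel C n ->
  exists X1 X2, [/\ X1 \in @nplus C n, X2 \in @cartan C n & X = X1 + X2].
Proof.
move=> /borelP[trX HX]; pose H := diag_mx (\row_j X j j) : 'M[C]_n.+1.
have HE a b : H a b = if a == b then X a a else 0.
  by rewrite mxE mxE; case: eqP => // ->.
exists (X - H), H; split; last by rewrite subrK.
  apply/nplusP => a b ba; rewrite mxE [(- H) _ _]mxE HE.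
  case: eqP ba => [<- _|ab ba]; first by rewrite subrr.
  rewrite subr0 HX // ltn_neqAle ba andbT; apply: contra_notN ab => /eqP e.
  exact: ord_inj (esym e).
apply/cartanP; split; last exact: diag_mx_is_diag.
by rewrite -trX; apply: eq_bigr => a _; rewrite HE eqxx.
Qed.

Lemma sln_split X : X \in @sln C n ->
  exists X1 X2, [/\ X1 \in nminus, X2 \in @borel C n & X = X1 + X2].
Proof.
rewrite sln_trace => /eqP trX.
pose L : 'M[C]_n.+1 := \matrix_(a, b) (if (b < a)%N then X a b else 0).
exists L, (X - L); split; last by rewrite addrC subrK.
  by apply/nminusP => a b ab; rewrite mxE ltnNge ab.
apply/borelP; split.
  rewrite raddfB /= trX sub0r /mxtrace big1 ?oppr0 // => a _.
  by rewrite mxE ltnn.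
by move=> a b ba; rewrite !mxE ba subrr.
Qed.

Lemma sln_br X Y : X \in @sln C n -> Y \in @sln C n ->
  X *m Y - Y *m X \in @sln C n.
Proof. by move=> _ _; rewrite sln_trace raddfB /= mxtrace_mulC subrr. Qed.

Lemma sln0 : 0 \in @sln C n. Proof. by rewrite sln_trace mxtrace0. Qed.

Lemma sln_add X Y : X \in @sln C n -> Y \in @sln C n -> X + Y \in @sln C n.
Proof. by rewrite !sln_trace raddfD /= => /eqP -> /eqP ->; rewrite addr0. Qed.

Lemma borel_br X Y : X \in @borel C n -> Y \in @borel C n ->
  X *m Y - Y *m X \in @borel C n.
Proof.
move=> bX bY; apply/borelP; split.
  by apply/eqP; rewrite -sln_trace sln_br ?borel_sln.
have /borelP[_ HX] := bX; have /borelP[_ HY] := bY.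
have tri (Z U : 'M[C]_n.+1) (a b : 'I_n.+1) :
    (forall a b : 'I_n.+1, (b < a)%N -> Z a b = 0) ->
    (forall a b : 'I_n.+1, (b < a)%N -> U a b = 0) ->
    (b < a)%N -> (Z *m U) a b = 0.
  move=> HZ HU ba; rewrite mxE big1 // => c _.
  have [cb|bc] := leqP c b; last by rewrite HU ?mulr0.
  by rewrite HZ ?mul0r // (leq_ltn_trans cb).
by move=> a b ba; rewrite mxE tri // mxE tri // subrr.
Qed.

End BorelDecomposition.

Section Triangular.

Variables (C : numClosedFieldType) (n m : nat).
Implicit Types (J K L : {set 'I_n.+1}) (X Y : 'M[C]_n.+1) (a b : 'I_n.+1).
Notation fk := (fock C n).
Notation focoord := ((fun J (f : {ffun {set 'I_n.+1} -> C^o}) => f J) :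
  {set 'I_n.+1} -> fk -> C^o).
Notation fcoef := (act_coef (W := fk) (fock_basis C (n := n)) focoord (@fock_act C n)).
Notation T := (ftens C n m).
Implicit Types F : {ffun {ffun 'I_m -> {set 'I_n.+1}} -> C^o}.
Implicit Types t : {ffun 'I_m -> {set 'I_n.+1}}.

Definition height J : nat := (\sum_(j in J) j)%N.

Lemma fcoef_height X K L : X \in @nplus C n -> fcoef X K L != 0 ->
  (height K < height L)%N.
Proof.
move=> /nplusP HX; rewrite fcoef_delta => KL.
have /existsP[[a b] /= nz] : [exists ab : 'I_n.+1 * 'I_n.+1,
    X ab.1 ab.2 * creation ab.1 (annihilation ab.2 (fock_basis C L)) K != 0].
  apply: contraR KL => /existsPn all0; apply/eqP/big1 => ab _.
  by apply/eqP; have := all0 ab; rewrite negbK.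
move: nz; rewrite mulf_eq0 negb_or hopE => /andP[Xab].
case: ifP => [hop_ab _|]; last by rewrite eqxx.
have ab : (a < b)%N by rewrite ltnNge; apply: contra Xab => /HX ->.
have [_ _ ->] := hop_sym hop_ab; have /and3P[aK bK _] := hop_ab.
rewrite /height big_setU1 //= (bigD1 a) //= [X in (_ < _ + X)%N](eq_bigl _ _ (_ : _ =1
  (fun j => (j \in K) && (j != a)))) ?ltn_add2r // => j.
by rewrite !inE andbC.
Qed.

(** Each factor replaces an element of some index set by a smaller one. *)
Lemma ftact_nilpotent X : X \in @nplus C n ->
  exists k, forall F, iter k (@ftact C n m X) F = 0.
Proof.
move=> nX.
(* the total height strictly decreases and is bounded by its maximum *)
pose ht t := (\sum_k height (t k))%N.
pose M := (\max_t ht t)%N; exists M.+1 => F.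
suff main k t : (M < ht t + k)%N -> (iter k (@ftact C n m X) F : {ffun _}) t = 0.
  by apply/ffunP => t; rewrite [RHS]ffunE main // addnS ltnS leq_addl.
elim: k t => [|k IHk] t.
  by rewrite addn0 ltnNge (leq_bigmax t).
rewrite addnS ltnS => Mt; rewrite iterS ffunE big1 // => l _; rewrite big1 // => J _.
have [->|/(fcoef_height nX) hJ] := eqVneq (fcoef X (t l) J) 0; first by rewrite mul0r.
rewrite IHk ?mulr0 //; apply: leq_ltn_trans Mt _; rewrite ltn_add2r.
rewrite /ht (bigD1 l) //= [X in (_ < X)%N](bigD1 l) //= ffunE /upd eqxx.
rewrite [X in (_ < _ + X)%N](eq_bigr (fun j => height (t j))) ?ltn_add2r //.
by move=> j jl; rewrite ffunE (negPf jl).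
Qed.

Variable i : nat.

Definition initial : {set 'I_n.+1} := [set j : 'I_n.+1 | (j < i)%N]%SET.

Lemma ftact_nplus_hw X : X \in @nplus C n -> ftact X (fpure C m initial) = 0.
Proof.
move=> /nplusP HX; rewrite /ftact /fpure tpow_leibniz.
- rewrite big1 // => k _; apply: (tpow_pure0 _ (k := k)).
    exact: fock_coord_lin.
  rewrite /upd eqxx /fock_act big1 // => -[a b] _ /=.
  have [ba|ab] := leqP b a; first by rewrite HX // scale0r.
  rewrite -fock_act_delta fock_delta_kill ?scaler0 //.
    by rewrite neq_ltn ab.
  by rewrite !inE; case: ltnP => //= ia; rewrite -leqNgt (leq_trans ia) // ltnW.
- exact: fock_coord_lin.
- exact: fock_expand.
- exact: fock_act_lin.
Qed.

Lemma ftact_nminus_hw X F : X \in @nminus C n ->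
  (ftact X F : {ffun _}) [ffun=> initial] = 0.
Proof.
move=> /nminusP HX; rewrite ffunE big1 // => k _; rewrite big1 // => L _.
rewrite ffunE fcoef_delta big1 ?mul0r // => -[a b] _ /=.
have [ab|ba] := leqP a b; first by rewrite HX // mul0r.
rewrite hopE /hop !inE; case: (ltnP a i) => ai; rewrite /= ?mulr0 //.
by rewrite (ltn_trans ba ai) neq_ltn ba /= mulr0.
Qed.

Lemma ftact_diag_pure X J : is_diag_mx X ->
  ftact X (fpure C m J) = ((\sum_(j in J) X j j) *+ m) *: fpure C m J.
Proof.
move=> dX; apply/ffunP => t; rewrite ftact_diag // [RHS]ffunE !fpureE.
case: eqP => [->|_]; last by rewrite mulr0 scaler0.
congr (_ * _); under eq_bigr do rewrite ffunE.
by rewrite sumr_const card_ord.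
Qed.

End Triangular.

(** * Levels below the highest weight *)

Section HeightFiltration.

Variables (C : numFieldType) (n : nat) (V : vectType C).
Variables (act : 'M[C]_n.+1 -> V -> V) (lam : C).
Hypothesis Lact : lie_module (@sln C n) act fullv.

(** The entries are equally spaced, so that the root vector of each root below the
    diagonal lowers eigenvalues by a multiple of the spacing; the constant makes the
    trace vanish. *)
Definition height_entry (j : 'I_n.+1) : C :=
  (\sum_(l < n.+1) l)%:R - (n.+1 * j)%:R.
Definition height_mx : 'M[C]_n.+1 := diag_mx (\row_j height_entry j).

Lemma height_cartan : height_mx \in @cartan C n.
Proof.
apply/cartanP; split; last exact: diag_mx_is_diag.
rewrite /mxtrace (eq_bigr height_entry) => [|j _]; last first.
  by rewrite mxE mxE eqxx.
rewrite sumrB sumr_const card_ord -natr_sum -big_distrr /= -mulrnA mulnC.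
by rewrite subrr.
Qed.

Let height_sln : height_mx \in @sln C n.
Proof. exact/borel_sln/cartan_borel/height_cartan. Qed.

Let lh : linear (act height_mx).
Proof. exact: lie_linear Lact _ height_sln. Qed.

Definition eigen_op (mu : C) (x : V) : V := act height_mx x - mu *: x.
Definition eigen_ops (mus : seq C) (x : V) : V := foldr eigen_op x mus.

Lemma eigen_op_lin mu : linear (eigen_op mu).
Proof.
move=> c x y; rewrite /eigen_op lh scalerDr opprD addrACA scalerBr !scalerA.
by rewrite [mu * c]mulrC.
Qed.

Lemma eigen_ops_lin mus : linear (eigen_ops mus).
Proof.
move=> c x y; elim: mus => //= mu mus ->; exact: eigen_op_lin.
Qed.

Lemma eigen_opC mu nu x : eigen_op mu (eigen_op nu x) = eigen_op nu (eigen_op mu x).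
Proof.
rewrite /eigen_op !(linD lh) !(linN lh) !(linZ lh) !scalerBr !opprB !scalerA.
rewrite [mu * nu]mulrC addrACA [RHS]addrACA; congr (_ + _).
exact: addrC.
Qed.

Lemma eigen_ops_op mus mu x :
  eigen_ops mus (eigen_op mu x) = eigen_op mu (eigen_ops mus x).
Proof. by elim: mus => //= nu mus ->; apply: eigen_opC. Qed.

Lemma eigen_opsC mus nus x :
  eigen_ops mus (eigen_ops nus x) = eigen_ops nus (eigen_ops mus x).
Proof. by elim: nus => //= nu nus IHn; rewrite eigen_ops_op IHn. Qed.

(** The sum of the generalized eigenspaces of the height matrix whose eigenvalues
    are at least [k] levels below [lam]. *)
Definition below (k : nat) (x : V) : Prop :=
  exists2 mus : seq C,
    (forall mu, mu \in mus -> exists2 j, (k <= j)%N & mu = lam - (n.+1 * j)%:R) &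
    eigen_ops mus x = 0.

Lemma below0 k : below k 0.
Proof. by exists [::]. Qed.

Lemma below_lin k c x y : below k x -> below k y -> below k (c *: x + y).
Proof.
move=> [mus mP mx] [nus nP ny]; exists (mus ++ nus).
  by move=> mu; rewrite mem_cat => /orP[/mP|/nP].
rewrite /eigen_ops foldr_cat -!/(eigen_ops _ _) (linD (eigen_ops_lin nus)) ny.
rewrite addr0 eigen_opsC (linZ (eigen_ops_lin mus)) mx scaler0.
exact: lin0 (eigen_ops_lin nus).
Qed.

Lemma below_weaken k k' x : (k <= k')%N -> below k' x -> below k x.
Proof.
move=> kk' [mus mP mx]; exists mus => // mu /mP[j k'j ->].
by exists j => //; apply: leq_trans k'j.
Qed.

Lemma delta_sln (a b : 'I_n.+1) : a != b -> delta_mx a b \in @sln C n.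
Proof.
move=> ab; rewrite sln_trace /mxtrace big1 // => c _; rewrite mxE.
by case: (c =P a) => // ->; rewrite (negPf ab).
Qed.

(** The height matrix and a root vector commute up to a multiple of the latter, which
    shifts eigenvalues. *)
Lemma below_delta k (a b : 'I_n.+1) x : (b < a)%N -> below k x ->
  below k.+1 (act (delta_mx a b) x).
Proof.
move=> ba [mus mP mx].
have sE : delta_mx a b \in @sln C n by rewrite delta_sln // neq_ltn ba orbT.
have lE := lie_linear Lact sE.
have brE : height_mx *m delta_mx a b - delta_mx a b *m height_mx =
    - (n.+1 * (a - b))%:R *: delta_mx a b.
  apply/matrixP => c d; rewrite mul_diag_mx mul_mx_diag !mxE.
  case: (c =P a) => [->|_] /=; last by rewrite mulr0 mul0r subrr mulr0.
  case: (d =P b) => [->|_] /=; last by rewrite mulr0 mul0r subrr mulr0.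
  rewrite mulr1 mul1r /height_entry opprB addrC addrA subrK mulr1.
  by rewrite mulnBr natrB ?leq_mul2l ?(ltnW ba) ?orbT // opprB.
have shift mu y : eigen_op (mu - (n.+1 * (a - b))%:R) (act (delta_mx a b) y) =
    act (delta_mx a b) (eigen_op mu y).
  rewrite /eigen_op (lie_actC Lact) // brE (lie_actZ Lact) ?sln0 //.
  rewrite (linD lE) (linN lE) (linZ lE) scalerBl opprB scaleNr addrA subrK.
  by [].
exists [seq mu - (n.+1 * (a - b))%:R | mu <- mus].
  move=> _ /mapP[mu /mP[j kj ->] ->]; exists (j + (a - b))%N.
    by rewrite -addn1 leq_add // subn_gt0.
  by rewrite mulnDr natrD opprD addrA.
suff -> : eigen_ops [seq mu - (n.+1 * (a - b))%:R | mu <- mus]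
    (act (delta_mx a b) x) = act (delta_mx a b) (eigen_ops mus x).
  by rewrite mx (lin0 lE).
by elim: mus {mP mx} => //= mu mus ->; rewrite shift.
Qed.

Lemma below_nminus k X x : X \in @nminus C n -> below k x -> below k.+1 (act X x).
Proof.
move=> /nminusP HX bx.
have XE : X = \sum_(ab : 'I_n.+1 * 'I_n.+1 | (ab.2 < ab.1)%N)
    X ab.1 ab.2 *: delta_mx ab.1 ab.2.
  rewrite {1}[X]matrix_sum_delta.
  rewrite (pair_bigA _ (fun a b => X a b *: delta_mx a b)) /= [RHS]big_mkcond.
  by apply: eq_bigr => -[a b] _ /=; case: ltnP => // /HX ->; rewrite scale0r.
have slnZ c Y : Y \in @sln C n -> c *: Y \in @sln C n.
  by rewrite !sln_trace linearZ /= => /eqP ->; rewrite mulr0.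
rewrite XE (lie_act_sum Lact) ?sln0 //; first last.
- by move=> [a b] /= ba; apply/slnZ/delta_sln; rewrite neq_ltn ba orbT.
- by move=> ? ?; apply: sln_add.
elim/big_ind: _ => [|y z By Bz|[a b] /= ba]; first exact: below0.
  by rewrite -[y]scale1r; apply: below_lin.
have sE : delta_mx a b \in @sln C n by rewrite delta_sln // neq_ltn ba orbT.
rewrite (lie_actZ Lact) ?sln0 // -[_ *: _]addr0.
by apply: below_lin; [apply: below_delta | apply: below0].
Qed.

Variable u : V.
Hypothesis hu : act height_mx u = lam *: u.
Hypothesis u0 : u != 0.

Lemma below_top : below 0 u.
Proof.
exists [:: lam]; last by rewrite /= /eigen_op hu subrr.
by move=> mu; rewrite inE => /eqP ->; exists 0%N; rewrite // muln0 subr0.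
Qed.

Lemma below_word X s : all (mem (@nminus C n)) (X :: s) ->
  below 1 (foldr act u (X :: s)).
Proof.
move=> /= /andP[nX ns]; apply: below_nminus => //.
elim: s ns => [_|Y s IHs /= /andP[nY ns]]; first exact: below_top.
by apply: (below_weaken (leqnSn 0)); apply: below_nminus => //; apply: IHs.
Qed.

(** The product of the differences between the top eigenvalue and the lower ones is
    nonzero. *)
Lemma below_not_top c l : below 1 l -> c *: u + l = 0 -> c = 0.
Proof.
move=> [mus mP ml] /eqP; rewrite addr_eq0 => /eqP cu.
have uE : eigen_ops mus u = (\prod_(mu <- mus) (lam - mu)) *: u.
  elim: mus {mP ml} => [|mu mus IHm] /=; first by rewrite big_nil scale1r.
  rewrite IHm /eigen_op (linZ lh) hu big_cons !scalerA -scalerBl.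
  by rewrite mulrBl mulrC.
have : eigen_ops mus (c *: u) = 0.
  by rewrite cu (linN (eigen_ops_lin mus)) ml oppr0.
rewrite (linZ (eigen_ops_lin mus)) uE scalerA => /eqP.
rewrite scaler_eq0 (negPf u0) orbF mulf_eq0 => /orP[/eqP //|].
rewrite -[_ == 0]negbK => /negP[]; rewrite prodf_seq_neq0; apply/allP => mu /mP[j j0 ->] /=.
by rewrite opprB addrC subrK pnatr_eq0 muln_eq0 /= -lt0n.
Qed.

End HeightFiltration.

(** * Realization of the simple module *)

Section Embedding.

Variables (C : numClosedFieldType) (n i m : nat) (V : vectType C).
Variable act : 'M[C]_n.+1 -> V -> V.
Hypothesis hV : simple_hw_module act (fundamental_weight n i *+ m).

Notation T := (ftens C n m).
Notation tact := (@ftact C n m).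
Notation lam := (fundamental_weight n i *+ m).
Notation uT := (fpure C m (initial n i)).
Notation g := (@sln C n).

Let Lact : lie_module g act fullv. Proof. by case: hV => -[]. Qed.

Lemma weight_evalE (H : 'M[C]_n.+1) (f : 'I_n.+1 -> nat) :
  weight_eval [ffun j => (f j)%:Z] H = \sum_j (f j)%:R * H j j.
Proof. by apply: eq_bigr => j _; rewrite ffunE. Qed.

Lemma fundamental_weightM :
  lam = [ffun j : 'I_n.+1 => (((j < i) * m)%N)%:Z].
Proof. by apply/ffunP => j; rewrite ffunMnE !ffunE -mulr_natr natz -PoszM. Qed.

Lemma tact_cartan_hw H : H \in @cartan C n -> tact H uT = weight_eval lam H *: uT.
Proof.
move=> /cartanP[_ dH]; rewrite ftact_diag_pure //; congr (_ *: _).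
rewrite fundamental_weightM weight_evalE big_mkcond /= -sumrMnl.
apply: eq_bigr => j _; rewrite inE; case: ltnP => _; rewrite ?mul1n ?mul0n.
  by rewrite mulr_natl.
by rewrite mul0r mul0rn.
Qed.

Let pact (X : 'M[C]_n.+1) (z : V * T) : V * T := (act X z.1, tact X z.2).

Let Ltact : lie_module g tact fullv. Proof. exact: ftact_lie. Qed.

Lemma pact_lie : lie_module (V := (V * T)%type) g pact fullv.
Proof.
have [_ a1 a2 a3] := Lact; have [_ b1 b2 b3] := Ltact; split.
- by move=> X z _ _; apply: memvf.
- move=> X gX z w _ _ c; rewrite /pact /=; congr pair.
    by apply: a1; rewrite ?memvf.
  by apply: b1; rewrite ?memvf.
- move=> X Y gX gY z _ c; rewrite /pact; congr pair.
    by apply: a2; rewrite ?memvf.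
  by apply: b2; rewrite ?memvf.
- move=> X Y gX gY z _; rewrite /pact; congr pair.
    by apply: a3; rewrite ?memvf.
  by apply: b3; rewrite ?memvf.
Qed.

Lemma foldr_pact s x y :
  foldr pact (x, y) s = (foldr act x s, foldr tact y s).
Proof. by elim: s => //= X s ->. Qed.

Lemma fpure_top : (uT : {ffun _}) [ffun=> initial n i] = 1.
Proof. by rewrite fpureE eqxx. Qed.

Lemma adjoint_sln X : X \in g -> adjoint X \in g.
Proof.
rewrite !sln_trace => /eqP trX; apply/eqP.
rewrite /mxtrace (eq_bigr (fun a => (X a a)^*)) => [|a _]; last by rewrite mxE.
by rewrite -rmorph_sum -[\sum_i0 _]/(\tr X) trX rmorph0.
Qed.

Section HighestWeight.

Variable u : V.
Hypothesis hu : weight_vector act lam u.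
Hypothesis nu : {in @nplus C n, forall X, act X u = 0}.

Let D : {vspace (V * T)%type} := Ug g pact (u, uT).

Lemma graph_stable X x y : X \in g -> (x, y) \in D -> (act X x, tact X y) \in D.
Proof.
by move=> gX; apply: (Ug_stable (lie_linear pact_lie) gX).
Qed.

Lemma graph_nminus : D = Ug (@nminus C n) pact (u, uT).
Proof.
apply: (Ug_split pact_lie (@sln_br C n) (@nminus_sln C n) (@borel_sln C n)).
  exact: sln_split.
move=> Z /borel_split[Z1 [Z2 [nZ1 hZ2 ->]]].
have gZ1 : Z1 \in g by apply: nplus_sln.
have gZ2 : Z2 \in g by apply/borel_sln/cartan_borel.
apply/vlineP; exists (weight_eval lam Z2); rewrite /pact /=.
rewrite (lie_actD Lact) // (lie_actD Ltact) // nu // ftact_nplus_hw //.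
by case: hu => _ ->; rewrite // tact_cartan_hw // !add0r.
Qed.

Let h0 := weight_eval lam (@height_mx C n).

(** The first components of the nonempty words lie strictly below the highest
    weight, so the coefficient of the generator can be read off on either side. *)
Lemma graph_top x y : (x, y) \in D ->
  exists c l, [/\ x = c *: u + l, below act h0 1 l &
    (y : {ffun _}) [ffun=> initial n i] = c].
Proof.
rewrite graph_nminus.
pose P (z : V * T) := exists c l, [/\ z.1 = c *: u + l, below act h0 1 l &
    (z.2 : {ffun _}) [ffun=> initial n i] = c].
suff : forall z, z \in Ug (@nminus C n) pact (u, uT) -> P z by move/(_ (x, y)).
apply: lspan_ind.
- by exists 0, 0; rewrite scale0r addr0 ffunE; split=> //; apply: below0.
- move=> c z w [cz [lz [z1 bz z2]]] [cw [lw [w1 bw w2]]].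
  exists (c * cz + cw), (c *: lz + lw); split.
  + by rewrite /= z1 w1 scalerDl scalerDr scalerA addrACA.
  + exact: below_lin.
  + by rewrite !ffunE z2 w2.
move=> _ [[|X s] ns ->].
  exists 1, 0; rewrite /= scale1r addr0; split=> //; first exact: below0.
  exact: fpure_top.
exists 0, (foldr act u (X :: s)); rewrite foldr_pact scale0r add0r; split=> //.
  by apply: below_word => //; case: hu => _ ->; rewrite // height_cartan.
by move: ns => /= /andP[nX _]; apply: ftact_nminus_hw.
Qed.

(** The fibre over zero is a submodule without highest weight component. By
    contravariance it is orthogonal to everything the highest weight vector
    generates, in particular to itself. *)
Lemma graph_fun y : (0, y) \in D -> y = 0.
Proof.
move=> Dy.
have top z : (0, z) \in D -> (z : {ffun _}) [ffun=> initial n i] = 0.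
  move=> /graph_top[c [l [/esym cl bl ->]]].
  case: hu => u0 wu; apply: below_not_top bl cl => //.
  by apply: wu; apply: height_cartan.
have orth s z : (0, z) \in D -> all (mem g) s -> fform z (foldr tact uT s) = 0.
  elim: s z => [|X s IHs] z Dz /=.
    move=> _; rewrite /fform (bigD1 [ffun=> initial n i]) //= top // mul0r add0r.
    rewrite big1 // => t tI; rewrite fpureE (negPf tI).
    by rewrite rmorph0 mulr0.
  move=> /andP[gX gs]; have gX' := adjoint_sln gX.
  have XE : X = adjoint (adjoint X) by apply/matrixP => a b; rewrite !mxE conjCK.
  rewrite XE -fform_adjoint; apply: IHs => //.
  have := graph_stable gX' Dz.
  by rewrite (lin0 (lie_linear Lact gX')).
apply: fform_eq0.
suff main w : w \in D -> fform y w.2 = 0 by apply: (main (0, y)).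
move: w; apply: lspan_ind.
- by rewrite /fform big1 // => t _; rewrite ffunE rmorph0 mulr0.
- by move=> c w w' w0 w'0; rewrite /= fform_linr w0 w'0 mulr0 addr0.
- by move=> _ [s gs ->]; rewrite foldr_pact; apply: orth.
Qed.

Let simple (U : {vspace V}) : stable g act U -> U = 0%VS \/ U = fullv.
Proof. by case: hV => -[_ _ +] _; apply. Qed.

(** Otherwise the simplicity of [V] would put the highest weight vector of [V], and
    then that of the tensor power, into the graph by itself. *)
Lemma graph_inj x : (x, 0) \in D -> x = 0.
Proof.
pose U := lspan [set x | (x, 0) \in D]%classic.
have UD z : z \in U -> (z, 0) \in D.
  move: z; apply: lspan_ind => //; first exact: mem0v.
  move=> c z w Dz Dw; have := memvD (memvZ c Dz) Dw.
  by rewrite [_ + _](_ : _ = (c *: z + w, 0)) //; congr pair; rewrite /= scaler0 addr0.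
have stU : stable g act U.
  move=> X z gX /UD Dz; apply: mem_lspan => /=.
  by have := graph_stable gX Dz; rewrite (lin0 (lie_linear Ltact gX)).
move=> Dx; have xU : x \in U by apply: mem_lspan.
case: (simple stU) => UE; first by move: xU; rewrite UE memv0 => /eqP.
have Du : (u, 0) \in D by apply: UD; rewrite UE memvf.
have DuT : (u, uT) \in D by apply: Ug_gen.
have /graph_fun : (0, uT) \in D.
  have := memvB DuT Du; rewrite [_ - _](_ : _ = (0, uT)) //.
  by congr pair; rewrite /= ?subrr ?subr0.
move=> /(congr1 (fun F : {ffun _} => F [ffun=> initial n i])).
rewrite fpure_top ffunE => /eqP; by rewrite oner_eq0.
Qed.

Lemma graph_total x : exists y, (x, y) \in D.
Proof.
pose U := lspan [set x | exists y, (x, y) \in D]%classic.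
have UD z : z \in U -> exists y, (z, y) \in D.
  move: z; apply: lspan_ind => //; first by exists 0; apply: mem0v.
  move=> c z w [y Dz] [y' Dw]; exists (c *: y + y').
  exact: (memvD (memvZ c Dz) Dw).
have stU : stable g act U.
  move=> X z gX /UD[y Dz]; apply: mem_lspan => /=.
  by exists (tact X y); apply: graph_stable.
apply: UD; case: (simple stU) => UE; last by rewrite UE memvf.
have uU : u \in U by apply: mem_lspan; exists uT; apply: Ug_gen.
by rewrite UE memv0 in uU; case: hu; rewrite uU.
Qed.

End HighestWeight.

(** Uniqueness of the simple module with a given highest weight, in the form needed
    here: the submodule of the product generated by the pair of highest weight
    vectors is the graph of an embedding. *)
Lemma fock_embedding : exists psi : V -> T,
  [/\ linear psi, forall x, psi x = 0 -> x = 0 &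
      forall X x, X \in g -> psi (act X x) = tact X (psi x)].
Proof.
have [u hu nu] := hV.2.
have [psi psiP] := choice (graph_total hu).
have uniq x y y' : (x, y) \in Ug g pact (u, uT) ->
    (x, y') \in Ug g pact (u, uT) -> y = y'.
  move=> Dy Dy'; apply/eqP; rewrite -subr_eq0; apply/eqP/(graph_fun hu nu).
  have := memvB Dy Dy'; rewrite [_ - _](_ : _ = (0, y - y')) //.
  by congr pair; rewrite /= subrr.
exists psi; split.
- move=> c x y; apply: (uniq (c *: x + y)) => //.
  exact: (memvD (memvZ c (psiP x)) (psiP y)).
- by move=> x px; apply: (graph_inj hu nu); rewrite -px.
- by move=> X x gX; apply: (uniq (act X x)) => //; apply: graph_stable.
Qed.

End Embedding.

(** * The polytope *)

Section RealPolytope.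

Variables (R : realType) (N : nat) (good : pred 'I_N) (le : rel 'I_N).
Hypothesis le_refl : reflexive le.
Hypothesis le_anti : antisymmetric le.
Hypothesis le_trans : transitive le.
Implicit Types (x : 'rV[R]_N) (p : 'rV[nat]_N) (c : {set 'I_N}).

Notation cpoint := (chain_point good le).
Notation pt := (@exponent_point R N).

Lemma exponent_pointE p k : pt p ord0 k = (p ord0 k)%:R.
Proof. by rewrite mxE. Qed.

Lemma exponent_point_inj : injective pt.
Proof.
move=> p q pq; apply: exponentP => k; apply/eqP.
by have := congr1 (fun x => x ord0 k) pq; rewrite !exponent_pointE => /eqP; rewrite eqr_nat.
Qed.

Lemma exponent_point_lattice p : is_lattice_point (pt p).
Proof. by move=> k; rewrite exponent_pointE natr_int. Qed.

Lemma exponent_point_sum (J : finType) (f : J -> 'rV[nat]_N) :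
  pt (\sum_j f j) = \sum_j pt (f j).
Proof.
apply/rowP => k; rewrite exponent_pointE exponent_sum summxE natr_sum.
by apply: eq_bigr => j _; rewrite exponent_pointE.
Qed.

(** The definition by points makes it a lattice polytope by construction; the chain
    inequalities serve as necessary conditions on its points. *)
Definition chain_polytope m : set 'rV[R]_N :=
  convex_hull [seq pt p | p <- chain_points good le m].

Definition chain_ineq (b : R) x : Prop :=
  [/\ forall k, 0 <= x ord0 k, forall k, ~~ good k -> x ord0 k = 0 &
      forall c, chain le c -> \sum_(k in c) x ord0 k <= b].

Lemma chain_point_ineq m p : cpoint m p -> chain_ineq m%:R (pt p).
Proof.
move=> /chain_pointP[gp cp]; split=> [k|k /gp pk|c /cp pc].
- by rewrite exponent_pointE ler0n.
- by rewrite exponent_pointE pk.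
- under eq_bigr do rewrite exponent_pointE.
  by rewrite -natr_sum ler_nat.
Qed.

Lemma chain_polytope_ineq m x : chain_polytope m x -> chain_ineq m%:R x.
Proof.
rewrite /chain_polytope; set s := map _ _; move=> [a [a0 a1 ->]].
have sP k : (k < size s)%N -> chain_ineq m%:R s`_k.
  move=> ks; have /mapP[p] := mem_nth 0 ks.
  by rewrite mem_chain_points // => cp ->; apply: chain_point_ineq.
split.
- move=> k; rewrite summxE sumr_ge0 // => j _; rewrite mxE mulr_ge0 //.
  by have [H _ _] := sP j (ltn_ord j).
- move=> k bk; rewrite summxE big1 // => j _; rewrite mxE.
  by have [_ H _] := sP j (ltn_ord j); rewrite H ?mulr0.
move=> c cc; under eq_bigr do rewrite summxE.
rewrite exchange_big /=; apply: (@Order.POrderTheory.le_trans _ _ (\sum_j a j * m%:R)).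
  apply: ler_sum => j _; under eq_bigr do rewrite mxE.
  rewrite -mulr_sumr ler_wpM2l //.
  by have [_ _ H] := sP j (ltn_ord j); apply: H.
by rewrite -mulr_suml a1 mul1r.
Qed.

Lemma lattice_ineq m x : chain_ineq m%:R x -> is_lattice_point x ->
  exists2 p, cpoint m p & x = pt p.
Proof.
move=> [x0 gx cx] lx.
pose p : 'rV[nat]_N := \row_k Num.truncn (x ord0 k).
have xp : x = pt p.
  apply/rowP => k; rewrite exponent_pointE mxE truncnK //.
  by rewrite natrEint lx x0.
exists p => //; apply/chain_pointP; split=> [k bk|c cc].
  apply/eqP; have := gx k bk; rewrite {1}xp exponent_pointE => /eqP.
  by rewrite pnatr_eq0.
have := cx c cc; rewrite (eq_bigr (fun k => (p ord0 k)%:R)) => [|k _].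
  by rewrite -natr_sum ler_nat.
by rewrite {1}xp exponent_pointE.
Qed.

Lemma chain_point_polytope m p : cpoint m p -> chain_polytope m (pt p).
Proof.
rewrite -(mem_chain_points good le_refl) => /(map_f pt) ps.
rewrite /chain_polytope; set s := map _ _ in ps *; have ks : (index (pt p) s < size s)%N by rewrite index_mem.
pose k0 := Ordinal ks.
exists (fun k => (k == k0)%:R); split.
- by move=> k; rewrite ler0n.
- by rewrite (bigD1 k0) //= eqxx big1 ?addr0 // => k /negPf ->.
- rewrite (bigD1 k0) //= eqxx scale1r nth_index // big1 ?addr0 // => k /negPf ->.
  by rewrite scale0r.
Qed.

Lemma chain_lattice_polytope m : lattice_polytope (chain_polytope m).
Proof.
eexists; last by []; move=> _ /mapP[p _ ->]; exact: exponent_point_lattice.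
Qed.

Lemma lattice_points_chain m :
  lattice_points (chain_polytope m) = [set pt p | p in [set p | cpoint m p]]%classic.
Proof.
apply/seteqP; split=> [x [Px lx]|_ [p cp <-]].
  have [p cp ->] := lattice_ineq (chain_polytope_ineq Px) lx.
  by exists p.
by split; [apply: chain_point_polytope | apply: exponent_point_lattice].
Qed.

Lemma minkowski_chain m r : minkowski r (lattice_points (chain_polytope m)) =
  [set pt p | p in [set p | cpoint (r * m) p]]%classic.
Proof.
rewrite lattice_points_chain; apply/seteqP; split=> [x [f fP ->]|_ [p cp <-]].
  have /choice[q qP] : forall k : 'I_r, exists p, cpoint m p /\ pt p = f k.
    by move=> k; have [p cp pf] := fP k; exists p.
  exists (\sum_k q k).
    by apply: chain_point_sum_fun => k; case: (qP k).
  by rewrite exponent_point_sum; apply: eq_bigr => k _; case: (qP k).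
have [f fP ->] := chain_point_split le_refl le_anti le_trans cp.
exists (fun k => pt (f k)); last exact: exponent_point_sum.
by move=> k; exists (f k) => //; apply: fP.
Qed.

(** A lattice point of the dilation satisfies the dilated inequalities, hence is a
    chain point of the dilated order, and those decompose. *)
Lemma chain_polytope_normal m : normal_polytope (chain_polytope m).
Proof.
move=> r r0 x [[y Py <-] lx]; rewrite minkowski_chain.
have [y0 gy cy] := chain_polytope_ineq Py.
have [|p cp ->] := @lattice_ineq (r * m) (r%:R *: y) _ lx; last by exists p.
split=> [k|k bk|c cc].
- by rewrite mxE mulr_ge0.
- by rewrite mxE gy ?mulr0.
- under eq_bigr do rewrite mxE.
  by rewrite -mulr_sumr natrM ler_wpM2l ?cy.
Qed.

Lemma minkowski_chain_card m r :
  (minkowski r (lattice_points (chain_polytope m)) #=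
    `I_(size (chain_points good le (r * m))))%card.
Proof.
rewrite minkowski_chain; set s := chain_points _ _ _.
have -> : [set pt p | p in [set p | cpoint (r * m) p]]%classic =
    [set pt (nth 0 s k) | k in `I_(size s)]%classic.
  apply/seteqP; split=> [_ [p cp <-]|_ [k ks <-]].
    have ps : p \in s by rewrite mem_chain_points.
    by exists (index p s); rewrite /= ?index_mem ?nth_index.
  exists (nth 0 s k) => //=.
  by rewrite -(mem_chain_points good le_refl) mem_nth.
apply: inj_card_eq => k l; rewrite !inE => ks ls /exponent_point_inj /eqP.
by rewrite nth_uniq ?chain_points_uniq // => /eqP.
Qed.

End RealPolytope.

Lemma mx_subE (R : zmodType) p q (A B : 'M[R]_(p, q)) a b :
  (A - B) a b = A a b - B a b.
Proof. by rewrite mxE; congr (_ + _); rewrite mxE. Qed.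

(** * Demazure modules *)

Section ExtremalWeight.

Variables (C : numClosedFieldType) (n i m : nat) (w : 'S_n.+1).
Hypothesis hi : (1 <= i <= n)%N.

Notation lam := (fundamental_weight n i *+ m).

Definition extremal_set : {set 'I_n.+1} := [set j : 'I_n.+1 | (w^-1%g j < i)%N]%SET.

Let I := extremal_set.

Lemma extremal_weight :
  weyl_act w lam = [ffun j : 'I_n.+1 => (((j \in I) * m)%N)%:Z].
Proof.
by apply/ffunP => j; rewrite ffunE fundamental_weightM !ffunE inE.
Qed.

Lemma extremal_weight_eval a b :
  weight_eval (weyl_act w lam) (delta_mx a a - delta_mx b b : 'M[C]_n.+1) =
  (((a \in I) * m)%N)%:R - (((b \in I) * m)%N)%:R.
Proof.
rewrite extremal_weight weight_evalE.
have deltaE c : \sum_j (((j \in I) * m)%N)%:R * (delta_mx c c : 'M[C]_n.+1) j j =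
    (((c \in I) * m)%N)%:R.
  rewrite (bigD1 c) //= mxE !eqxx mulr1 big1 ?addr0 // => j jc.
  by rewrite mxE (negPf jc) mulr0.
rewrite -[in RHS](deltaE a) -[in RHS](deltaE b) -sumrB; apply: eq_bigr => j _.
by rewrite -mulrBr; rewrite mx_subE.
Qed.

Lemma delta_diff_cartan a b : (delta_mx a a - delta_mx b b) \in @cartan C n.
Proof.
apply/cartanP; split.
  have trd c : \tr (delta_mx c c : 'M[C]_n.+1) = 1.
    rewrite /mxtrace (bigD1 c) //= mxE !eqxx big1 ?addr0 // => j jc.
    by rewrite mxE (negPf jc).
  by rewrite raddfB /= !trd subrr.
apply/is_diag_mxP => c d cd; rewrite !mxE.
have off e : (c == e) && (d == e) = false.
  by apply/negP => /andP[/eqP ce /eqP de]; case/eqP: cd; rewrite ce de.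
by rewrite !off subrr.
Qed.

(** The extremal weight space is a line: the coefficients of the weight at an
    element of the index set and at an element outside it differ by [m], which
    is the largest possible difference of two multiplicities. *)
Lemma extremal_weight_space (F : ftens C n m) :
    (forall H, H \in @cartan C n -> ftact H F = weight_eval (weyl_act w lam) H *: F) ->
  exists c, F = c *: fpure C m I.
Proof.
move=> wF; exists ((F : {ffun _}) [ffun=> I]); apply/ffunP => t.
rewrite [RHS]ffunE fpureE; case: eqP => [->|tI]; first exact: (esym (mulr1 _)).
rewrite scaler0; apply: contra_notP tI => /eqP Ft.
pose mult a := (\sum_(k < m) (a \in t k))%N.
have diagE a b : (mult a + (b \in I) * m = mult b + (a \in I) * m)%N.
  have hC := delta_diff_cartan a b.
  have /cartanP[_ dH] := hC.
  have := congr1 (fun G : {ffun _} => G t) (wF _ hC).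
  rewrite ftact_diag // [RHS]ffunE => /(mulIf Ft); rewrite extremal_weight_eval.
  have multE c : \sum_(k < m) \sum_(j in t k) (delta_mx c c : 'M[C]_n.+1) j j =
      (mult c)%:R.
    rewrite natr_sum; apply: eq_bigr => k _; rewrite big_mkcond (bigD1 c) //=.
    rewrite mxE !eqxx big1 ?addr0 => [|j jc]; first by case: ifP.
    by rewrite mxE (negPf jc) if_same.
  rewrite (_ : \sum_(k < m) _ = (mult a)%:R - (mult b)%:R); last first.
    rewrite -!multE -sumrB; apply: eq_bigr => k _; rewrite -sumrB.
    by apply: eq_bigr => j _; rewrite mx_subE.
  move=> /eqP; rewrite subr_eq addrAC eq_sym subr_eq -!natrD eqr_nat => /eqP <-.
  exact: addnC.
have mult_le a : (mult a <= m)%N.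
  rewrite -[leqRHS]card_ord -sum1_card; apply: leq_sum => k _.
  by case: (a \in t k).
have /andP[i0 im] := hi.
have aI : w ord0 \in I by rewrite inE permK.
have bI : w ord_max \notin I by rewrite inE permK -leqNgt.
have inI a : a \in I -> mult a = m.
  move=> aI'; apply/eqP; rewrite eqn_leq mult_le /=.
  have := diagE a (w ord_max); rewrite aI' (negPf bI) mul0n mul1n addn0 => ->.
  exact: leq_addl.
have outI b : b \notin I -> mult b = 0%N.
  move=> bI'; have := diagE (w ord0) b; rewrite aI (negPf bI') mul0n mul1n addn0.
  rewrite inI // => /eqP; rewrite -[X in X == _]add0n eqn_add2r eq_sym.
  by move/eqP.
apply/ffunP => k; rewrite ffunE; apply/finset.setP => a.
have [aI'|aI'] := boolP (a \in I).
  apply/negPn/negP => ak; have := inI a aI'; apply/eqP; rewrite neq_ltn.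
  rewrite /mult (bigD1 k) //= (negPf ak) add0n; apply/orP; left.
  apply: (@leq_ltn_trans (\sum_(j < m | j != k) 1)%N).
    by apply: leq_sum => j _; case: (a \in t j).
  rewrite -[X in (_ < X)%N]card_ord -sum1_card [X in (_ < X)%N](bigD1 k) //=.
have /eqP := outI a aI'; rewrite sum_nat_eq0 => /forallP/(_ k).
by rewrite eqb0 => /negPf.
Qed.

End ExtremalWeight.

Section FavourableDemazure.

Variables (R : realType) (n i m : nat) (w : 'S_n.+1) (V : vectType R[i]).
Variables (act : 'M[R[i]]_n.+1 -> V -> V) (v : V).
Hypothesis hi : (1 <= i <= n)%N.
Hypothesis hV : simple_hw_module act (fundamental_weight n i *+ m).
Hypothesis hv : weight_vector act (weyl_act w (fundamental_weight n i *+ m)) v.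

Notation C := R[i].
Notation I := (extremal_set i w).

Let Lact : lie_module (@sln C n) act fullv. Proof. by case: hV => -[]. Qed.
Let Lnplus : lie_module (@nplus C n) act fullv.
Proof. exact: sub_lie_module Lact _ (@nplus_sln C n). Qed.

Lemma ftens_extremal beta : adapted I beta ->
  extremal_cyclic I beta (@ftact C n m) (fpure C m I) m.
Proof.
move=> Hbeta; have := tpow_extremal (@fock_coord_lin C n) (@fock_expand C n) m
  Hbeta (fock_extremal C Hbeta).
by rewrite muln1.
Qed.

(** The embedding maps the generator into an extremal weight space of the tensor
    power, which is a line. *)
Lemma demazure_extremal beta : adapted I beta -> extremal_cyclic I beta act v m.
Proof.
move=> Hbeta; have [psi [lpsi inj eqv]] := fock_embedding hV.
have hC : {subset @cartan C n <= @sln C n} by move=> X /cartan_borel/borel_sln.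
have [c psiv] : exists c, psi v = c *: fpure C m I.
  apply: extremal_weight_space => // H hH.
  by rewrite -eqv ?hC //; case: hv => _ ->; rewrite // (linZ lpsi).
have c0 : c != 0.
  apply: contraNneq (proj1 hv) => c0; apply/eqP/inj.
  by rewrite psiv c0 scale0r.
apply: (extremal_transfer lpsi inj _ Lnplus c0 psiv (ftens_extremal Hbeta)).
by move=> X x /nplus_sln; apply: eqv.
Qed.

Lemma act_nilpotent X : X \in @nplus C n -> exists k, forall x, iter k (act X) x = 0.
Proof.
move=> nX; have [psi [lpsi inj eqv]] := fock_embedding hV.
have [k kP] := ftact_nilpotent m nX; exists k => x; apply: inj.
rewrite -[RHS](kP (psi x)); elim: k {kP} => //= k <-.
exact/eqv/nplus_sln.
Qed.

Lemma demazure_nplus : demazure act v = Ug (@nplus C n) act v.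
Proof.
apply: (@Ug_split _ _ _ _ _ (@cartan C n)).
- exact: sub_lie_module Lact _ (@borel_sln C n).
- exact: borel_br.
- exact: nplus_borel.
- exact: cartan_borel.
- exact: borel_split.
- by move=> H hH; case: hv => _ ->; rewrite // memvZ // memv_line.
Qed.

Lemma demazure_favourable : favourable act (demazure act v) v.
Proof.
have [beta Hbeta] := adapted_exists I; have [bij _ _] := Hbeta.
have ext := demazure_extremal Hbeta.
pose nest := nested (rrow beta) (rcol beta).
have anti : antisymmetric nest.
  by apply: nested_anti => k l; apply: root_index_inj.
have refl : reflexive nest by apply: nested_refl.
have trans : transitive nest by apply: nested_trans.
split.
- rewrite demazure_nplus; split.
    have [_ H1 H2 H3] := Lnplus; split.
    + by apply: Ug_stable => X; apply: lie_linear.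
    + by move=> X nX x y _ _; apply: H1; rewrite ?memvf.
    + by move=> X Y nX nY x _; apply: H2; rewrite ?memvf.
    + by move=> X Y nX nY x _; apply: H3; rewrite ?memvf.
  by move=> X /act_nilpotent[k kP]; exists k => x _.
- exact: demazure_nplus.
exists beta => //; exists (@chain_polytope R _ (moving I beta) nest m); split.
- exact: chain_lattice_polytope.
- exact: chain_polytope_normal.
- rewrite lattice_points_chain //; congr image; apply/seteqP.
  by split=> p /(essentialE Hbeta ext).
move=> r r0; have co_lin (j : 'I_(\dim {:V})) : linear (coord (vbasis {:V}) j : V -> C^o).
  by move=> c x y; rewrite linearP.
have coE (x : V) : x = \sum_(j < \dim {:V}) coord (vbasis {:V}) j x *: (vbasis {:V})`_j.
  exact: coord_vbasis (memvf x).
have dimE : \dim (Ug (@nplus C n) (@tensor_act C n V act r)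
    (pure_tensor (fun _ : 'I_r => v))) =
    size (chain_points (moving I beta) nest (r * m)).
  exact: (dim_Ug_chain Hbeta (tpow_extremal co_lin coE r Hbeta ext)).
by rewrite dimE; apply: minkowski_chain_card.
Qed.

End FavourableDemazure.

Theorem mainTheorem3 (R : realType) (n i m : nat) (w : 'S_n.+1)
    (V : vectType R[i]) (act : 'M[R[i]]_n.+1 -> V -> V) (v : V)
    (hi : (1 <= i <= n)%N)
    (hw : minimal_rep i w)
    (hV : simple_hw_module act (fundamental_weight n i *+ m))
    (hv : weight_vector act (weyl_act w (fundamental_weight n i *+ m)) v) :
  favourable act (demazure act v) v.
Proof. exact: demazure_favourable hi hV hv. Qed.
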